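(* Let $k\geq 2$ be an integer and let $\chi_1,\chi_2$ be primitive non-trivial Dirichlet characters with conductors $q_1,q_2$ such that $\chi_1\chi_2(-1)=(-1)^k$. Let $\gamma=\begin{pmatrix} a & b\\ c & d\end{pmatrix}\in\Gamma_0(q_1q_2)$ with $c>0$. Then $$S_{\chi_1,\chi_2,k}(\gamma)=\sum_{j\bmod c}\ \sum_{n\bmod q_1}\overline{\chi_1}(n)\,\overline{\chi_2}(j)\,B_1\!\left(\frac{j}{c}\right)B_{k-1}\!\left(\frac{aj}{c}+\frac{n}{q_1}\right).$$
   Context: Notation: $e(z)=\exp(2\pi i z)$; for a Dirichlet character $\chi$ of conductor $q$, $\tau(\chi)=\sum_{n\bmod q}\chi(n)e(n/q)$ is its Gauss sum. For $\gamma=\begin{pmatrix} a&b\\ c&d\end{pmatrix}\in\Gamma_0(q_1q_2)$ write $\psi(\gamma)=\chi_1(d)\overline{\chi_2}(d)$. The Eisenstein series is defined for $z$ in the upper half plane $\mathcal H$ by $$E_{\chi_1,\chi_2,k}(z)=2\sum_{N\geq 1}\sum_{A\mid N}\chi_1(A)\overline{\chi_2}(N/A)(N/A)^{k-1}e(Nz);$$ it satisfies $E_{\chi_1,\chi_2,k}(\gamma z)=\psi(\gamma)(cz+d)^kE_{\chi_1,\chi_2,k}(z)$ for $\gamma\in\Gamma_0(q_1q_2)$. Let $P_{k-2}(z;X,Y)=(Xz+Y)^{k-2}$. For $\gamma\in\Gamma_0(q_1q_2)$ and $X,Y\in\mathbb C$, define the period integral $\phi_{\chi_1,\chi_2,k}(\gamma,X,Y)=\int_\infty^{\gamma\infty}E_{\chi_1,\chi_2,k}(z)P_{k-2}(z;X,Y)\,dz$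 (path in $\mathcal H$; convergent by exponential decay of $E$ at the cusps). For $\gamma$ with $c\neq 0$ define $S_{\chi_1,\chi_2,k}(\gamma)=(-1)^k\tau(\overline{\chi_1})(k-1)\,\phi_{\chi_1,\chi_2,k}(\gamma,1,-a/c)$. Periodic Bernoulli functions: for $m\geq 1$, $B_m(x)=\mathcal B_m(\{x\})$ for $x\in\mathbb R\setminus\mathbb Z$, where $\mathcal B_m$ is the $m$-th Bernoulli polynomial and $\{x\}$ the fractional part, and $B_m(x)=0$ for $x\in\mathbb Z$ (so $B_1(x)=\{x\}-1/2$ for non-integer $x$). *)

(* Defs.v *)
From Stdlib Require Import Reals ZArith List Lia.
From Coquelicot Require Import Coquelicot.
Import ListNotations.
Open Scope R_scope.

Definition Rsum_nat (n : nat) (f : nat -> R) : R :=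
  fold_right Rplus 0 (map f (seq 0 n)).
Definition Csum_nat (n : nat) (f : nat -> C) : C :=
  fold_right Cplus (RtoC 0) (map f (seq 0 n)).

(* e(z) = exp(2 pi i z) *)
Definition e (z : C) : C :=
  (exp (-(2 * PI * Im z)) * cos (2 * PI * Re z),
   exp (-(2 * PI * Im z)) * sin (2 * PI * Re z)).

Definition is_dirichlet_char (q : Z) (chi : Z -> C) : Prop :=
  (0 < q)%Z /\
  (forall m n : Z, chi (m * n)%Z = (chi m * chi n)%C) /\
  (forall n : Z, chi (n + q)%Z = chi n) /\
  (forall n : Z, chi n = RtoC 0 <-> Z.gcd n q <> 1%Z).

(* chi is a primitive character of conductor q: it is a character mod q that
   is not induced from any proper divisor d of q, i.e. for every divisor d < q
   it is non-trivial on {n coprime to q, n = 1 mod d}. *)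
Definition primitive_char (q : Z) (chi : Z -> C) : Prop :=
  is_dirichlet_char q chi /\
  forall d : Z, (0 < d)%Z -> (d | q)%Z -> (d < q)%Z ->
    exists n : Z, Z.gcd n q = 1%Z /\ (d | n - 1)%Z /\ chi n <> RtoC 1.

Definition nontrivial_char (chi : Z -> C) : Prop :=
  exists n : Z, chi n <> RtoC 0 /\ chi n <> RtoC 1.

Definition in_Gamma0 (N a b c d : Z) : Prop :=
  (a * d - b * c = 1)%Z /\ (N | c)%Z.

Definition gauss_sum (q : Z) (chi : Z -> C) : C :=
  Csum_nat (Z.to_nat q)
    (fun n => (chi (Z.of_nat n) * e (RtoC (INR n / IZR q)))%C).

Definition eis_coeff (chi1 chi2 : Z -> C) (k N : nat) : C :=
  Csum_nat (S N) (fun A =>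
    if andb (1 <=? A)%nat (N mod A =? 0)%nat then
      (chi1 (Z.of_nat A) * Cconj (chi2 (Z.of_nat (N / A)))
        * RtoC (INR (N / A) ^ (k - 1)))%C
    else RtoC 0).

Definition eis_term (chi1 chi2 : Z -> C) (k : nat) (z : C) (n : nat) : C :=
  (eis_coeff chi1 chi2 k (S n) * e (RtoC (INR (S n)) * z))%C.

(* E_{chi1,chi2,k}(z) = 2 sum_{N>=1} ... e(Nz); the (absolutely convergent)
   series is summed componentwise *)
Definition Eisenstein (chi1 chi2 : Z -> C) (k : nat) (z : C) : C :=
  (RtoC 2 * (Series (fun n => Re (eis_term chi1 chi2 k z n)),
             Series (fun n => Im (eis_term chi1 chi2 k z n))))%C.

(* period integral phi(gamma, X, Y) = int_oo^{a/c} E(z) (Xz+Y)^(k-2) dz, taken along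
   the vertical path z = a/c + i t, t from +oo down to 0 (c <> 0):
   = - int_0^oo E(a/c + i t) (X(a/c+it)+Y)^(k-2) i dt *)
Definition period_phi (chi1 chi2 : Z -> C) (k : nat) (a c : Z) (X Y : C) : C :=
  RInt_gen (V := C_R_CompleteNormedModule)
    (fun t : R =>
       let z := (IZR a / IZR c, t) : C in
       (- (Ci * (Eisenstein chi1 chi2 k z * Cpow (X * z + Y) (k - 2))))%C)
    (at_right 0) (Rbar_locally p_infty).

Definition S_sum (chi1 chi2 : Z -> C) (q1 : Z) (k : nat) (a c : Z) : C :=
  (RtoC ((-1) ^ k) * gauss_sum q1 (fun n => Cconj (chi1 n)) * RtoC (INR k - 1)
   * period_phi chi1 chi2 k a c (RtoC 1) (RtoC (- (IZR a / IZR c))))%C.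

(* Bernoulli numbers (b_1 = -1/2): b_n = -1/(n+1) sum_{i<n} C(n+1,i) b_i *)
Fixpoint bern_list (n : nat) : list R :=
  match n with
  | O => [1]
  | S m => let l := bern_list m in
           l ++ [ - / INR (n + 1) *
                  Rsum_nat n (fun i => Binomial.C (n + 1) i * nth i l 0) ]
  end.
Definition bernoulli (n : nat) : R := nth n (bern_list n) 0.

Definition bernoulli_poly (m : nat) (x : R) : R :=
  Rsum_nat (S m) (fun j => Binomial.C m j * bernoulli j * x ^ (m - j)).

Definition Bper (m : nat) (x : R) : R :=
  if Req_EM_T (frac_part x) 0 then 0 else bernoulli_poly m (frac_part x).

(* Main.v *)
(* The proof never uses the modularity of E.  On z = a/c + it, expanding E as a double series
   over A, B >= 1 and integrating from t termwise gives sum_A chi1(A) A^-(k-1) G_A(A t), where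
   G_A(s) is the tail integral of sum_B conj(chi2 B) e(ABa/c) B^(k-1) exp(-2 PI B s) s^(k-2).
   The coefficients e(ABa/c) chi1(A) conj(chi2 B) are c-periodic and sum to zero over a period
   in A and in B, because q2 | c/q1 and q1 | c/q2.  Cancellation in B makes each
   sum_B conj(chi2 B) e(ABa/c) B^l exp(-2 PI B s) with chi1(A) <> 0 a rational function of
   exp(-2 PI s) without pole at 1, so G_A extends to s = 0 with value the Abel sum - sum_j B_1(j/c) conj(chi2 j) e(Aja/c), up to a constant.
   Cancellation in A makes blocks of length c of the A-sum O(1/p^2) uniformly in t, so one may
   let t tend to 0 termwise.  Finally tau(conj chi1) chi1(A) = sum_n conj(chi1 n) e(nA/q1), the
   parity (j,n) -> (-j,-n) and the Fourier series of B_(k-1) evaluate the sum over A; the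
   argument aj/c + n/q1 is an integer only where chi2(j) = 0. *)
Require Import Defs.
From Stdlib Require Import Reals ZArith List Lia Lra Permutation Znumtheory.
From Coquelicot Require Import Coquelicot.
Import ListNotations.
Open Scope R_scope.

(** * Finite sums and a mean value estimate *)


(** Write k = m + 2. The obstacle is that the A-sum carries only the weight A^-(m+1): for k = 2 it
    converges conditionally at t = 0, and there the B-sums do not converge at all. Hence no sum is
    exchanged with an integral. Repeated integration by parts ([iter_prim]) gives a primitive of the
    integrand that is a finite combination of power series in exp(-2 PI t); the rearrangement over A
    and B happens at fixed t > 0, and dominated convergence over blocks of A then reaches t = 0.

    B_1 appears because the Abel sum of a c-periodic f of mean zero is -(1/c) sum_j j f(j), and mean
    zero allows j/c to be replaced by j/c - 1/2.

    The constants cancel as follows. The primitive contributes m!/(2 PI)^(m+1) and the Fourier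
    series -(2 PI)^(m+1)/(2 (m+1)!); together with the factors 2 of E and k - 1 = m + 1 of S they
    give 1 up to sign. One i^(m+1) comes from dz and (z - a/c)^m, another from the parity step;
    their product (-1)^(m+1) meets the (-1)^k of S, and the remaining signs come from the direction
    of the path, the Abel sum and the Fourier series. *)

Lemma Rsum_nat_S n f : Rsum_nat (S n) f = Rsum_nat n f + f n.
Proof.
  unfold Rsum_nat. rewrite seq_S, map_app, fold_right_app. simpl.
  generalize (map f (seq 0 n)); intros l.
  induction l as [|x l IH]; simpl; [lra|]. rewrite IH. lra.
Qed.

Lemma Csum_nat_S n f : Csum_nat (S n) f = (Csum_nat n f + f n)%C.
Proof.
  unfold Csum_nat. rewrite seq_S, map_app, fold_right_app. simpl.
  generalize (map f (seq 0 n)); intros l.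
  induction l as [|x l IH]; simpl; [ring|]. rewrite IH. ring.
Qed.

Lemma Rsum_nat_ext n f g :
  (forall i, (i < n)%nat -> f i = g i) -> Rsum_nat n f = Rsum_nat n g.
Proof.
  intros H. unfold Rsum_nat. f_equal. apply map_ext_in.
  intros i Hi%in_seq. apply H. lia.
Qed.

Lemma Csum_nat_ext n f g :
  (forall i, (i < n)%nat -> f i = g i) -> Csum_nat n f = Csum_nat n g.
Proof.
  intros H. unfold Csum_nat. f_equal. apply map_ext_in.
  intros i Hi%in_seq. apply H. lia.
Qed.

Lemma Rsum_nat_0 n f : (forall i, (i < n)%nat -> f i = 0) -> Rsum_nat n f = 0.
Proof.
  induction n as [|n IH]; intros H; [reflexivity|].
  rewrite Rsum_nat_S, IH, H; auto; lra.
Qed.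

Lemma Csum_nat_0 n f : (forall i, (i < n)%nat -> f i = RtoC 0) -> Csum_nat n f = RtoC 0.
Proof.
  induction n as [|n IH]; intros H; [reflexivity|].
  rewrite Csum_nat_S, IH, H; auto. ring.
Qed.

Lemma Rsum_nat_plus n f g :
  Rsum_nat n (fun i => f i + g i) = Rsum_nat n f + Rsum_nat n g.
Proof.
  induction n as [|n IH]; [unfold Rsum_nat; simpl; lra|].
  rewrite !Rsum_nat_S, IH. lra.
Qed.

Lemma Rsum_nat_scal n x f : Rsum_nat n (fun i => x * f i) = x * Rsum_nat n f.
Proof.
  induction n as [|n IH]; [unfold Rsum_nat; simpl; lra|].
  rewrite !Rsum_nat_S, IH. lra.
Qed.

Lemma Csum_nat_plus n f g :
  Csum_nat n (fun i => f i + g i)%C = (Csum_nat n f + Csum_nat n g)%C.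
Proof.
  induction n as [|n IH]; [unfold Csum_nat; simpl; ring|].
  rewrite !Csum_nat_S, IH. ring.
Qed.

Lemma Csum_nat_scal n x f : Csum_nat n (fun i => x * f i)%C = (x * Csum_nat n f)%C.
Proof.
  induction n as [|n IH]; [unfold Csum_nat; simpl; ring|].
  rewrite !Csum_nat_S, IH. ring.
Qed.

Lemma Csum_nat_swap n p (f : nat -> nat -> C) :
  Csum_nat n (fun i => Csum_nat p (f i)) =
  Csum_nat p (fun j => Csum_nat n (fun i => f i j)).
Proof.
  induction n as [|n IH].
  - symmetry. apply Csum_nat_0. reflexivity.
  - rewrite Csum_nat_S, IH, <- Csum_nat_plus. apply Csum_nat_ext.
    intros. now rewrite Csum_nat_S.
Qed.

Lemma Rsum_nat_add n p f :
  Rsum_nat (n + p) f = Rsum_nat n f + Rsum_nat p (fun i => f (n + i)%nat).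
Proof.
  induction p as [|p IH].
  - rewrite Nat.add_0_r. unfold Rsum_nat at 3. simpl. lra.
  - rewrite Nat.add_succ_r, !Rsum_nat_S, IH. lra.
Qed.

Lemma Rsum_nat_Sl n f : Rsum_nat (S n) f = f 0%nat + Rsum_nat n (fun i => f (S i)).
Proof.
  change (S n) with (1 + n)%nat. rewrite Rsum_nat_add, Rsum_nat_S.
  unfold Rsum_nat at 1. simpl. lra.
Qed.

Lemma Rsum_nat_le n f g :
  (forall i, (i < n)%nat -> f i <= g i) -> Rsum_nat n f <= Rsum_nat n g.
Proof.
  induction n as [|n IH]; intros H; [unfold Rsum_nat; simpl; lra|].
  rewrite !Rsum_nat_S. apply Rplus_le_compat; auto.
Qed.

Lemma Rsum_nat_abs n f : Rabs (Rsum_nat n f) <= Rsum_nat n (fun i => Rabs (f i)).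
Proof.
  induction n as [|n IH].
  - unfold Rsum_nat. simpl. rewrite Rabs_R0. lra.
  - rewrite !Rsum_nat_S. eapply Rle_trans; [apply Rabs_triang|]. lra.
Qed.

Lemma Rsum_nat_const n x : Rsum_nat n (fun _ => x) = INR n * x.
Proof.
  induction n as [|n IH]; [unfold Rsum_nat; simpl; lra|].
  rewrite Rsum_nat_S, IH, S_INR. lra.
Qed.

Lemma Rsum_nat_bound n f K :
  (forall i, (i < n)%nat -> Rabs (f i) <= K) -> Rabs (Rsum_nat n f) <= INR n * K.
Proof.
  intros H. eapply Rle_trans; [apply Rsum_nat_abs|].
  rewrite <- Rsum_nat_const. now apply Rsum_nat_le.
Qed.

Lemma Csum_nat_pair n f :
  Csum_nat n f = (Rsum_nat n (fun i => Re (f i)), Rsum_nat n (fun i => Im (f i))).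
Proof.
  induction n as [|n IH]; [reflexivity|].
  rewrite Csum_nat_S, !Rsum_nat_S, IH. reflexivity.
Qed.

Lemma sum_n_Rsum_nat (a : nat -> R) n : sum_n a n = Rsum_nat (S n) a.
Proof.
  induction n as [|n IH].
  - rewrite sum_O. unfold Rsum_nat. simpl. lra.
  - rewrite sum_Sn, IH, (Rsum_nat_S (S n)). reflexivity.
Qed.

Lemma is_derive_Rsum_nat n (f df : nat -> R -> R) x :
  (forall i, (i < n)%nat -> is_derive (f i) x (df i x)) ->
  is_derive (fun y => Rsum_nat n (fun i => f i y)) x (Rsum_nat n (fun i => df i x)).
Proof.
  induction n as [|n IH]; intros H.
  - unfold Rsum_nat. simpl. apply (is_derive_const (V := R_NormedModule)).
  - apply (is_derive_ext (fun y => Rsum_nat n (fun i => f i y) + f n y)).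
    { intros y. now rewrite Rsum_nat_S. }
    rewrite Rsum_nat_S. apply (is_derive_plus (V := R_NormedModule)); auto.
Qed.

Lemma is_lim_seq_Rsum_nat n (f : nat -> nat -> R) (l : nat -> R) :
  (forall i, (i < n)%nat -> is_lim_seq (f i) (l i)) ->
  is_lim_seq (fun p => Rsum_nat n (fun i => f i p)) (Rsum_nat n l).
Proof.
  induction n as [|n IH]; intros H.
  - unfold Rsum_nat. simpl. apply is_lim_seq_const.
  - apply (is_lim_seq_ext (fun p => Rsum_nat n (fun i => f i p) + f n p)).
    { intros p. now rewrite Rsum_nat_S. }
    rewrite Rsum_nat_S. apply is_lim_seq_plus'; auto.
Qed.

Lemma filterlim_Rsum_nat {T} (F : (T -> Prop) -> Prop) {FF : Filter F} n
    (f : nat -> T -> R) (l : nat -> R) :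
  (forall i, (i < n)%nat -> filterlim (f i) F (locally (l i))) ->
  filterlim (fun t => Rsum_nat n (fun i => f i t)) F (locally (Rsum_nat n l)).
Proof.
  induction n as [|n IH]; intros H.
  - unfold Rsum_nat. simpl. apply filterlim_const.
  - apply (filterlim_ext (fun t => plus (Rsum_nat n (fun i => f i t)) (f n t))).
    { intros p. now rewrite Rsum_nat_S. }
    rewrite Rsum_nat_S.
    eapply filterlim_comp_2; [apply IH; auto | apply H; auto |].
    apply (filterlim_plus (V := R_NormedModule)).
Qed.

(** The derivative is controlled on the segment only: a symmetric ball around an endpoint would
    leave [0, 1], or come too close to 0, in the applications. *)
Lemma mvt_bound (f df : R -> R) D x y : x <= y ->
  (forall t, x <= t <= y -> is_derive f t (df t) /\ Rabs (df t) <= D) ->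
  Rabs (f y - f x) <= D * (y - x).
Proof.
  intros Hxy H.
  destruct (MVT_gen f x y df) as [t [Ht E]].
  - intros t. rewrite Rmin_left, Rmax_right by lra. intros Ht. apply H. lra.
  - intros t. rewrite Rmin_left, Rmax_right by lra. intros Ht.
    apply derivable_continuous_pt. exists (df t). apply is_derive_Reals, H, Ht.
  - rewrite Rmin_left, Rmax_right in Ht by lra.
    rewrite E, Rabs_mult, (Rabs_pos_eq (y - x)) by lra.
    apply Rmult_le_compat_r; [lra|]. now apply H.
Qed.

Lemma sum_inv_sq_bound N : Rsum_nat N (fun i => / INR (S i) ^ 2) <= 2.
Proof.
  destruct N as [|N]; [unfold Rsum_nat; simpl; lra|].
  (* The stronger bound makes the induction close: 1/n^2 <= 1/(n-1) - 1/n telescopes. *)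
  enough (H : Rsum_nat (S N) (fun i => / INR (S i) ^ 2) <= 2 - / INR (S N)).
  { assert (0 < / INR (S N)) by (apply Rinv_0_lt_compat, lt_0_INR; lia). lra. }
  induction N as [|N IH].
  - unfold Rsum_nat. simpl. lra.
  - rewrite Rsum_nat_S. pose proof (pos_INR N).
    enough (/ INR (S (S N)) ^ 2 <= / INR (S N) - / INR (S (S N))) by lra.
    rewrite (S_INR (S N)), (S_INR N).
    replace (/ (INR N + 1) - / (INR N + 1 + 1)) with (/ ((INR N + 1) * (INR N + 1 + 1)))
      by (field; lra).
    apply Rinv_le_contravar; nra.
Qed.

(** * Fourier expansion of the periodic Bernoulli functions *)


Lemma bern_list_length n : length (bern_list n) = S n.
Proof. induction n; simpl; [reflexivity|]. rewrite length_app, IHn. simpl. lia. Qed.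

(** Each list extends the previous one at its end, so entries never change. *)
Lemma nth_bern_list n i : (i <= n)%nat -> nth i (bern_list n) 0 = bernoulli i.
Proof.
  induction n as [|n IH]; intros Hi.
  - now replace i with 0%nat by lia.
  - destruct (Nat.eq_dec i (S n)) as [->|Hne]; [reflexivity|].
    rewrite <- IH by lia. simpl. rewrite app_nth1; [reflexivity|].
    rewrite bern_list_length. lia.
Qed.

(** The summand i = n has binomial coefficient n + 1, which cancels the prefactor in [bern_list]. *)
Lemma bernoulli_rec n : (1 <= n)%nat ->
  Rsum_nat (n + 1) (fun i => Binomial.C (n + 1) i * bernoulli i) = 0.
Proof.
  intros Hn. destruct n as [|m]; [lia|].
  rewrite Nat.add_1_r, Rsum_nat_S.
  assert (Hb : bernoulli (S m) = - / INR (S m + 1) *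
     Rsum_nat (S m) (fun i => Binomial.C (S m + 1) i * bernoulli i)).
  { unfold bernoulli at 1. cbn [bern_list].
    rewrite app_nth2; rewrite bern_list_length; [|lia].
    rewrite Nat.sub_diag. cbn [nth]. f_equal. apply Rsum_nat_ext.
    intros i Hi. rewrite nth_bern_list by lia. reflexivity. }
  rewrite Nat.add_1_r in Hb.
  replace (Binomial.C (S (S m)) (S m)) with (INR (S (S m))).
  - rewrite Hb at 1. field. apply not_0_INR. lia.
  - unfold Binomial.C. replace (S (S m) - S m)%nat with 1%nat by lia.
    rewrite (fact_simpl (S m)), mult_INR. simpl (fact 1). simpl (INR 1). field.
    apply INR_fact_neq_0.
Qed.

(** The difference of the two values is the sum in [bernoulli_rec] for n = m - 1. At m = 1 it is the
    jump of B_1. *)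
Lemma bernoulli_poly_at_0_1 m : (2 <= m)%nat -> bernoulli_poly m 0 = bernoulli_poly m 1.
Proof.
  intros Hm. unfold bernoulli_poly. rewrite !Rsum_nat_S. rewrite Nat.sub_diag.
  f_equal.
  transitivity 0.
  - apply Rsum_nat_0. intros i Hi. rewrite pow_i by lia. ring.
  - symmetry. rewrite <- (bernoulli_rec (m - 1)) by lia.
    replace (m - 1 + 1)%nat with m by lia.
    apply Rsum_nat_ext. intros i Hi. rewrite pow1. ring.
Qed.

Lemma is_derive_bernoulli_poly m x :
  is_derive (bernoulli_poly (S m)) x (INR (S m) * bernoulli_poly m x).
Proof.
  unfold bernoulli_poly.
  replace (INR (S m) * _) with
    (Rsum_nat (S (S m)) (fun j => Binomial.C (S m) j * bernoulli j *
        (INR (S m - j) * x ^ pred (S m - j)))).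
  - apply (is_derive_Rsum_nat (S (S m))
      (fun j x => Binomial.C (S m) j * bernoulli j * x ^ (S m - j))
      (fun j x => Binomial.C (S m) j * bernoulli j *
        (INR (S m - j) * x ^ pred (S m - j)))).
    intros i Hi. generalize (S m - i)%nat. intros n. auto_derive; [exact I|]. ring.
  - rewrite Rsum_nat_S, Nat.sub_diag, <- Rsum_nat_scal.
    simpl (INR 0). rewrite Rmult_0_l, Rmult_0_r, Rplus_0_r.
    apply Rsum_nat_ext. intros j Hj.
    replace (pred (S m - j)) with (m - j)%nat by lia.
    replace (Binomial.C (S m) j * bernoulli j * (INR (S m - j) * x ^ (m - j)))
      with (Binomial.C (S m) j * INR (S m - j) * (bernoulli j * x ^ (m - j))) by ring.
    replace (INR (S m) * (Binomial.C m j * bernoulli j * x ^ (m - j)))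
      with (INR (S m) * Binomial.C m j * (bernoulli j * x ^ (m - j))) by ring.
    f_equal. unfold Binomial.C.
    replace (S m - j)%nat with (S (m - j)) by lia.
    rewrite (fact_simpl m), (fact_simpl (m - j)), !mult_INR. field.
    repeat split; try apply INR_fact_neq_0. apply not_0_INR. lia.
Qed.

Lemma bernoulli_poly_0 x : bernoulli_poly 0 x = 1.
Proof.
  unfold bernoulli_poly, Rsum_nat, bernoulli, Binomial.C. simpl. field.
Qed.

Lemma bernoulli_poly_1 x : bernoulli_poly 1 x = x - 1 / 2.
Proof.
  unfold bernoulli_poly, Rsum_nat, bernoulli, Binomial.C, bern_list, Rsum_nat, Binomial.C.
  simpl. field.
Qed.

Lemma Rdiv_lt_arch K eps : 0 < eps ->
  exists N0 : nat, forall N, (N0 <= N)%nat -> K / INR (S N) <= eps.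
Proof.
  intros He. destruct (nfloor_ex (Rmax 0 (K / eps))) as [N0 HN0]; [apply Rmax_l|].
  exists N0. intros N HN.
  assert (HS : 0 < INR (S N)) by (apply lt_0_INR; lia).
  apply Rle_div_l; [exact HS|].
  assert (K / eps <= INR (S N)).
  { apply Rle_trans with (Rmax 0 (K / eps)); [apply Rmax_r|].
    apply Rle_trans with (INR N0 + 1); [lra|]. rewrite <- S_INR. apply le_INR. lia. }
  apply Rle_div_l in H; lra.
Qed.

(** The phase m PI / 2 treats sine and cosine series at once: differentiating in x lowers m by one
    and multiplies by 2 PI, without signs. *)
Definition trig_sum (m N : nat) (x : R) : R :=
  Rsum_nat N (fun i =>
    cos (2 * PI * INR (S i) * x - INR m * (PI / 2)) / INR (S i) ^ m).

(** Error of the truncated Fourier series of B_m on (0, 1), normalised so that the derivative of the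
    error for m + 1 is 2 PI times the error for m. *)
Definition trig_err (m N : nat) (x : R) : R :=
  trig_sum m N x + (2 * PI) ^ m / (2 * INR (fact m)) * bernoulli_poly m x.

Lemma cos_minus_pi2 y : cos (y - PI / 2) = sin y.
Proof. rewrite cos_minus, cos_PI2, sin_PI2. ring. Qed.

Lemma is_derive_trig_err m N x :
  is_derive (trig_err (S m) N) x (2 * PI * trig_err m N x).
Proof.
  unfold trig_err. rewrite Rmult_plus_distr_l.
  apply (is_derive_plus (V := R_NormedModule)).
  - unfold trig_sum. rewrite <- Rsum_nat_scal.
    apply (is_derive_Rsum_nat N
      (fun i x => cos (2 * PI * INR (S i) * x - INR (S m) * (PI / 2)) / INR (S i) ^ (S m))
      (fun i x => 2 * PI * (cos (2 * PI * INR (S i) * x - INR m * (PI / 2)) / INR (S i) ^ m))).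
    intros i _.
    assert (Hi : INR (S i) <> 0) by (apply not_0_INR; lia).
    replace (cos (2 * PI * INR (S i) * x - INR m * (PI / 2)))
      with (- sin (2 * PI * INR (S i) * x - INR (S m) * (PI / 2))).
    + revert Hi. generalize (INR (S i)), (INR (S m) * (PI / 2)). intros r p Hr.
      auto_derive; [exact I|]. unfold Rminus.
      field. split; [apply pow_nonzero; exact Hr | exact Hr].
    + rewrite <- (cos_minus_pi2 (_ - _)).
      replace (2 * PI * INR (S i) * x - INR (S m) * (PI / 2) - PI / 2)
        with (2 * PI * INR (S i) * x - INR m * (PI / 2) - PI)
        by (rewrite (S_INR m); field).
      rewrite cos_minus, cos_PI, sin_PI. ring.
  - replace (2 * PI * ((2 * PI) ^ m / (2 * INR (fact m)) * bernoulli_poly m x))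
      with ((2 * PI) ^ (S m) / (2 * INR (fact (S m))) * (INR (S m) * bernoulli_poly m x)).
    + apply (is_derive_scal (bernoulli_poly (S m))), is_derive_bernoulli_poly.
    + rewrite fact_simpl, mult_INR, <- tech_pow_Rmult. field.
      split; [apply INR_fact_neq_0 | apply not_0_INR; lia].
Qed.

(** Half of 1 + 2 [trig_sum 0] is [trig_err 0], so this puts the derivative of [trig_err 1] in
    closed form. *)
Lemma dirichlet_kernel N y :
  sin (PI * y) * (1 + 2 * trig_sum 0 N y) = sin ((2 * INR N + 1) * (PI * y)).
Proof.
  induction N as [|N IH].
  - unfold trig_sum, Rsum_nat. simpl. replace ((2 * 0 + 1) * (PI * y)) with (PI * y) by ring.
    ring.
  - unfold trig_sum in *. rewrite Rsum_nat_S.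
    transitivity (sin ((2 * INR N + 1) * (PI * y)) +
      2 * (sin (PI * y) * cos (2 * PI * INR (S N) * y))).
    { rewrite <- IH. simpl (INR 0). rewrite Rmult_0_l, Rminus_0_r. simpl (_ ^ 0).
      field. }
    replace ((2 * INR N + 1) * (PI * y)) with (2 * PI * INR (S N) * y - PI * y)
      by (rewrite S_INR; ring).
    replace ((2 * INR (S N) + 1) * (PI * y)) with (2 * PI * INR (S N) * y + PI * y) by ring.
    rewrite sin_plus, sin_minus. ring.
Qed.

Lemma sin_pi_lower d y : 0 < d -> d <= y <= 1 - d -> sin (PI * d) <= sin (PI * y).
Proof.
  intros Hd Hy. pose proof PI_RGT_0.
  destruct (Rle_dec y (1 / 2)).
  - apply sin_incr_1; nra.
  - replace (sin (PI * y)) with (sin (PI * (1 - y))).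
    + apply sin_incr_1; nra.
    + replace (PI * (1 - y)) with (PI - PI * y) by ring. apply sin_PI_x.
Qed.

(** Fixes the constant of integration: at 1/2 every sine and B_1 itself vanish. *)
Lemma trig_err_1_half N : trig_err 1 N (1 / 2) = 0.
Proof.
  unfold trig_err. rewrite bernoulli_poly_1.
  replace (trig_sum 1 N (1 / 2)) with 0; [field; apply INR_fact_neq_0|].
  symmetry. apply Rsum_nat_0. intros i _.
  replace (cos _) with 0; [unfold Rdiv; ring|]. simpl (INR 1). rewrite Rmult_1_l, cos_minus_pi2.
  replace (2 * PI * INR (S i) * (1 / 2)) with (0 + IZR (Z.of_nat (S i)) * PI)
    by (rewrite <- INR_IZR_INZ; field).
  symmetry. rewrite Rplus_0_l. apply sin_eq_0_1. now exists (Z.of_nat (S i)).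
Qed.

(** Uniformity is asked on compact subsets of (0, 1) because B_1 jumps at the integers. *)
Definition unif_null (f : nat -> R -> R) : Prop :=
  forall d eps : R, 0 < d < 1 / 2 -> 0 < eps ->
  exists N0 : nat, forall N x, (N0 <= N)%nat -> d <= x <= 1 - d -> Rabs (f N x) <= eps.

(* Integrating [PI sin(l y) / sin(PI y)] by parts gains the factor [1 / l]. *)
Lemma trig_err_1_bound d N x : 0 < d < 1 / 2 -> d <= x <= 1 - d ->
  let s := sin (PI * d) in
  Rabs (trig_err 1 N x) <= (PI / (s * s) + 2 / s) / INR (S N).
Proof.
  intros Hd Hx s. pose proof PI_RGT_0 as HPI.
  assert (Hs : 0 < s) by (apply sin_gt_0; nra).
  set (l := (2 * INR N + 1) * PI).
  pose proof (pos_INR N) as HN.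
  assert (Hl : PI * INR (S N) <= l) by (unfold l; rewrite S_INR; nra).
  assert (HSN : 0 < INR (S N)) by (apply lt_0_INR; lia).
  assert (Hl1 : 0 < PI * INR (S N)) by (apply Rmult_lt_0_compat; lra).
  assert (Hl0 : 0 < l) by lra.
  assert (Hlow : forall y, d <= y <= 1 - d -> s <= sin (PI * y)).
  { intros y Hy. apply sin_pi_lower; lra. }
  (* Boundary term of the integration by parts. Adding it to [trig_err 1] cancels the oscillating PI
     sin(l y) / sin(PI y) and leaves a derivative of size 1/l. *)
  pose (u := fun y => PI * cos (l * y) / (l * sin (PI * y))).
  assert (Hu : forall y, d <= y <= 1 - d -> Rabs (u y) <= / (s * INR (S N))).
  { intros y Hy. specialize (Hlow y Hy). unfold u, Rdiv.
    rewrite !Rabs_mult, (Rabs_pos_eq PI) by lra.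
    rewrite Rabs_inv, (Rabs_pos_eq (l * _)) by (apply Rmult_le_pos; lra).
    apply Rle_trans with (PI * 1 * / (PI * INR (S N) * s)).
    - apply Rmult_le_compat.
      + apply Rmult_le_pos; [lra|apply Rabs_pos].
      + left. apply Rinv_0_lt_compat. nra.
      + apply Rmult_le_compat_l; [lra|]. apply Rabs_le, COS_bound.
      + apply Rinv_le_contravar; [apply Rmult_lt_0_compat; nra|].
        apply Rmult_le_compat; nra.
    - right. field. lra. }
  pose (h := fun y => trig_err 1 N y + u y).
  assert (Hh : Rabs (h x - h (1 / 2)) <= (PI / (s * s) / INR (S N)) * Rabs (x - 1 / 2)).
  { apply (bounded_variation h
      (fun y => - (PI * PI) * cos (l * y) * cos (PI * y) / (l * (sin (PI * y) * sin (PI * y))))).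
    intros y Hy.
    assert (Hy' : d <= y <= 1 - d).
    { revert Hy. unfold Rabs. repeat destruct Rcase_abs; lra. }
    specialize (Hlow y Hy'). split.
    - unfold h.
      replace (- (PI * PI) * _ * _ / _) with
        (2 * PI * trig_err 0 N y +
         (PI * (- l * sin (l * y)) / (l * sin (PI * y))
          - PI * cos (l * y) * (l * (PI * cos (PI * y))) / (l * sin (PI * y)) ^ 2)).
      + apply (is_derive_plus (V := R_NormedModule)); [apply is_derive_trig_err|].
        unfold u. auto_derive; [nra|]. field. lra.
      + pose proof (dirichlet_kernel N y) as HD.
        replace ((2 * INR N + 1) * (PI * y)) with (l * y) in HD by (unfold l; ring).
        rewrite <- HD. unfold trig_err. rewrite bernoulli_poly_0. simpl (fact 0).
        simpl (INR 1). field. lra.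
    - unfold Rdiv. rewrite !Rabs_mult, Rabs_Ropp, Rabs_inv.
      rewrite (Rabs_pos_eq (PI * PI)) by nra.
      rewrite (Rabs_pos_eq (l * _)) by (apply Rmult_le_pos; nra).
      apply Rle_trans with (PI * PI * 1 * 1 * / (PI * INR (S N) * (s * s))).
      + apply Rmult_le_compat.
        * apply Rmult_le_pos; [apply Rmult_le_pos; [nra|] |]; apply Rabs_pos.
        * left. apply Rinv_0_lt_compat. apply Rmult_lt_0_compat; nra.
        * apply Rmult_le_compat; [|apply Rabs_pos| |apply Rabs_le, COS_bound].
          { apply Rmult_le_pos; [nra|apply Rabs_pos]. }
          apply Rmult_le_compat_l; [nra|]. apply Rabs_le, COS_bound.
        * apply Rinv_le_contravar; [apply Rmult_lt_0_compat; nra|].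
          apply Rmult_le_compat; nra.
      + right. field. lra. }
  assert (Hhalf : Rabs (u (1 / 2)) <= / (s * INR (S N))) by (apply Hu; lra).
  specialize (Hu x Hx).
  assert (Hx2 : Rabs (x - 1 / 2) <= 1) by (apply Rabs_le; lra).
  assert (E : trig_err 1 N x = (h x - h (1 / 2)) + (u (1 / 2) - u x)).
  { unfold h. rewrite trig_err_1_half. ring. }
  rewrite E. eapply Rle_trans; [apply Rabs_triang|].
  replace ((PI / (s * s) + 2 / s) / INR (S N)) with
    (PI / (s * s) / INR (S N) * 1 + (/ (s * INR (S N)) + / (s * INR (S N)))) by (field; lra).
  apply Rplus_le_compat.
  - eapply Rle_trans; [exact Hh|]. apply Rmult_le_compat_l; [|exact Hx2].
    apply Rmult_le_pos; [|left; now apply Rinv_0_lt_compat].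
    apply Rmult_le_pos; [lra|]. left. apply Rinv_0_lt_compat. nra.
  - unfold Rminus. eapply Rle_trans; [apply Rabs_triang|]. rewrite Rabs_Ropp. lra.
Qed.

Lemma trig_err_1_null : unif_null (trig_err 1).
Proof.
  intros d eps Hd He.
  destruct (Rdiv_lt_arch (PI / (sin (PI * d) * sin (PI * d)) + 2 / sin (PI * d)) eps He)
    as [N0 HN0].
  exists N0. intros N x HN Hx.
  eapply Rle_trans; [apply (trig_err_1_bound d); assumption|]. now apply HN0.
Qed.

Lemma trig_sum_bound m N x : (2 <= m)%nat -> Rabs (trig_sum m N x) <= 2.
Proof.
  intros Hm. eapply Rle_trans; [apply Rsum_nat_abs|].
  eapply Rle_trans; [|apply (sum_inv_sq_bound N)].
  apply Rsum_nat_le. intros i _.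
  assert (H1 : 1 <= INR (S i)) by (change 1 with (INR 1); apply le_INR; lia).
  unfold Rdiv. rewrite Rabs_mult, Rabs_inv, <- RPow_abs, (Rabs_pos_eq (INR (S i))) by lra.
  rewrite <- (Rmult_1_l (/ INR (S i) ^ 2)).
  apply Rmult_le_compat; [apply Rabs_pos | | apply Rabs_le, COS_bound |].
  - left. apply Rinv_0_lt_compat, pow_lt. lra.
  - apply Rinv_le_contravar; [apply pow_lt; lra|]. apply Rle_pow; [lra|lia].
Qed.

(** A crude bound that includes the endpoints; it controls the short intervals [0, d] and [1 - d, 1]
    in the induction step. *)
Lemma trig_err_bound m : (2 <= m)%nat ->
  exists K, 0 < K /\ forall N x, 0 <= x <= 1 -> Rabs (trig_err m N x) <= K.
Proof.
  intros Hm.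
  destruct (continuity_ab_maj (fun x => Rabs (bernoulli_poly m x)) 0 1) as [z [Hz _]]; [lra| |].
  { intros x _. apply (continuity_pt_comp (bernoulli_poly m) Rabs); [|apply Rcontinuity_abs].
    destruct m as [|m]; [lia|]. apply derivable_continuous_pt.
    eexists. apply is_derive_Reals, is_derive_bernoulli_poly. }
  set (B := Rabs (bernoulli_poly m z)) in *.
  set (q := (2 * PI) ^ m / (2 * INR (fact m))).
  exists (2 + Rabs q * B + 1). split.
  { assert (0 <= Rabs q * B) by (apply Rmult_le_pos; apply Rabs_pos). lra. }
  intros N x Hx. unfold trig_err. eapply Rle_trans; [apply Rabs_triang|].
  pose proof (trig_sum_bound m N x Hm). rewrite Rabs_mult. fold q.
  enough (Rabs q * Rabs (bernoulli_poly m x) <= Rabs q * B) by lra.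
  apply Rmult_le_compat_l; [apply Rabs_pos | apply Hz; exact Hx].
Qed.

Lemma trig_sum_1_0 m N : trig_sum m N 1 = trig_sum m N 0.
Proof.
  apply Rsum_nat_ext. intros i _. f_equal.
  replace (2 * PI * INR (S i) * 1 - INR m * (PI / 2)) with
    (2 * PI * INR (S i) * 0 - INR m * (PI / 2) + 2 * INR (S i) * PI) by ring.
  apply cos_period.
Qed.

(* The null sequence for [m] makes [trig_err (m+1)] almost constant, and the constant has to
   vanish because the primitive [trig_err (m+2)] takes equal values at 0 and 1. *)
Lemma trig_err_step m : (1 <= m)%nat -> unif_null (trig_err m) -> unif_null (trig_err (S m)).
Proof.
  intros Hm IH d0 eps Hd0 Heps.
  destruct (trig_err_bound (S m)) as [K [HK HB]]; [lia|].
  pose proof PI_RGT_0 as HPI.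
  (* The three bounds on d make [d, 1 - d] contain x, keep 1 - 2 d >= 1/2, and make the two end
     intervals contribute at most eps/16 each, up to 2 PI. *)
  set (d := Rmin d0 (Rmin (1 / 4) (eps / (16 * K)))).
  assert (Hd1 : d <= d0) by apply Rmin_l.
  assert (Hd2 : d <= 1 / 4) by (eapply Rle_trans; [apply Rmin_r | apply Rmin_l]).
  assert (Hd3 : d <= eps / (16 * K)) by (eapply Rle_trans; [apply Rmin_r | apply Rmin_r]).
  assert (Hd : 0 < d).
  { repeat apply Rmin_glb_lt; try lra. apply Rdiv_lt_0_compat; lra. }
  assert (Hd4 : d * K <= eps / 16).
  { apply Rle_div_r in Hd3; lra. }
  destruct (IH d (eps / (16 * PI))) as [N0 HN0]; [lra | apply Rdiv_lt_0_compat; lra |].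
  exists N0. intros N x HN Hx.
  set (kap := trig_err (S m) N (1 / 2)).
  assert (Hflat : forall y, d <= y <= 1 - d -> Rabs (trig_err (S m) N y - kap) <= eps / 8).
  { intros y Hy.
    replace (eps / 8) with (2 * PI * (eps / (16 * PI)) * 1) by (field; lra).
    eapply Rle_trans.
    - apply (bounded_variation (trig_err (S m) N) (fun t => 2 * PI * trig_err m N t)
        (2 * PI * (eps / (16 * PI)))).
      intros t Ht. split; [apply is_derive_trig_err|].
      rewrite Rabs_mult, Rabs_pos_eq by lra. apply Rmult_le_compat_l; [lra|].
      apply HN0; [lia|]. revert Ht. unfold Rabs. repeat destruct Rcase_abs; lra.
    - apply Rmult_le_compat_l.
      + apply Rmult_le_pos; [lra|]. apply Rdiv_le_0_compat; lra.
      + apply Rabs_le. lra. }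
  (* On [d, 1 - d] the integral of [trig_err (S m)] is kap (1 - 2 d) up to a small error, while over
     [0, 1] it vanishes; this forces kap to be small. *)
  assert (Hin : Rabs ((trig_err (S (S m)) N (1 - d) - 2 * PI * kap * (1 - d))
                 - (trig_err (S (S m)) N d - 2 * PI * kap * d))
               <= 2 * PI * (eps / 8) * (1 - d - d)).
  { apply (mvt_bound (fun t => trig_err (S (S m)) N t - 2 * PI * kap * t)
      (fun t => 2 * PI * trig_err (S m) N t - 2 * PI * kap)); [lra|].
    intros t Ht. split.
    - apply (is_derive_minus (V := R_NormedModule)); [apply is_derive_trig_err|].
      auto_derive; [exact I|ring].
    - rewrite <- Rmult_minus_distr_l, Rabs_mult, Rabs_pos_eq by lra.
      apply Rmult_le_compat_l; [lra|]. apply Hflat. lra. }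
  assert (Hend : forall y z, 0 <= y <= z -> z <= 1 ->
     Rabs (trig_err (S (S m)) N z - trig_err (S (S m)) N y) <= 2 * PI * K * (z - y)).
  { intros y z Hyz Hz.
    apply (mvt_bound _ (fun t => 2 * PI * trig_err (S m) N t)); [lra|].
    intros t Ht. split; [apply is_derive_trig_err|].
    rewrite Rabs_mult, Rabs_pos_eq by lra. apply Rmult_le_compat_l; [lra|].
    apply HB. lra. }
  assert (H0 : trig_err (S (S m)) N 1 = trig_err (S (S m)) N 0).
  { unfold trig_err. rewrite trig_sum_1_0, bernoulli_poly_at_0_1 by lia. reflexivity. }
  pose proof (Hend 0 d ltac:(lra) ltac:(lra)) as He0.
  pose proof (Hend (1 - d) 1 ltac:(lra) ltac:(lra)) as He1.
  set (E1 := trig_err (S (S m)) N (1 - d)) in *.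
  set (E0 := trig_err (S (S m)) N d) in *.
  rewrite H0 in He1. set (Z0 := trig_err (S (S m)) N 0) in *.
  assert (Hk : Rabs (2 * PI * (kap * (1 - 2 * d))) <= 2 * PI * (eps / 4)).
  { replace (2 * PI * (kap * (1 - 2 * d))) with
      (- ((E1 - 2 * PI * kap * (1 - d)) - (E0 - 2 * PI * kap * d))
        - (Z0 - E1) - (E0 - Z0)) by ring.
    unfold Rminus at 1 2.
    eapply Rle_trans; [apply Rabs_triang|]. rewrite Rabs_Ropp.
    eapply Rle_trans; [apply Rplus_le_compat_r, Rabs_triang|]. rewrite !Rabs_Ropp.
    assert (PI * (d * K) <= PI * (eps / 16)) by (apply Rmult_le_compat_l; lra).
    assert (0 <= PI * (eps * d)) by (apply Rmult_le_pos; nra).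
    lra. }
  rewrite Rabs_mult, (Rabs_pos_eq (2 * PI)) in Hk by lra.
  apply Rmult_le_reg_l in Hk; [|lra].
  rewrite Rabs_mult, (Rabs_pos_eq (1 - 2 * d)) in Hk by lra.
  assert (Hk2 : Rabs kap <= eps / 2).
  { pose proof (Rabs_pos kap). nra. }
  specialize (Hflat x ltac:(lra)).
  replace (trig_err (S m) N x) with (trig_err (S m) N x - kap + kap) by ring.
  eapply Rle_trans; [apply Rabs_triang|]. lra.
Qed.

Lemma trig_err_null m : (1 <= m)%nat -> unif_null (trig_err m).
Proof.
  induction 1; [apply trig_err_1_null | now apply trig_err_step].
Qed.

Lemma trig_sum_lim m x : (1 <= m)%nat -> frac_part x <> 0 ->
  is_lim_seq (fun N => trig_sum m N x) (- ((2 * PI) ^ m / (2 * INR (fact m))) * Bper m x).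
Proof.
  intros Hm Hx.
  unfold Bper. destruct (Req_EM_T (frac_part x) 0) as [|_]; [contradiction|].
  destruct (base_fp x) as [Hf0 Hf1]. set (y := frac_part x) in *.
  apply (is_lim_seq_ext (fun N => trig_sum m N y)).
  { intros N. apply Rsum_nat_ext. intros i _. f_equal.
    assert (Exy : x = y + IZR (Int_part x)) by (unfold y, frac_part; ring).
    rewrite Exy, (INR_IZR_INZ (S i)).
    replace (2 * PI * IZR (Z.of_nat (S i)) * (y + IZR (Int_part x)) - INR m * (PI / 2))
      with (2 * PI * IZR (Z.of_nat (S i)) * y - INR m * (PI / 2) +
        2 * IZR (Z.of_nat (S i) * Int_part x) * PI) by (rewrite mult_IZR; ring).
    set (w := _ - INR m * (PI / 2)). generalize (Z.of_nat (S i) * Int_part x)%Z. intros n.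
    destruct (Z_le_gt_dec 0 n) as [Hn|Hn].
    - replace n with (Z.of_nat (Z.to_nat n)) by lia. rewrite <- INR_IZR_INZ.
      symmetry. apply cos_period.
    - rewrite <- (cos_period (w + 2 * IZR n * PI) (Z.to_nat (- n))).
      f_equal. rewrite INR_IZR_INZ, Z2Nat.id, opp_IZR by lia. ring. }
  set (q := (2 * PI) ^ m / (2 * INR (fact m))).
  apply is_lim_seq_spec. intros eps.
  set (d := Rmin (1 / 4) (Rmin y (1 - y))).
  assert (d <= 1 / 4) by apply Rmin_l.
  assert (d <= y) by (eapply Rle_trans; [apply Rmin_r | apply Rmin_l]).
  assert (d <= 1 - y) by (eapply Rle_trans; [apply Rmin_r | apply Rmin_r]).
  assert (0 < d) by (repeat apply Rmin_glb_lt; lra).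
  destruct (trig_err_null m Hm d (eps / 2)) as [N0 HN0];
    [lra | pose proof (cond_pos eps); lra |].
  exists N0. intros N HN. specialize (HN0 N y HN ltac:(lra)).
  unfold trig_err in HN0. fold q in HN0.
  replace (trig_sum m N y - - q * bernoulli_poly m y)
    with (trig_sum m N y + q * bernoulli_poly m y) by ring.
  pose proof (cond_pos eps). lra.
Qed.

(** * Power series with window-null coefficients *)


(** Dominated convergence for series, along any filter: it serves t -> 0+, t -> infinity, and the
    truncation P -> infinity. Summability of the limits is part of the conclusion because the
    limiting sum over A is only known to converge in this way. *)
Lemma tannery {T} (F : (T -> Prop) -> Prop) {FF : ProperFilter F}
    (u : nat -> T -> R) (M l : nat -> R) :
  F (fun t => forall p, Rabs (u p t) <= M p) -> ex_series M ->
  (forall p, filterlim (u p) F (locally (l p))) ->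
  ex_series l /\ filterlim (fun t => Series (fun p => u p t)) F (locally (Series l)).
Proof.
  intros HM HexM Hl.
  assert (HlM : forall p, Rabs (l p) <= M p).
  { intros p.
    apply (filterlim_le (F := F) (fun t => Rabs (u p t)) (fun _ => M p)
      (Rabs (l p)) (M p)).
    - revert HM. apply filter_imp. auto.
    - eapply filterlim_comp; [apply Hl|]. apply continuous_Rabs.
    - apply filterlim_const. }
  assert (Hexl : ex_series (fun p => Rabs (l p))).
  { apply (ex_series_le (K := R_AbsRing) (V := R_CompleteNormedModule) _ M); [|exact HexM].
    intros p. unfold norm. simpl. unfold abs. simpl. rewrite Rabs_Rabsolu. apply HlM. }
  split; [now apply ex_series_Rabs|].
  apply filterlim_locally. intros eps.
  assert (HMl : is_lim_seq (sum_n M) (Series M)) by exact (Series_correct _ HexM).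
  apply is_lim_seq_spec in HMl.
  (* One tail of M below eps/4 bounds the tails of both series; a third eps/4 goes to the finite
     part. *)
  destruct (HMl (mkposreal (eps / 4) ltac:(pose proof (cond_pos eps); lra))) as [N HN].
  specialize (HN N (le_n N)). simpl in HN.
  rewrite sum_n_Rsum_nat in HN.
  assert (Htail : forall a : nat -> R, (forall p, Rabs (a p) <= M p) ->
    Rabs (Series a - Rsum_nat (S N) a) <= eps / 4).
  { intros a Ha.
    assert (Hexa : ex_series (fun p => Rabs (a p))).
    { apply (ex_series_le (K := R_AbsRing) (V := R_CompleteNormedModule) _ M); [|exact HexM].
      intros p. unfold norm. simpl. unfold abs. simpl. rewrite Rabs_Rabsolu. apply Ha. }
    rewrite (Series_incr_n a (S N)); [|lia|now apply ex_series_Rabs].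
    rewrite (Series_incr_n M (S N)) in HN; [|lia|exact HexM].
    simpl (pred (S N)) in *. rewrite <- sum_n_Reals, sum_n_Rsum_nat in *.
    set (sa := Rsum_nat (S N) a) in *. set (sm := Rsum_nat (S N) M) in *.
    replace (sa + Series (fun k => a (S N + k)%nat) - sa)
      with (Series (fun k => a (S N + k)%nat)) by ring.
    eapply Rle_trans; [apply Series_Rabs|].
    { apply (ex_series_incr_n (fun k => Rabs (a k)) (S N)), Hexa. }
    apply Rle_trans with (Series (fun k => M (S N + k)%nat)).
    - apply Series_le.
      + intros n. split; [apply Rabs_pos | apply Ha].
      + apply (ex_series_incr_n M (S N)), HexM.
    - rewrite <- Rabs_Ropp in HN.
      eapply Rle_trans; [apply Rle_abs|]. left. eapply Rle_lt_trans; [|exact HN].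
      right. f_equal. ring. }
  assert (Hfin : filterlim (fun t => Rsum_nat (S N) (fun p => u p t)) F
      (locally (Rsum_nat (S N) l))).
  { apply (filterlim_Rsum_nat F (S N) u l). intros; apply Hl. }
  pose proof (proj1 (filterlim_locally _ _) Hfin
     (mkposreal (eps / 4) ltac:(pose proof (cond_pos eps); lra))) as Hfin'.
  generalize (filter_and _ _ HM Hfin'). apply filter_imp. intros t [H1 H2].
  pose proof (Htail _ H1) as T1. pose proof (Htail _ HlM) as T2.
  unfold ball in *. simpl in *. unfold AbsRing_ball, abs, minus, plus, opp in *. simpl in *.
  revert T1 T2 H2.
  generalize (Series (fun p => u p t)), (Rsum_nat (S N) (fun p => u p t)),
    (Series l), (Rsum_nat (S N) l).
  intros a b x y T1 T2 H2. pose proof (cond_pos eps).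
  replace (a + - x) with ((a - b) + (b + - y) + - (x - y)) by ring.
  eapply Rle_lt_trans; [apply Rabs_triang|].
  eapply Rle_lt_trans; [apply Rplus_le_compat_r, Rabs_triang|].
  rewrite Rabs_Ropp. lra.
Qed.

Definition rad1 (a : nat -> R) : Prop := Rbar_le 1 (CV_radius a).

Lemma rad1_lt a x : rad1 a -> Rabs x < 1 -> Rbar_lt (Rabs x) (CV_radius a).
Proof. intros Ha Hx. eapply Rbar_lt_le_trans; [|exact Ha]. exact Hx. Qed.

Lemma rad1_bounded a K : (forall n, Rabs (a n) <= K) -> rad1 a.
Proof.
  intros H. apply (proj1 (CV_radius_bounded a) 1). exists K. intros n.
  rewrite pow1, Rmult_1_r. apply H.
Qed.

Lemma rad1_le a b : (forall n, Rabs (a n) <= b n) -> rad1 b -> rad1 a.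
Proof.
  intros H Hb. eapply Rbar_le_trans; [exact Hb|].
  apply (proj2 (CV_radius_bounded b)). intros r [M HM].
  apply (proj1 (CV_radius_bounded a)). exists M. intros n.
  eapply Rle_trans; [|apply (HM n)]. rewrite !Rabs_mult.
  apply Rmult_le_compat_r; [apply Rabs_pos|].
  eapply Rle_trans; [apply H | apply Rle_abs].
Qed.

(** The coefficients n a_n are those of x times the derivative. *)
Lemma CV_radius_mult_n a : CV_radius (fun n => a n * INR n) = CV_radius a.
Proof.
  rewrite <- (CV_radius_derive a), <- (CV_radius_incr_1 (PS_derive a)).
  apply CV_radius_ext. intros [|n]; unfold PS_incr_1, PS_derive.
  - simpl. unfold zero. simpl. ring.
  - apply Rmult_comm.
Qed.

Lemma rad1_mult_pow a l : rad1 a -> rad1 (fun n => a n * INR n ^ l).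
Proof.
  intros Ha. unfold rad1. induction l as [|l IH].
  - erewrite CV_radius_ext; [exact Ha|]. intros n. simpl. ring.
  - erewrite CV_radius_ext; [rewrite CV_radius_mult_n; exact IH|].
    intros n. simpl. ring.
Qed.

Lemma rad1_shift a i : rad1 a -> rad1 (fun n => a (n + i)%nat).
Proof.
  intros Ha. unfold rad1. induction i as [|i IH].
  - erewrite CV_radius_ext; [exact Ha|]. intros n. now rewrite Nat.add_0_r.
  - rewrite <- CV_radius_decr_1 in IH. erewrite CV_radius_ext; [exact IH|].
    intros n. unfold PS_decr_1. f_equal. lia.
Qed.

Lemma rad1_plus a b : rad1 a -> rad1 b -> rad1 (fun n => a n + b n).
Proof.
  intros Ha Hb. eapply Rbar_le_trans; [|apply CV_radius_plus].
  apply Rbar_min_case; assumption.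
Qed.

Lemma rad1_Rsum c (f : nat -> nat -> R) :
  (forall i, (i < c)%nat -> rad1 (f i)) -> rad1 (fun n => Rsum_nat c (fun i => f i n)).
Proof.
  induction c as [|c IH]; intros H.
  - apply (rad1_bounded _ 0). intros n. unfold Rsum_nat. simpl. rewrite Rabs_R0. lra.
  - unfold rad1.
    rewrite (CV_radius_ext _ (fun n => Rsum_nat c (fun i => f i n) + f c n))
      by (intros; now rewrite Rsum_nat_S).
    apply rad1_plus; auto.
Qed.

Lemma ex_pseries_rad1 a x : rad1 a -> Rabs x < 1 -> ex_pseries a x.
Proof. intros Ha Hx. now apply CV_radius_inside, rad1_lt. Qed.

Lemma PSeries_Rsum c (f : nat -> nat -> R) x :
  (forall i, (i < c)%nat -> rad1 (f i)) -> Rabs x < 1 ->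
  PSeries (fun n => Rsum_nat c (fun i => f i n)) x = Rsum_nat c (fun i => PSeries (f i) x).
Proof.
  intros H Hx. induction c as [|c IH].
  - unfold Rsum_nat. simpl. apply PSeries_const_0.
  - rewrite Rsum_nat_S, <- IH by auto.
    rewrite <- PSeries_plus.
    + apply PSeries_ext. intros n. unfold PS_plus. now rewrite Rsum_nat_S.
    + apply ex_pseries_rad1; [apply rad1_Rsum; auto | exact Hx].
    + apply ex_pseries_rad1; auto.
Qed.

Lemma PSeries_shift a i x : rad1 a -> Rabs x < 1 ->
  PSeries a x = Rsum_nat i (fun k => a k * x ^ k) + x ^ i * PSeries (fun n => a (n + i)%nat) x.
Proof.
  intros Ha Hx. induction i as [|i IH].
  - unfold Rsum_nat. simpl. rewrite Rplus_0_l, Rmult_1_l. apply PSeries_ext. intros n.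
    now rewrite Nat.add_0_r.
  - rewrite IH, Rsum_nat_S.
    rewrite (PSeries_decr_1 (fun n => a (n + i)%nat)).
    + unfold PS_decr_1. simpl (0 + i)%nat.
      rewrite (PSeries_ext (fun n => a (S n + i)%nat) (fun n => a (n + S i)%nat))
        by (intros n; f_equal; lia). simpl. ring.
    + apply ex_pseries_rad1; [now apply rad1_shift | exact Hx].
Qed.

Definition window (c : nat) (a : nat -> R) : nat -> R :=
  fun n => Rsum_nat c (fun i => a (n + i)%nat).

(* The model case is [n^(l-1)] times a c-periodic sequence of mean zero; a generating series
   with this property is rational with denominator a power of [1 + x + ... + x^(c-1)]. *)
Fixpoint window_null (c l : nat) (a : nat -> R) : Prop :=
  match l with
  | O => forall n, a n = 0
  | S l => window_null c l (window c a)
  end.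

Lemma window_null_ext c l a b :
  (forall n, a n = b n) -> window_null c l a -> window_null c l b.
Proof.
  revert a b. induction l as [|l IH]; simpl; intros a b H Ha.
  - intros n. now rewrite <- H.
  - revert Ha. apply IH. intros n. apply Rsum_nat_ext. auto.
Qed.

Lemma window_null_0 c l : window_null c l (fun _ => 0).
Proof.
  induction l as [|l IH]; simpl; [reflexivity|].
  revert IH. apply window_null_ext. intros n. symmetry. now apply Rsum_nat_0.
Qed.

Lemma window_null_plus c l a b :
  window_null c l a -> window_null c l b -> window_null c l (fun n => a n + b n).
Proof.
  revert a b. induction l as [|l IH]; simpl; intros a b Ha Hb.
  - intros n. rewrite Ha, Hb. ring.
  - eapply window_null_ext; [|apply (IH _ _ Ha Hb)].
    intros n. symmetry. apply Rsum_nat_plus.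
Qed.

Lemma window_null_scal c l a x : window_null c l a -> window_null c l (fun n => x * a n).
Proof.
  revert a. induction l as [|l IH]; simpl; intros a Ha.
  - intros n. rewrite Ha. ring.
  - eapply window_null_ext; [|apply (IH _ Ha)]. intros n. symmetry. apply Rsum_nat_scal.
Qed.

Lemma window_null_shift c l a i : window_null c l a -> window_null c l (fun n => a (n + i)%nat).
Proof.
  revert a. induction l as [|l IH]; simpl; intros a Ha; [auto|].
  eapply window_null_ext; [|apply (IH _ Ha)].
  intros n. apply Rsum_nat_ext. intros j _. f_equal. lia.
Qed.

Lemma window_null_Rsum c l p (f : nat -> nat -> R) :
  (forall i, (i < p)%nat -> window_null c l (f i)) ->
  window_null c l (fun n => Rsum_nat p (fun i => f i n)).
Proof.
  induction p as [|p IH]; intros H.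
  - apply window_null_0.
  - apply (window_null_ext c l (fun n => Rsum_nat p (fun i => f i n) + f p n)).
    { intros n. now rewrite Rsum_nat_S. }
    apply window_null_plus; auto.
Qed.

(** The window of n a_n is n times the window of a, of lower order, plus a fixed combination of
    shifts of a; hence induction on the order. *)
Lemma window_null_mult_n c l a :
  window_null c l a -> window_null c (S l) (fun n => a n * INR n).
Proof.
  revert a. induction l as [|l IH]; intros a Ha.
  - intros n. apply Rsum_nat_0. intros i _. simpl in Ha. rewrite Ha. ring.
  - change (window_null c (S l) (window c (fun n => a n * INR n))).
    apply (window_null_ext c (S l)
      (fun n => window c a n * INR n + Rsum_nat c (fun i => INR i * a (n + i)%nat))).
    { intros n. unfold window. rewrite Rmult_comm, <- Rsum_nat_scal, <- Rsum_nat_plus.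
      apply Rsum_nat_ext. intros i _. rewrite plus_INR. ring. }
    apply window_null_plus; [now apply IH|].
    apply (window_null_Rsum c (S l) c (fun i n => INR i * a (n + i)%nat)).
    intros i _. apply (window_null_scal c (S l)), (window_null_shift c (S l)), Ha.
Qed.

Lemma window_null_mult_pow c l a p :
  window_null c l a -> window_null c (p + l) (fun n => a n * INR n ^ p).
Proof.
  intros Ha. induction p as [|p IH].
  - revert Ha. apply window_null_ext. intros n. simpl. ring.
  - eapply window_null_ext; [|apply (window_null_mult_n _ _ _ IH)].
    intros n. simpl. ring.
Qed.

Definition geom_factor (c : nat) (x : R) : R := Rsum_nat c (fun i => x ^ (c - 1 - i)).

Definition window_rest (c : nat) (a : nat -> R) (x : R) : R :=
  Rsum_nat c (fun i => x ^ (c - 1 - i) * Rsum_nat i (fun k => a k * x ^ k)).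

(** Split off the first i terms of the series, multiply by x^(c-1-i) and sum over i < c: the shifted
    series all get the common factor x^(c-1). When the window vanishes, the series is the explicit
    quotient [window_rest] / [geom_factor]. *)
Lemma PSeries_window c a x : rad1 a -> Rabs x < 1 ->
  geom_factor c x * PSeries a x = x ^ (c - 1) * PSeries (window c a) x + window_rest c a x.
Proof.
  intros Ha Hx. unfold window, geom_factor, window_rest.
  rewrite (PSeries_Rsum c (fun i n => a (n + i)%nat)); [|intros; now apply rad1_shift|exact Hx].
  rewrite Rmult_comm, <- !Rsum_nat_scal, <- Rsum_nat_plus.
  apply Rsum_nat_ext. intros i Hi.
  rewrite (PSeries_shift a i) by assumption.
  replace (x ^ (c - 1)) with (x ^ (c - 1 - i) * x ^ i).
  - ring.
  - rewrite <- pow_add. f_equal. lia.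
Qed.

(** The summand i = c - 1 is x^0. This is why there is no pole at x = 1. *)
Lemma geom_factor_ge_1 c x : (0 < c)%nat -> 0 <= x -> 1 <= geom_factor c x.
Proof.
  intros Hc Hx. unfold geom_factor. destruct c as [|c]; [lia|].
  rewrite Rsum_nat_S. replace (S c - 1 - c)%nat with 0%nat by lia. simpl (x ^ 0).
  enough (0 <= Rsum_nat c (fun i => x ^ (S c - 1 - i))) by lra.
  rewrite <- (Rsum_nat_0 c (fun _ => 0)) by auto.
  apply Rsum_nat_le. intros i _. now apply pow_le.
Qed.

Lemma pow_le_1 x n : 0 <= x < 1 -> 0 <= x ^ n <= 1.
Proof.
  intros Hx. split; [apply pow_le; lra|].
  rewrite <- (pow1 n). apply pow_incr. lra.
Qed.

Lemma window_rest_bounded c a :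
  exists K, forall x, 0 <= x < 1 -> Rabs (window_rest c a x) <= K.
Proof.
  exists (Rsum_nat c (fun i => Rsum_nat i (fun k => Rabs (a k)))). intros x Hx.
  eapply Rle_trans; [apply Rsum_nat_abs|]. apply Rsum_nat_le. intros i _.
  rewrite Rabs_mult, <- (Rmult_1_l (Rsum_nat i (fun k => Rabs _))).
  pose proof (pow_le_1 x (c - 1 - i) Hx).
  apply Rmult_le_compat; try apply Rabs_pos; [rewrite Rabs_pos_eq; lra|].
  eapply Rle_trans; [apply Rsum_nat_abs|]. apply Rsum_nat_le. intros k _.
  pose proof (pow_le_1 x k Hx). rewrite Rabs_mult, (Rabs_pos_eq (x ^ k)) by lra.
  pose proof (Rabs_pos (a k)). nra.
Qed.

(** The bound is uniform up to x = 1, about which [rad1] says nothing: each order costs one division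
    by [geom_factor], which is at least 1. *)
Lemma PSeries_window_null_bounded c l a : (0 < c)%nat -> window_null c l a -> rad1 a ->
  exists K, forall x, 0 <= x < 1 -> Rabs (PSeries a x) <= K.
Proof.
  intros Hc. revert a. induction l as [|l IH]; intros a Ha Hr.
  - exists 0. intros x Hx. rewrite (PSeries_ext _ (fun _ => 0)) by exact Ha.
    rewrite PSeries_const_0, Rabs_R0. lra.
  - destruct (IH (window c a)) as [K1 HK1]; [exact Ha| |].
    { apply (rad1_Rsum c (fun i n => a (n + i)%nat)). intros i _. now apply rad1_shift. }
    destruct (window_rest_bounded c a) as [K2 HK2].
    exists (K1 + K2). intros x Hx.
    assert (Hx1 : Rabs x < 1) by (rewrite Rabs_pos_eq; lra).
    pose proof (geom_factor_ge_1 c x Hc ltac:(lra)) as HD.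
    apply Rle_trans with (Rabs (geom_factor c x * PSeries a x)).
    + rewrite Rabs_mult, (Rabs_pos_eq (geom_factor c x)) by lra.
      pose proof (Rabs_pos (PSeries a x)). nra.
    + rewrite PSeries_window by assumption.
      eapply Rle_trans; [apply Rabs_triang|]. apply Rplus_le_compat; [|now apply HK2].
      rewrite Rabs_mult. pose proof (pow_le_1 x (c - 1) Hx).
      rewrite (Rabs_pos_eq (x ^ _)) by lra. specialize (HK1 x Hx).
      pose proof (Rabs_pos (PSeries (window c a) x)). nra.
Qed.

(** The factor x = exp(-2 PI t) is the decay as t -> infinity. *)
Lemma PSeries_window_null_linear c l a :
  (0 < c)%nat -> window_null c l a -> rad1 a -> a 0%nat = 0 ->
  exists K, forall x, 0 <= x < 1 -> Rabs (PSeries a x) <= K * x.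
Proof.
  intros Hc Ha Hr H0.
  destruct (PSeries_window_null_bounded c l (fun n => a (n + 1)%nat) Hc) as [K HK].
  { now apply window_null_shift. }
  { now apply rad1_shift. }
  exists K. intros x Hx.
  rewrite (PSeries_shift a 1); [|exact Hr|rewrite Rabs_pos_eq; lra].
  unfold Rsum_nat. simpl. rewrite H0.
  replace (0 * 1 + 0 + x * 1 * PSeries (fun n => a (n + 1)%nat) x)
    with (PSeries (fun n => a (n + 1)%nat) x * x) by ring.
  rewrite Rabs_mult, (Rabs_pos_eq x) by lra.
  apply Rmult_le_compat_r; [lra|]. now apply HK.
Qed.

(** The weight n^l stays apart from a because d/dt only raises l, up to the factor -2 PI. *)
Definition moment (a : nat -> R) (l : nat) (t : R) : R :=
  PSeries (fun n => a n * INR n ^ l) (exp (- (2 * PI * t))).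

Lemma exp_neg_bounds t : 0 < t -> 0 < exp (- (2 * PI * t)) < 1.
Proof.
  intros Ht. pose proof PI_RGT_0. split; [apply exp_pos|].
  rewrite <- exp_0. apply exp_increasing. nra.
Qed.

Lemma exp_neg_Rabs t : 0 < t -> Rabs (exp (- (2 * PI * t))) < 1.
Proof. intros Ht. pose proof (exp_neg_bounds t Ht). rewrite Rabs_pos_eq; lra. Qed.

Lemma is_derive_moment a l t : rad1 a -> 0 < t ->
  is_derive (moment a l) t (- (2 * PI) * moment a (S l) t).
Proof.
  intros Ha Ht. unfold moment. set (x := exp (- (2 * PI * t))).
  set (b := fun n => a n * INR n ^ l).
  replace (- (2 * PI) * _) with ((- (2 * PI) * x) * PSeries (PS_derive b) x).
  - apply (is_derive_comp (PSeries b) (fun t => exp (- (2 * PI * t)))).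
    + apply is_derive_PSeries, rad1_lt; [now apply rad1_mult_pow|]. now apply exp_neg_Rabs.
    + unfold x. auto_derive; [exact I|]. ring.
  - rewrite Rmult_assoc, <- PSeries_incr_1. f_equal. apply PSeries_ext.
    intros [|n]; unfold PS_incr_1, PS_derive, b.
    + unfold zero. simpl. ring.
    + rewrite <- tech_pow_Rmult. ring.
Qed.

(* [iter_prim M m] is [t |-> int_t^oo s^(m-1) M_m(s) ds] when [M_l' = - 2 PI M_(l+1)]
   and everything decays: this is integration by parts. *)
Fixpoint iter_prim (M : nat -> R -> R) (m : nat) (t : R) : R :=
  match m with
  | O => 0
  | S p => (t ^ p * M p t + INR p * iter_prim M p t) / (2 * PI)
  end.

(** Differentiating t^p produces p t^(p-1) M_p, which the derivative of the recursive summand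
    cancels. *)
Lemma is_derive_iter_prim M m t :
  (forall l, is_derive (M l) t (- (2 * PI) * M (S l) t)) ->
  is_derive (iter_prim M m) t
    (match m with O => 0 | S p => - (t ^ p * M (S p) t) end).
Proof.
  intros H. pose proof PI_RGT_0. induction m as [|p IH].
  - apply (is_derive_const (V := R_NormedModule)).
  - set (dp := match p with O => 0 | S q => - (t ^ q * M (S q) t) end) in IH.
    replace (- (t ^ p * M (S p) t)) with
      (/ (2 * PI) * ((INR p * t ^ pred p * M p t + t ^ p * (- (2 * PI) * M (S p) t))
         + INR p * dp)).
    + apply (is_derive_ext (fun t => / (2 * PI) * (t ^ p * M p t + INR p * iter_prim M p t))).
      { intros s. simpl. field. lra. }
      apply (is_derive_scal (fun t => t ^ p * M p t + INR p * iter_prim M p t)).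
      apply (is_derive_plus (V := R_NormedModule)).
      * apply (is_derive_mult (fun t => t ^ p) (M p)); [|apply H|exact Rmult_comm].
        generalize p. intros q. auto_derive; [exact I|]. ring.
      * apply (is_derive_scal (iter_prim M p)), IH.
    + unfold dp. destruct p as [|q]; simpl pred.
      * simpl. field. lra.
      * simpl (t ^ S q). field. lra.
Qed.

(** * Iterated primitives of the moments *)


Lemma mul_exp_neg_le y : 0 <= y -> y * exp (- y) <= 1.
Proof.
  intros Hy. rewrite exp_Ropp. pose proof (exp_pos y).
  apply Rle_div_l; [lra|]. destruct (Req_dec y 0) as [->|Hne].
  - rewrite exp_0. lra.
  - pose proof (exp_ineq1 y Hne). lra.
Qed.

Lemma exp_pow_n y n : exp y ^ n = exp (INR n * y).
Proof.
  induction n as [|n IH].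
  - simpl. rewrite Rmult_0_l. symmetry. apply exp_0.
  - rewrite <- tech_pow_Rmult, IH, <- exp_plus, S_INR. f_equal. ring.
Qed.

Lemma pow_mul_exp_bounded l : exists K, forall t, 0 < t -> t ^ l * exp (- (2 * PI * t)) <= K.
Proof.
  pose proof PI_RGT_0 as HPI.
  destruct l as [|l].
  - exists 1. intros t Ht. simpl. pose proof (exp_neg_bounds t Ht). lra.
  - set (n := INR (S l)). assert (Hn : 0 < n) by (apply lt_0_INR; lia).
    exists ((n / (2 * PI)) ^ S l). intros t Ht.
    (* Then exp(-2 PI t) = exp(-y)^n, and each of the n factors t exp(-y) is at most n / (2 PI). *)
    set (y := 2 * PI * t / n).
    assert (Hy : 0 <= y) by (unfold y; apply Rdiv_le_0_compat; nra).
    replace (exp (- (2 * PI * t))) with (exp (- y) ^ S l).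
    + rewrite <- Rpow_mult_distr. apply pow_incr. split.
      * apply Rmult_le_pos; [lra|]. left. apply exp_pos.
      * replace (t * exp (- y)) with (n / (2 * PI) * (y * exp (- y)))
          by (unfold y; field; lra).
        rewrite <- (Rmult_1_r (n / (2 * PI))) at 2.
        apply Rmult_le_compat_l; [apply Rdiv_le_0_compat; lra|].
        now apply mul_exp_neg_le.
    + rewrite exp_pow_n. f_equal. unfold y. fold n. field. lra.
Qed.

Lemma moment_bound c l a : (0 < c)%nat -> window_null c 1 a -> rad1 a -> a 0%nat = 0 ->
  exists K, 0 <= K /\
    forall t, 0 < t -> Rabs (moment a l t) <= K * exp (- (2 * PI * t)).
Proof.
  intros Hc Hw Hr H0.
  destruct (PSeries_window_null_linear c (l + 1) (fun n => a n * INR n ^ l) Hc) as [K HK].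
  - now apply window_null_mult_pow.
  - now apply rad1_mult_pow.
  - rewrite H0. ring.
  - assert (HK' : forall t, 0 < t -> Rabs (moment a l t) <= K * exp (- (2 * PI * t))).
    { intros t Ht. pose proof (exp_neg_bounds t Ht). apply HK. lra. }
    exists K. split; [|exact HK'].
    (* Any one value of t shows that K is nonnegative. *)
    pose proof (HK' 1 Rlt_0_1) as H1. pose proof (exp_pos (- (2 * PI * 1))).
    pose proof (Rabs_pos (moment a l 1)). nra.
Qed.

(** The exponent is independent of l: p = l bounds [iter_prim], while p = l - 1 and p = l + 1 leave
    a factor t or 1/t for the limits at 0 and at infinity. *)
Lemma pow_moment_bound c l a p : (0 < c)%nat -> window_null c 1 a -> rad1 a -> a 0%nat = 0 ->
  exists K, forall t, 0 < t -> Rabs (t ^ p * moment a l t) <= K.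
Proof.
  intros Hc Hw Hr H0.
  destruct (moment_bound c l a Hc Hw Hr H0) as [K1 [HK1 H1]].
  destruct (pow_mul_exp_bounded p) as [K2 H2].
  exists (K1 * K2). intros t Ht. specialize (H1 t Ht). specialize (H2 t Ht).
  rewrite Rabs_mult, (Rabs_pos_eq (t ^ p)) by (apply pow_le; lra).
  apply Rle_trans with (t ^ p * (K1 * exp (- (2 * PI * t)))).
  - apply Rmult_le_compat_l; [apply pow_le; lra | exact H1].
  - replace (t ^ p * (K1 * _)) with (K1 * (t ^ p * exp (- (2 * PI * t)))) by ring.
    now apply Rmult_le_compat_l.
Qed.

Lemma iter_prim_bound c a m : (0 < c)%nat -> window_null c 1 a -> rad1 a -> a 0%nat = 0 ->
  exists K, forall t, 0 < t -> Rabs (iter_prim (moment a) m t) <= K.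
Proof.
  intros Hc Hw Hr H0. pose proof PI_RGT_0 as HPI. induction m as [|p [K1 HK1]].
  - exists 0. intros t _. simpl. rewrite Rabs_R0. lra.
  - destruct (pow_moment_bound c p a p Hc Hw Hr H0) as [K2 HK2].
    exists ((K2 + INR p * K1) / (2 * PI)). intros t Ht. simpl.
    unfold Rdiv. rewrite Rabs_mult, Rabs_inv, (Rabs_pos_eq (2 * PI)) by lra.
    apply Rmult_le_compat_r; [left; apply Rinv_0_lt_compat; lra|].
    eapply Rle_trans; [apply Rabs_triang|]. apply Rplus_le_compat; [now apply HK2|].
    rewrite Rabs_mult, (Rabs_pos_eq (INR p)) by apply pos_INR.
    apply Rmult_le_compat_l; [apply pos_INR | now apply HK1].
Qed.

Lemma filterlim_const_mult {T} (F : (T -> Prop) -> Prop) {FF : Filter F} (f : T -> R) k l :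
  filterlim f F (locally l) -> filterlim (fun t => k * f t) F (locally (k * l)).
Proof.
  intros H. eapply filterlim_comp; [exact H|].
  apply (filterlim_scal_r (K := R_AbsRing) (V := R_NormedModule) k l).
Qed.

Lemma filterlim_Rplus {T} (F : (T -> Prop) -> Prop) {FF : Filter F} (f g : T -> R) l l' :
  filterlim f F (locally l) -> filterlim g F (locally l') ->
  filterlim (fun t => f t + g t) F (locally (l + l')).
Proof.
  intros H H'. eapply filterlim_comp_2; [exact H | exact H' |].
  apply (filterlim_plus (V := R_NormedModule)).
Qed.

(** Only M_0 survives in the limit, and unfolding the recursion multiplies it by p / (2 PI) at each
    stage, whence m! / (2 PI)^(m+1). *)
Lemma filterlim_iter_prim {F} {FF : Filter F} (M : nat -> R -> R) (L : R) :
  filterlim (M 0%nat) F (locally L) ->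
  (forall p, filterlim (fun t => t ^ S p * M (S p) t) F (locally 0)) ->
  forall m, filterlim (iter_prim M (S m)) F
    (locally (INR (fact m) / (2 * PI) ^ S m * L)).
Proof.
  intros HL HM. pose proof PI_RGT_0.
  induction m as [|m IH].
  - apply (filterlim_ext (fun t => / (2 * PI) * M 0%nat t)).
    { intros t. simpl. field. lra. }
    replace (INR (fact 0) / (2 * PI) ^ 1 * L) with (/ (2 * PI) * L) by (simpl; field; lra).
    now apply filterlim_const_mult.
  - apply (filterlim_ext (fun t => / (2 * PI) *
      (t ^ S m * M (S m) t + INR (S m) * iter_prim M (S m) t))).
    { intros t. change (iter_prim M (S (S m)) t) with
        ((t ^ S m * M (S m) t + INR (S m) * iter_prim M (S m) t) / (2 * PI)).
      field. lra. }
    replace (INR (fact (S m)) / (2 * PI) ^ S (S m) * L) with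
      (/ (2 * PI) * (0 + INR (S m) * (INR (fact m) / (2 * PI) ^ S m * L))).
    + apply filterlim_const_mult; [exact FF|].
      apply filterlim_Rplus; [exact FF | apply HM |].
      now apply filterlim_const_mult.
    + rewrite fact_simpl, mult_INR, <- (tech_pow_Rmult (2 * PI) (S m)).
      field. split; [apply pow_nonzero|]; lra.
Qed.

Lemma filterlim_0_bound {T} (F : (T -> Prop) -> Prop) {FF : Filter F} (f g : T -> R) :
  F (fun t => Rabs (f t) <= g t) -> filterlim g F (locally 0) -> filterlim f F (locally 0).
Proof.
  intros H Hg. apply filterlim_locally. intros eps.
  pose proof (proj1 (filterlim_locally _ _) Hg eps) as Hg'.
  generalize (filter_and _ _ H Hg'). apply filter_imp. intros t [H1 H2].
  unfold ball in *. simpl in *. unfold AbsRing_ball, abs, minus, plus, opp in *. simpl in *.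
  rewrite Ropp_0, Rplus_0_r in *. eapply Rle_lt_trans; [|exact H2].
  eapply Rle_trans; [exact H1 | apply Rle_abs].
Qed.

Lemma at_right_pos (P : R -> Prop) : (forall t, 0 < t -> P t) -> at_right 0 P.
Proof. intros H. exists (mkposreal 1 Rlt_0_1). intros t _ Ht. now apply H. Qed.

Lemma p_infty_pos (P : R -> Prop) : (forall t, 0 < t -> P t) -> Rbar_locally p_infty P.
Proof. intros H. exists 0. exact H. Qed.

Lemma filterlim_at_right_continuous (f : R -> R) x :
  continuous f x -> filterlim f (at_right x) (locally (f x)).
Proof. intros H P HP. unfold filtermap. apply filter_le_within. exact (H P HP). Qed.

Lemma filterlim_at_right_id : filterlim (fun t : R => t) (at_right 0) (locally 0).
Proof. intros P HP. unfold filtermap. apply filter_le_within. exact HP. Qed.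

Lemma filterlim_inv_p_infty : filterlim (fun t => / t) (Rbar_locally p_infty) (locally 0).
Proof.
  apply (is_lim_inv (fun t => t) p_infty p_infty); [apply is_lim_id | discriminate].
Qed.

Lemma continuous_Rsum n (f : nat -> R -> R) x :
  (forall i, (i < n)%nat -> continuous (f i) x) ->
  continuous (fun y => Rsum_nat n (fun i => f i y)) x.
Proof. intros H. apply (filterlim_Rsum_nat (locally x) n f). exact H. Qed.

Lemma continuous_pow_R n (x : R) : continuous (fun y : R => y ^ n) x.
Proof.
  apply (ex_derive_continuous (V := R_NormedModule)). auto_derive. exact I.
Qed.

(** For a c-periodic sequence of mean zero, the average of the partial sums over one period is its
    Abel sum. *)
Definition abel_value (c : nat) (a : nat -> R) : R :=
  Rsum_nat c (fun i => Rsum_nat i a) / INR c.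

Lemma abel_value_spec c a : Rsum_nat c a = 0 ->
  abel_value c a = - Rsum_nat c (fun i => INR i * a i) / INR c.
Proof.
  intros H0. unfold abel_value. f_equal.
  (* Summation by parts: a_k lies in the n - 1 - k partial sums of index k < i < n. *)
  assert (H : forall n, Rsum_nat n (fun i => Rsum_nat i a) + Rsum_nat n (fun i => INR i * a i)
      + Rsum_nat n a = INR n * Rsum_nat n a).
  { induction n as [|n IH]; [unfold Rsum_nat; simpl; ring|].
    rewrite !Rsum_nat_S, S_INR. nra. }
  specialize (H c). rewrite H0 in H. lra.
Qed.

(** The series equals [window_rest] / [geom_factor] at x = exp(-2 PI t), a rational function
    continuous at x = 1; its value there is read off. *)
Lemma moment_0_lim c a : (0 < c)%nat -> window_null c 1 a -> rad1 a ->
  filterlim (moment a 0) (at_right 0) (locally (abel_value c a)).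
Proof.
  intros Hc Hw Hr.
  apply (filterlim_ext_loc (fun t =>
     window_rest c a (exp (- (2 * PI * t))) / geom_factor c (exp (- (2 * PI * t))))).
  - apply at_right_pos. intros t Ht. unfold moment.
    pose proof (exp_neg_bounds t Ht).
    pose proof (geom_factor_ge_1 c (exp (- (2 * PI * t))) Hc ltac:(lra)).
    pose proof (PSeries_window c a (exp (- (2 * PI * t))) Hr (exp_neg_Rabs t Ht)) as E.
    rewrite (PSeries_ext (window c a) (fun _ => 0)) in E by exact Hw.
    rewrite PSeries_const_0, Rmult_0_r, Rplus_0_l in E.
    rewrite <- E. rewrite (PSeries_ext (fun n => a n * INR n ^ 0) a) by (intros; simpl; ring).
    field. lra.
  - replace (abel_value c a) with (window_rest c a 1 / geom_factor c 1).
    + eapply filterlim_comp with (G := locally 1)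
        (f := fun t => exp (- (2 * PI * t)))
        (g := fun x => window_rest c a x / geom_factor c x).
      * replace 1 with (exp (- (2 * PI * 0))) at 1 by (rewrite Rmult_0_r, Ropp_0; apply exp_0).
        apply (filterlim_at_right_continuous (fun t => exp (- (2 * PI * t))) 0).
        apply (ex_derive_continuous (V := R_NormedModule) (fun t => exp (- (2 * PI * t)))).
        auto_derive. exact I.
      * apply (continuous_mult (K := R_AbsRing) (window_rest c a) (fun x => / geom_factor c x)).
        -- apply (continuous_Rsum c (fun i x => x ^ (c - 1 - i) * Rsum_nat i (fun k => a k * x ^ k))).
           intros i _. apply (continuous_mult (K := R_AbsRing) (fun x => x ^ (c - 1 - i))).
           { apply continuous_pow_R. }
           apply (continuous_Rsum i (fun k x => a k * x ^ k)). intros k _.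
           apply (continuous_mult (K := R_AbsRing) (fun _ => a k)).
           { apply continuous_const. }
           apply continuous_pow_R.
        -- apply continuous_comp.
           { apply (continuous_Rsum c (fun i x => x ^ (c - 1 - i))). intros; apply continuous_pow_R. }
           apply continuous_Rinv.
           pose proof (geom_factor_ge_1 c 1 Hc ltac:(lra)). lra.
    + unfold abel_value, window_rest, geom_factor. f_equal.
      * apply Rsum_nat_ext. intros i _. rewrite pow1, Rmult_1_l. apply Rsum_nat_ext.
        intros k _. rewrite pow1. ring.
      * rewrite (Rsum_nat_ext _ _ (fun _ => 1)) by (intros; apply pow1).
        rewrite Rsum_nat_const. ring.
Qed.

Lemma iter_prim_moment_lim_0 c a m :
  (0 < c)%nat -> window_null c 1 a -> rad1 a -> a 0%nat = 0 ->
  filterlim (iter_prim (moment a) (S m)) (at_right 0)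
    (locally (INR (fact m) / (2 * PI) ^ S m * abel_value c a)).
Proof.
  intros Hc Hw Hr H0.
  apply (filterlim_iter_prim (F := at_right 0) (moment a) (abel_value c a)).
  - now apply moment_0_lim.
  - intros p. destruct (pow_moment_bound c (S p) a p Hc Hw Hr H0) as [K HK].
    apply (filterlim_0_bound _ _ (fun t => K * t)).
    + apply at_right_pos. intros t Ht. simpl (t ^ S p).
      rewrite Rmult_assoc, Rabs_mult, (Rabs_pos_eq t), Rmult_comm by lra.
      apply Rmult_le_compat_r; [lra | now apply HK].
    + replace 0 with (K * 0) at 2 by ring.
      apply (filterlim_const_mult _ (fun t => t)), filterlim_at_right_id.
Qed.

Lemma iter_prim_moment_lim_infty c a m :
  (0 < c)%nat -> window_null c 1 a -> rad1 a -> a 0%nat = 0 ->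
  filterlim (iter_prim (moment a) (S m)) (Rbar_locally p_infty) (locally 0).
Proof.
  intros Hc Hw Hr H0.
  assert (H : forall p, filterlim (fun t => t ^ p * moment a p t) (Rbar_locally p_infty) (locally 0)).
  { intros p. destruct (pow_moment_bound c p a (S p) Hc Hw Hr H0) as [K HK].
    apply (filterlim_0_bound _ _ (fun t => K * / t)).
    + apply p_infty_pos. intros t Ht.
      replace (t ^ p * moment a p t) with (t ^ S p * moment a p t * / t)
        by (simpl; field; lra).
      assert (0 < / t) by now apply Rinv_0_lt_compat.
      rewrite Rabs_mult, (Rabs_pos_eq (/ t)) by lra.
      apply Rmult_le_compat_r; [lra | now apply HK].
    + replace 0 with (K * 0) at 1 by ring.
      apply filterlim_const_mult; [apply Rbar_locally_filter | apply filterlim_inv_p_infty]. }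
  replace 0 with (INR (fact m) / (2 * PI) ^ S m * 0) at 1 by ring.
  apply (filterlim_iter_prim (F := Rbar_locally p_infty) (moment a) 0).
  - apply (filterlim_ext (fun t => t ^ 0 * moment a 0 t)); [intros; simpl; ring | apply H].
  - intros p. apply H.
Qed.

(** * Cancelling kernels: block estimates and Lambert rearrangement *)


(** Abstracts the real and the imaginary part of [twist]. Periodicity in A makes constants uniform
    in A, and the zero column gives decay at infinity. The last two clauses are the cancellation in
    B, which yields a finite value at t = 0, and in A, which makes the sum over blocks converge. *)
Definition cancelling_kernel (c : nat) (g : nat -> nat -> R) : Prop :=
  (0 < c)%nat /\
  (forall A B, g (A + c)%nat B = g A B) /\
  (exists K, forall A B, Rabs (g A B) <= K) /\
  (forall A, g A 0%nat = 0) /\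
  (forall A, window_null c 1 (g A)) /\
  (forall n B, Rsum_nat c (fun i => g (n + i)%nat B) = 0).

Lemma kernel_rad1 c g A : cancelling_kernel c g -> rad1 (g A).
Proof. intros (_ & _ & [K HK] & _). apply (rad1_bounded _ K). auto. Qed.

Lemma iter_prim_ext M M' m t :
  (forall l, M l t = M' l t) -> iter_prim M m t = iter_prim M' m t.
Proof. intros H. induction m as [|m IH]; simpl; [reflexivity|]. now rewrite IH, H. Qed.

Lemma moment_ext a b l t : (forall n, a n = b n) -> moment a l t = moment b l t.
Proof. intros H. apply PSeries_ext. intros n. now rewrite H. Qed.

Lemma kernel_mod c g A B : cancelling_kernel c g -> g A B = g (A mod c)%nat B.
Proof.
  intros (Hc & Hp & _). rewrite (Nat.div_mod A c) at 1 by lia.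
  rewrite Nat.add_comm. induction (A / c)%nat as [|n IH].
  - now rewrite Nat.mul_0_r, Nat.add_0_r.
  - rewrite <- IH. replace (A mod c + c * S n)%nat with (A mod c + c * n + c)%nat by lia.
    apply Hp.
Qed.

(** By periodicity in A a kernel has only c different rows, so bounds row by row suffice. *)
Lemma uniform_bound (P : nat -> R -> Prop) c :
  (forall i, exists K, P i K) -> (forall i K K', K <= K' -> P i K -> P i K') ->
  exists K, 0 <= K /\ forall i, (i < c)%nat -> P i K.
Proof.
  intros H Hmon. induction c as [|c [K1 [HK1 H1]]].
  - exists 0. split; [lra|]. intros i Hi. lia.
  - destruct (H c) as [K2 H2]. exists (Rmax K1 K2). split.
    + eapply Rle_trans; [exact HK1 | apply Rmax_l].
    + intros i Hi. destruct (Nat.eq_dec i c) as [->|Hne].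
      * apply (Hmon c K2); [apply Rmax_r | exact H2].
      * apply (Hmon i K1); [apply Rmax_l | apply H1; lia].
Qed.

Lemma kernel_iter_prim_bound c g m : cancelling_kernel c g ->
  exists K, 0 <= K /\
    forall A t, 0 < t -> Rabs (iter_prim (moment (g A)) m t) <= K.
Proof.
  intros Hg. pose proof Hg as (Hc & _ & _ & H0 & Hw & _).
  destruct (uniform_bound (fun A K => forall t, 0 < t -> Rabs (iter_prim (moment (g A)) m t) <= K) c)
    as [K [HK H]].
  - intros i. apply (iter_prim_bound c); auto. now apply (kernel_rad1 c).
  - intros i K K' HKK H t Ht. eapply Rle_trans; [now apply H | exact HKK].
  - exists K. split; [exact HK|]. intros A t Ht.
    rewrite (iter_prim_ext _ (moment (g (A mod c)%nat))).
    + apply H; [apply Nat.mod_upper_bound; lia | exact Ht].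
    + intros l. apply moment_ext. intros n. now apply kernel_mod.
Qed.

Lemma kernel_pow_moment_bound c g l p : cancelling_kernel c g ->
  exists K, 0 <= K /\ forall A t, 0 < t -> Rabs (t ^ p * moment (g A) l t) <= K.
Proof.
  intros Hg. pose proof Hg as (Hc & _ & _ & H0 & Hw & _).
  destruct (uniform_bound (fun A K => forall t, 0 < t -> Rabs (t ^ p * moment (g A) l t) <= K) c)
    as [K [HK H]].
  - intros i. apply (pow_moment_bound c); auto. now apply (kernel_rad1 c).
  - intros i K K' HKK H t Ht. eapply Rle_trans; [now apply H | exact HKK].
  - exists K. split; [exact HK|]. intros A t Ht.
    rewrite (moment_ext _ (g (A mod c)%nat)).
    + apply H; [apply Nat.mod_upper_bound; lia | exact Ht].
    + intros n. now apply kernel_mod.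
Qed.

(** The cancellation in A holds for each coefficient B, so it passes to the series as long as all
    rows are taken at the same point t. *)
Lemma kernel_moment_sum c g n l t : cancelling_kernel c g -> 0 < t ->
  Rsum_nat c (fun i => moment (g (n + i)%nat) l t) = 0.
Proof.
  intros Hg Ht. unfold moment.
  rewrite <- (PSeries_Rsum c (fun i B => g (n + i)%nat B * INR B ^ l)).
  - rewrite (PSeries_ext _ (fun _ => 0)); [apply PSeries_const_0|].
    intros B. rewrite (Rsum_nat_ext _ _ (fun i => INR B ^ l * g (n + i)%nat B))
      by (intros; ring).
    rewrite Rsum_nat_scal. destruct Hg as (_ & _ & _ & _ & _ & H). rewrite H. ring.
  - intros i _. apply rad1_mult_pow. now apply (kernel_rad1 c).
  - now apply exp_neg_Rabs.
Qed.

Lemma kernel_iter_prim_sum c g n m t : cancelling_kernel c g -> 0 < t ->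
  Rsum_nat c (fun i => iter_prim (moment (g (n + i)%nat)) m t) = 0.
Proof.
  intros Hg Ht. induction m as [|m IH].
  - now apply Rsum_nat_0.
  - simpl.
    rewrite (Rsum_nat_ext _ _ (fun i => t ^ m / (2 * PI) * moment (g (n + i)%nat) m t +
      INR m / (2 * PI) * iter_prim (moment (g (n + i)%nat)) m t)).
    + rewrite Rsum_nat_plus, !Rsum_nat_scal, IH, (kernel_moment_sum c) by assumption. ring.
    + intros i _. field. apply PI_neq0.
Qed.

(** Block p runs over A = c p + 1, ..., c p + c, so that A = 0 is never met. Row A is evaluated at A
    t, which varies inside the block. *)
Definition block (c : nat) (g : nat -> nat -> R) (m p : nat) (t : R) : R :=
  Rsum_nat c (fun i => iter_prim (moment (g (c * p + S i)%nat)) m (INR (c * p + S i) * t)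
                       / INR (c * p + S i) ^ m).

(* Subtracting the vanishing sum of the same primitives at the common point [c p + c]
   gains a derivative, hence a factor [1 / p]. *)
Lemma block_bound c g m : cancelling_kernel c g ->
  exists K, forall p t, 0 < t -> Rabs (block c g (S m) p t) <= K * / INR (S p) ^ 2.
Proof.
  intros Hg. pose proof Hg as (Hc & _).
  destruct (kernel_iter_prim_bound c g (S m) Hg) as [K1 [HK1 H1]].
  destruct (kernel_pow_moment_bound c g (S m) (S m) Hg) as [K2 [HK2 H2]].
  set (K := K2 + INR (S m) * K1).
  assert (HK : 0 <= K).
  { unfold K. pose proof (pos_INR (S m)). nra. }
  (* There are c rows, each moved by a distance at most c. *)
  exists (INR c * (K * INR c)). intros p t Ht.
  set (Y := INR (c * p + c)).
  set (f := fun A y => iter_prim (moment (g A)) (S m) (y * t) / y ^ S m).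
  assert (HY : INR (S p) <= Y) by (apply le_INR; nia).
  assert (Hp : 0 < INR (S p)) by (apply lt_0_INR; lia).
  assert (Hzero : Rsum_nat c (fun i => f (c * p + S i)%nat Y) = 0).
  { unfold f.
    rewrite (Rsum_nat_ext _ _ (fun i => / Y ^ S m *
      iter_prim (moment (g (S (c * p) + i)%nat)) (S m) (Y * t))).
    - rewrite Rsum_nat_scal, (kernel_iter_prim_sum c) by (auto; nra). ring.
    - intros i _. replace (c * p + S i)%nat with (S (c * p) + i)%nat by lia.
      apply Rmult_comm. }
  replace (block c g (S m) p t) with
    (- Rsum_nat c (fun i => f (c * p + S i)%nat Y - f (c * p + S i)%nat (INR (c * p + S i)))).
  2:{ unfold Rminus. rewrite Rsum_nat_plus, Hzero.
      rewrite (Rsum_nat_ext c (fun i => - f (c * p + S i)%nat (INR (c * p + S i)))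
        (fun i => -1 * f (c * p + S i)%nat (INR (c * p + S i)))) by (intros; ring).
      rewrite Rsum_nat_scal. unfold block, f. ring. }
  rewrite Rabs_Ropp, Rmult_assoc. apply Rsum_nat_bound. intros i Hi.
  set (y0 := INR (c * p + S i)).
  assert (Hy0 : INR (S p) <= y0) by (apply le_INR; nia).
  assert (HyY : y0 <= Y) by (apply le_INR; nia).
  assert (HYc : Y - y0 <= INR c).
  { unfold Y, y0. rewrite !plus_INR. pose proof (pos_INR (S i)). lra. }
  apply Rle_trans with (K * / INR (S p) ^ 2 * (Y - y0)).
  2:{ rewrite Rmult_assoc, (Rmult_assoc K). apply Rmult_le_compat_l; [exact HK|].
      rewrite Rmult_comm. apply Rmult_le_compat_r; [|exact HYc].
      left. apply Rinv_0_lt_compat, pow_lt, Hp. }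
  set (A := (c * p + S i)%nat).
  apply (mvt_bound (f A) (fun y =>
     (- ((y * t) ^ m * moment (g A) (S m) (y * t)) * t) / y ^ S m
     - iter_prim (moment (g A)) (S m) (y * t) * (INR (S m) * y ^ m) / (y ^ S m) ^ 2));
    [exact HyY|].
  intros y Hy. assert (Hy1 : 0 < y) by lra.
  assert (Hpy : 0 < y ^ S m) by (apply pow_lt; lra).
  assert (Hyt : 0 < y * t) by nra.
  assert (Hr : rad1 (g A)) by now apply (kernel_rad1 c).
  split.
  - unfold f.
    replace (_ - _) with
      (- ((y * t) ^ m * moment (g A) (S m) (y * t)) * t * / y ^ S m +
       iter_prim (moment (g A)) (S m) (y * t) * (- (INR (S m) * y ^ m) / (y ^ S m) ^ 2))
      by (field; lra).
    apply (is_derive_mult (fun y => iter_prim (moment (g A)) (S m) (y * t)) (fun y => / y ^ S m));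
      [| |exact Rmult_comm].
    + rewrite Rmult_comm.
      apply (is_derive_comp (iter_prim (moment (g A)) (S m)) (fun y => y * t)).
      * apply (is_derive_iter_prim (moment (g A)) (S m)). intros l.
        now apply is_derive_moment.
      * auto_derive; [exact I|ring].
    + apply (is_derive_inv (fun y => y ^ S m)); [|lra].
      replace (INR (S m) * y ^ m) with (INR (S m) * 1 * y ^ pred (S m)) by (simpl pred; ring).
      apply is_derive_pow, (is_derive_id (K := R_AbsRing)).
  (* Writing t = (y t) / y leaves functions of y t alone, whose bounds do not depend on t, over
     y^(m+2). *)
  - replace (_ - _) with
      (- (((y * t) ^ S m * moment (g A) (S m) (y * t)) / (y * y ^ S m))
       - INR (S m) * iter_prim (moment (g A)) (S m) (y * t) / (y * y ^ S m)).
    2:{ rewrite <- (tech_pow_Rmult (y * t) m), <- (tech_pow_Rmult y m).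
        field. split; [apply pow_nonzero|]; lra. }
    assert (Hd : 0 < y * y ^ S m) by nra.
    apply Rle_trans with (K / (y * y ^ S m)).
    + unfold K, Rdiv, Rminus. eapply Rle_trans; [apply Rabs_triang|].
      rewrite !Rabs_Ropp, Rmult_plus_distr_r. rewrite 2!(Rabs_mult _ (/ (y * y ^ S m))).
      rewrite (Rabs_pos_eq (/ (y * y ^ S m))) by (left; now apply Rinv_0_lt_compat).
      apply Rplus_le_compat; apply Rmult_le_compat_r;
        try (left; now apply Rinv_0_lt_compat).
      * now apply H2.
      * rewrite Rabs_mult, (Rabs_pos_eq (INR (S m))) by apply pos_INR.
        apply Rmult_le_compat_l; [apply pos_INR | now apply H1].
    + unfold Rdiv. apply Rmult_le_compat_l; [exact HK|].
      apply Rinv_le_contravar; [now apply pow_lt|].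
      change (y * y ^ S m) with (y ^ S (S m)).
      apply Rle_trans with (y ^ 2).
      * apply pow_incr. lra.
      * apply Rle_pow; [|lia]. apply Rle_trans with (INR (S p)); [|lra].
        change 1 with (INR 1). apply le_INR. lia.
Qed.

Lemma ex_series_inv_sq K : ex_series (fun p => K * / INR (S p) ^ 2).
Proof.
  apply (ex_series_scal (K := R_AbsRing) (V := R_NormedModule) K (fun p => / INR (S p) ^ 2)).
  enough (H : ex_finite_lim_seq (sum_n (fun p => / INR (S p) ^ 2))).
  { destruct H as [l Hl]. exists l. exact Hl. }
  apply ex_finite_lim_seq_incr with (M := 2).
  - intros n. rewrite sum_Sn. unfold plus. simpl plus.
    enough (0 <= / INR (S (S n)) ^ 2) by (simpl in *; lra).
    left. apply Rinv_0_lt_compat, pow_lt, lt_0_INR. lia.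
  - intros n. rewrite sum_n_Rsum_nat. apply sum_inv_sq_bound.
Qed.

Lemma is_lim_seq_subseq_mul (u : nat -> R) (l : Rbar) c : (0 < c)%nat ->
  is_lim_seq u l -> is_lim_seq (fun P => u (c * P)%nat) l.
Proof.
  intros Hc H. apply (is_lim_seq_subseq u l (fun P => (c * P)%nat)); [|exact H].
  apply eventually_subseq. intros n. nia.
Qed.

(** Places a series in B on the multiples N = A B; the partial sum up to n is the original one up to
    n / A. *)
Lemma is_series_sparse (b : nat -> R) s A : (1 <= A)%nat -> is_series b s ->
  is_series (fun N => if (N mod A =? 0)%nat then b (N / A)%nat else 0) s.
Proof.
  intros HA H.
  assert (E : forall n, sum_n b (n / A) =
    sum_n (fun N => if (N mod A =? 0)%nat then b (N / A)%nat else 0) n).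
  { induction n as [|n IH].
    - rewrite Nat.Div0.div_0_l, !sum_O, Nat.Div0.mod_0_l, Nat.Div0.div_0_l. reflexivity.
    - rewrite sum_Sn, <- IH.
      pose proof (Nat.div_mod n A ltac:(lia)) as E1.
      pose proof (Nat.mod_upper_bound n A ltac:(lia)) as E2.
      destruct (Nat.eqb_spec (S n mod A) 0) as [Hz|Hz].
      + assert (E3 : (S n / A = S (n / A))%nat).
        { pose proof (Nat.div_mod (S n) A ltac:(lia)). nia. }
        rewrite E3, sum_Sn. reflexivity.
      + assert (E3 : (S n / A = n / A)%nat).
        { symmetry. apply (Nat.div_unique _ _ _ (S (n mod A))); [|lia].
          destruct (Nat.eq_dec (S (n mod A)) A) as [Heq|]; [|lia].
          exfalso. apply Hz.
          replace (S n) with ((n / A + 1) * A)%nat by nia.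
          apply Nat.Div0.mod_mul. }
        rewrite E3. symmetry. apply Rplus_0_r. }
  unfold is_series.
  apply (filterlim_ext (fun n => sum_n b (n / A)%nat)); [exact E|].
  eapply filterlim_comp; [|exact H].
  intros P [N HN]. exists (A * N)%nat. intros n Hn. apply HN.
  apply Nat.div_le_lower_bound; lia.
Qed.

(** The range and the guard copy [eis_coeff], so the two can be compared term by term. *)
Definition divisor_sum (h : nat -> nat -> R) (N : nat) : R :=
  Rsum_nat (S N) (fun A =>
    if andb (1 <=? A)%nat (N mod A =? 0)%nat then h A (N / A)%nat else 0).

Lemma divisor_sum_S h N : divisor_sum h N =
  Rsum_nat N (fun i => if (N mod S i =? 0)%nat then h (S i) (N / S i)%nat else 0).
Proof. unfold divisor_sum. rewrite Rsum_nat_Sl. simpl (andb _ _). cbn iota. apply Rplus_0_l. Qed.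

Lemma divisor_sum_bound h K N : (forall A B, Rabs (h (S A) B) <= K) ->
  Rabs (divisor_sum h N) <= INR N * K.
Proof.
  intros H. rewrite divisor_sum_S. apply Rsum_nat_bound. intros i _.
  destruct (_ =? _)%nat; [apply H|]. rewrite Rabs_R0.
  eapply Rle_trans; [apply Rabs_pos | apply (H 0%nat 0%nat)].
Qed.

(** Since B^m = N^m / A^m for N = A B, the Eisenstein coefficient is N^m times this with m = k - 1,
    which makes E a [moment]. *)
Definition dirichlet_coeff (g : nat -> nat -> R) (m : nat) : nat -> R :=
  divisor_sum (fun A B => g A B / INR A ^ m).

Lemma kernel_div_bound c g m : cancelling_kernel c g ->
  exists K, 0 <= K /\ forall A B, Rabs (g (S A) B / INR (S A) ^ m) <= K.
Proof.
  intros (_ & _ & [K HK] & _). exists K. split.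
  { eapply Rle_trans; [apply Rabs_pos | apply (HK 0%nat 0%nat)]. }
  intros A B.
  assert (H1 : 1 <= INR (S A) ^ m).
  { apply pow_R1_Rle. change 1 with (INR 1). apply le_INR. lia. }
  unfold Rdiv. rewrite Rabs_mult, Rabs_inv, (Rabs_pos_eq (_ ^ m)) by lra.
  rewrite <- (Rmult_1_r K). apply Rmult_le_compat; [apply Rabs_pos| |apply HK|].
  - left. apply Rinv_0_lt_compat. lra.
  - rewrite <- Rinv_1. apply Rinv_le_contravar; lra.
Qed.

Lemma rad1_linear K : rad1 (fun n => INR n * K).
Proof.
  unfold rad1. rewrite (CV_radius_ext _ (fun n => K * INR n)) by (intros; ring).
  rewrite CV_radius_mult_n. apply (rad1_bounded _ (Rabs K)). intros _. apply Rle_refl.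
Qed.

Lemma dirichlet_coeff_rad1 c g m : cancelling_kernel c g -> rad1 (dirichlet_coeff g m).
Proof.
  intros Hg. destruct (kernel_div_bound c g m Hg) as [K [_ HK]].
  apply (rad1_le _ (fun n => INR n * K)); [|apply rad1_linear].
  intros n. now apply divisor_sum_bound.
Qed.

Lemma is_series_zero : is_series (fun _ => 0) 0.
Proof.
  apply (filterlim_ext (fun _ => 0)); [|apply filterlim_const].
  intros n. rewrite sum_n_const. symmetry. apply Rmult_0_r.
Qed.

(** Rearranges the sum over N and A | N into a sum over A of sums over B. The exchange is [tannery]
    with the truncation P as parameter: the part of the N-th coefficient with A <= P is constant
    once P >= N and is dominated by a polynomial in N times x^N. *)
Lemma lambert c g l m t : cancelling_kernel c g -> 0 < t ->
  is_lim_seq (fun P => Rsum_nat P (fun i =>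
      INR (S i) ^ l / INR (S i) ^ m * moment (g (S i)) l (INR (S i) * t)))
    (moment (dirichlet_coeff g m) l t).
Proof.
  intros Hg Ht. destruct (kernel_div_bound c g m Hg) as [K [HK0 HK]].
  pose proof Hg as (Hc & _ & _ & H0 & _).
  set (x := exp (- (2 * PI * t))).
  assert (Hx : 0 < x < 1) by now apply exp_neg_bounds.
  assert (Hx1 : Rabs x < 1) by now apply exp_neg_Rabs.
  set (v := fun i N : nat => if (N mod S i =? 0)%nat
     then g (S i) (N / S i)%nat / INR (S i) ^ m * (INR N ^ l * x ^ N) else 0).
  set (u := fun N P : nat => Rsum_nat P (fun i => v i N)).
  assert (Hv : forall i, is_series (v i)
    (INR (S i) ^ l / INR (S i) ^ m * moment (g (S i)) l (INR (S i) * t))).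
  { intros i.
    assert (Hi : 0 < INR (S i)) by (apply lt_0_INR; lia).
    assert (Hm : is_series (fun B => INR (S i) ^ l / INR (S i) ^ m *
        (g (S i) B * INR B ^ l * (x ^ S i) ^ B))
        (INR (S i) ^ l / INR (S i) ^ m * moment (g (S i)) l (INR (S i) * t))).
    { apply (is_series_scal (K := R_AbsRing) (V := R_NormedModule)).
      unfold moment.
      replace (exp (- (2 * PI * (INR (S i) * t)))) with (x ^ S i).
      - apply is_pseries_R, PSeries_correct, ex_pseries_rad1.
        + apply rad1_mult_pow. now apply (kernel_rad1 c).
        + rewrite <- RPow_abs, Rabs_pos_eq by lra.
          rewrite <- tech_pow_Rmult. pose proof (pow_le_1 x i ltac:(lra)). nra.
      - unfold x. rewrite exp_pow_n. f_equal. ring. }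
    apply (is_series_sparse _ _ (S i) ltac:(lia)) in Hm.
    revert Hm. apply is_series_ext. intros N. unfold v.
    destruct (Nat.eqb_spec (N mod S i) 0) as [Hz|Hz]; [|reflexivity].
    assert (EN : N = (S i * (N / S i))%nat).
    { rewrite (Nat.div_mod N (S i)) at 1 by lia. lia. }
    rewrite <- pow_mult, <- EN.
    assert (EN' : INR N = INR (S i) * INR (N / S i)) by (rewrite EN at 1; apply mult_INR).
    rewrite EN', Rpow_mult_distr. match goal with |- ?a = ?b => change (@eq R a b) end. field. apply pow_nonzero. lra. }
  assert (Hser : forall P, Series (fun N => u N P) = Rsum_nat P (fun i =>
      INR (S i) ^ l / INR (S i) ^ m * moment (g (S i)) l (INR (S i) * t))).
  { intros P. apply is_series_unique. unfold u. induction P as [|P IH].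
    - apply is_series_zero.
    - rewrite Rsum_nat_S.
      apply (is_series_ext (fun N => plus (Rsum_nat P (fun i => v i N)) (v P N))).
      { intros N. rewrite Rsum_nat_S. reflexivity. }
      apply (is_series_plus (K := R_AbsRing) (V := R_NormedModule)); [exact IH | apply Hv]. }
  (* An A > N divides N only for N = 0, where the kernel vanishes. *)
  assert (Hstab : forall N P, (N <= P)%nat -> u N P = u N N).
  { intros N P HNP. unfold u.
    replace P with (N + (P - N))%nat at 1 by lia.
    rewrite Rsum_nat_add.
    rewrite (Rsum_nat_0 (P - N)); [ring|]. intros i _. unfold v.
    destruct (Nat.eqb_spec (N mod S (N + i)) 0) as [Hz|Hz]; [|reflexivity].
    rewrite Nat.mod_small in Hz by lia. subst N.
    rewrite Nat.Div0.div_0_l, H0. unfold Rdiv. ring. }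
  assert (Hsmall : forall N P, (P <= N)%nat -> Rabs (u N P) <= INR N * K * INR N ^ l * x ^ N).
  { intros N P HPN.
    assert (Hpos : 0 <= INR N ^ l * x ^ N).
    { apply Rmult_le_pos; apply pow_le; [apply pos_INR | lra]. }
    apply Rle_trans with (INR P * (K * (INR N ^ l * x ^ N))).
    - apply Rsum_nat_bound. intros i _. unfold v.
      destruct (_ =? _)%nat.
      + rewrite Rabs_mult, (Rabs_pos_eq (_ * x ^ N)) by exact Hpos.
        apply Rmult_le_compat_r; [exact Hpos | apply HK].
      + rewrite Rabs_R0. now apply Rmult_le_pos.
    - replace (INR N * K * INR N ^ l * x ^ N) with (INR N * (K * (INR N ^ l * x ^ N))) by ring.
      apply Rmult_le_compat_r; [now apply Rmult_le_pos | now apply le_INR]. }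
  destruct (tannery eventually u (fun N => INR N * K * INR N ^ l * x ^ N) (fun N => u N N))
    as [_ Hlim].
  - exists 0%nat. intros P _ N.
    destruct (le_lt_dec P N) as [H|H]; [now apply Hsmall|].
    rewrite Hstab by lia. now apply Hsmall.
  - apply (ex_series_ext (fun n => scal (pow_n x n) (INR n * K * INR n ^ l))).
    { intros n. rewrite pow_n_pow. unfold scal. simpl. unfold mult. simpl. ring. }
    apply (ex_pseries_rad1 (fun n => INR n * K * INR n ^ l)); [|exact Hx1].
    apply rad1_mult_pow, rad1_linear.
  - intros N. apply (filterlim_ext_loc (fun _ => u N N)); [|apply filterlim_const].
    exists N. intros P HP. symmetry. now apply Hstab.
  - unfold is_lim_seq.
    replace (moment (dirichlet_coeff g m) l t) with (Series (fun N => u N N)).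
    + revert Hlim. apply filterlim_ext. exact Hser.
    + apply Series_ext. intros N. unfold dirichlet_coeff. fold x. rewrite divisor_sum_S.
      unfold u.
      rewrite Rmult_assoc, Rmult_comm, <- Rsum_nat_scal. apply Rsum_nat_ext. intros i _.
      unfold v. destruct (_ =? _)%nat; ring.
Qed.

(** The termwise integration, obtained without exchanging a sum and an integral: [iter_prim] is a
    finite combination of moments, and the powers (A t)^j supply the factors A^j of [lambert]. *)
Lemma lambert_iter_prim c g m j t : cancelling_kernel c g -> 0 < t ->
  is_lim_seq (fun P => Rsum_nat P (fun i =>
      iter_prim (moment (g (S i))) j (INR (S i) * t) / INR (S i) ^ m))
    (iter_prim (moment (dirichlet_coeff g m)) j t).
Proof.
  intros Hg Ht. induction j as [|j IH].
  - simpl. apply (is_lim_seq_ext (fun _ => 0)); [|apply is_lim_seq_const].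
    intros P. symmetry. apply Rsum_nat_0. intros; unfold Rdiv; ring.
  - simpl iter_prim at 2.
    apply (is_lim_seq_ext (fun P => / (2 * PI) *
      (t ^ j * Rsum_nat P (fun i => INR (S i) ^ j / INR (S i) ^ m * moment (g (S i)) j (INR (S i) * t))
       + INR j * Rsum_nat P (fun i => iter_prim (moment (g (S i))) j (INR (S i) * t) / INR (S i) ^ m)))).
    { intros P. rewrite <- !Rsum_nat_scal, <- Rsum_nat_plus, <- Rsum_nat_scal.
      apply Rsum_nat_ext. intros i _. cbn [iter_prim]. rewrite Rpow_mult_distr. field.
      split; [apply PI_neq0 | apply pow_nonzero, not_0_INR; lia]. }
    match goal with |- is_lim_seq _ (Finite (?a / ?b)) =>
      replace (a / b) with (/ b * a) by apply Rmult_comm end.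
    apply (is_lim_seq_scal_l _ (/ (2 * PI)) (Finite _)).
    apply is_lim_seq_plus'.
    + apply (is_lim_seq_scal_l _ (t ^ j) (Finite _)). now apply (lambert c).
    + apply (is_lim_seq_scal_l _ (INR j) (Finite _)). exact IH.
Qed.

Lemma Rsum_nat_blocks c P (f : nat -> R) :
  Rsum_nat (c * P) f = Rsum_nat P (fun p => Rsum_nat c (fun i => f (c * p + i)%nat)).
Proof.
  induction P as [|P IH].
  - now rewrite Nat.mul_0_r.
  - rewrite Rsum_nat_S, <- IH, <- Rsum_nat_add. f_equal. lia.
Qed.

Lemma is_series_blocks c (f : nat -> R) (s : R) : (0 < c)%nat ->
  is_lim_seq (fun P => Rsum_nat (c * P) f) s ->
  is_series (fun p => Rsum_nat c (fun i => f (c * p + i)%nat)) s.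
Proof.
  intros Hc H. apply is_lim_seq_incr_1 in H.
  change (is_lim_seq (sum_n (fun p => Rsum_nat c (fun i => f (c * p + i)%nat))) s).
  revert H. apply is_lim_seq_ext. intros n.
  now rewrite sum_n_Rsum_nat, Rsum_nat_blocks.
Qed.

Lemma iter_prim_blocks c g m t : cancelling_kernel c g -> 0 < t ->
  Series (fun p => block c g m p t) = iter_prim (moment (dirichlet_coeff g m)) m t.
Proof.
  intros Hg Ht. pose proof Hg as (Hc & _). apply is_series_unique.
  (* Only partial sums of length c P are kept, since the estimates concern whole blocks. *)
  pose proof (is_lim_seq_subseq_mul _ _ c Hc (lambert_iter_prim c g m m t Hg Ht)) as H.
  apply is_series_blocks in H; [|exact Hc]. revert H. apply is_series_ext.
  intros p. apply Rsum_nat_ext. intros i _. now rewrite Nat.add_succ_r.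
Qed.

Lemma period_primitive_lim_0 c g m : cancelling_kernel c g ->
  exists V : R,
    is_lim_seq (fun P => Rsum_nat (c * P) (fun i =>
      INR (fact m) / (2 * PI) ^ S m * (abel_value c (g (S i)) / INR (S i) ^ S m))) V /\
    filterlim (iter_prim (moment (dirichlet_coeff g (S m))) (S m)) (at_right 0) (locally V).
Proof.
  intros Hg. pose proof Hg as (Hc & _ & _ & H0 & Hw & _).
  destruct (block_bound c g m Hg) as [K HK].
  set (kap := INR (fact m) / (2 * PI) ^ S m).
  set (lim := fun p => Rsum_nat c (fun i =>
     kap * (abel_value c (g (c * p + S i)%nat) / INR (c * p + S i) ^ S m))).
  destruct (tannery (at_right 0) (block c g (S m)) (fun p => K * / INR (S p) ^ 2) lim)
    as [Hex Hlim].
  - apply at_right_pos. intros t Ht p. now apply HK.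
  - apply ex_series_inv_sq.
  - intros p. unfold block, lim.
    apply (filterlim_Rsum_nat (at_right 0) c
      (fun i t => iter_prim (moment (g (c * p + S i)%nat)) (S m) (INR (c * p + S i) * t)
         / INR (c * p + S i) ^ S m)).
    intros i _. set (A := (c * p + S i)%nat).
    assert (HA : 0 < INR A) by (apply lt_0_INR; unfold A; lia).
    apply (filterlim_ext (fun t => / INR A ^ S m *
       iter_prim (moment (g A)) (S m) (INR A * t))).
    { intros t. apply Rmult_comm. }
    replace (kap * (abel_value c (g A) / INR A ^ S m)) with
      (/ INR A ^ S m * (kap * abel_value c (g A))) by (unfold Rdiv; ring).
    apply filterlim_const_mult; [apply at_right_proper_filter|].
    eapply filterlim_comp.
    2:{ apply (iter_prim_moment_lim_0 c); auto. now apply (kernel_rad1 c). }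
    intros Q [d Hd]. assert (Hd' : 0 < d / INR A) by (apply Rdiv_lt_0_compat; [apply cond_pos|exact HA]).
    exists (mkposreal _ Hd'). intros t Hb Ht. apply Hd.
    + unfold ball in *. simpl in *. unfold AbsRing_ball, abs, minus, plus, opp in *. simpl in *.
      rewrite Ropp_0, Rplus_0_r in *. rewrite Rabs_mult, (Rabs_pos_eq (INR A)) by lra.
      apply Rlt_div_r in Hb; [|exact HA]. lra.
    + now apply Rmult_lt_0_compat.
  - exists (Series lim). split.
    + apply is_lim_seq_incr_1.
      assert (H : is_lim_seq (sum_n lim) (Series lim)) by exact (Series_correct _ Hex).
      revert H. apply is_lim_seq_ext. intros n.
      rewrite sum_n_Rsum_nat, Rsum_nat_blocks. apply Rsum_nat_ext. intros p _.
      apply Rsum_nat_ext. intros i _. now rewrite Nat.add_succ_r.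
    + revert Hlim. apply filterlim_ext_loc. apply at_right_pos. intros t Ht.
      now apply iter_prim_blocks.
Qed.

Lemma period_primitive_lim_infty c g m : cancelling_kernel c g ->
  filterlim (iter_prim (moment (dirichlet_coeff g (S m))) (S m)) (Rbar_locally p_infty)
    (locally 0).
Proof.
  intros Hg. pose proof Hg as (Hc & _ & _ & H0 & Hw & _).
  destruct (block_bound c g m Hg) as [K HK].
  destruct (tannery (Rbar_locally p_infty) (block c g (S m)) (fun p => K * / INR (S p) ^ 2)
    (fun _ => 0)) as [_ Hlim].
  - apply p_infty_pos. intros t Ht p. now apply HK.
  - apply ex_series_inv_sq.
  - intros p. unfold block. rewrite <- (Rsum_nat_0 c (fun _ => 0)) at 1 by auto.
    apply (filterlim_Rsum_nat (Rbar_locally p_infty) c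
      (fun i t => iter_prim (moment (g (c * p + S i)%nat)) (S m) (INR (c * p + S i) * t)
         / INR (c * p + S i) ^ S m)).
    intros i _. set (A := (c * p + S i)%nat).
    assert (HA : 0 < INR A) by (apply lt_0_INR; unfold A; lia).
    apply (filterlim_ext (fun t => / INR A ^ S m *
       iter_prim (moment (g A)) (S m) (INR A * t))).
    { intros t. apply Rmult_comm. }
    rewrite <- (Rmult_0_r (/ INR A ^ S m)).
    apply filterlim_const_mult; [apply Rbar_locally_filter|].
    eapply filterlim_comp.
    2:{ apply (iter_prim_moment_lim_infty c); auto. now apply (kernel_rad1 c). }
    intros Q [M HM]. exists (M / INR A). intros t Ht. apply HM.
    apply Rlt_div_l in Ht; [|exact HA]. lra.
  - rewrite (is_series_unique _ _ is_series_zero) in Hlim.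
    revert Hlim. apply filterlim_ext_loc. apply p_infty_pos. intros t Ht.
    now apply iter_prim_blocks.
Qed.

(** * Dirichlet characters and Gauss sums *)


Lemma Csum_nat_perm n f (l : list nat) : Permutation l (seq 0 n) ->
  fold_right Cplus (RtoC 0) (map f l) = Csum_nat n f.
Proof.
  intros H. unfold Csum_nat. apply (Permutation_map f) in H. revert H.
  generalize (map f l), (map f (seq 0 n)). induction 1; simpl; try congruence. ring.
Qed.

Lemma periodic_Zmult (F : Z -> C) q z n : (forall n, F (n + q)%Z = F n) -> F (n + z * q)%Z = F n.
Proof.
  intros H. assert (Hn : forall p n, F (n + Z.of_nat p * q)%Z = F n).
  { induction p as [|p IH]; intros x; [f_equal; lia|].
    rewrite <- (IH x), <- (H (x + Z.of_nat p * q)%Z). f_equal. rewrite Nat2Z.inj_succ. ring. }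
  destruct (Z_le_gt_dec 0 z).
  - rewrite <- (Hn (Z.to_nat z) n), Z2Nat.id by lia. reflexivity.
  - rewrite <- (Hn (Z.to_nat (- z)) (n + z * q)%Z), Z2Nat.id by lia. f_equal. ring.
Qed.

Lemma Csum_affine (q : nat) (F : Z -> C) (u s : Z) :
  (forall n, F (n + Z.of_nat q)%Z = F n) -> Z.gcd u (Z.of_nat q) = 1%Z ->
  Csum_nat q (fun n => F (u * Z.of_nat n + s)%Z) = Csum_nat q (fun n => F (Z.of_nat n)).
Proof.
  intros HF Hu. destruct (Nat.eq_dec q 0) as [->|Hq]; [reflexivity|].
  set (phi := fun n => Z.to_nat ((u * Z.of_nat n + s) mod Z.of_nat q)).
  assert (Hb : forall n, (0 <= (u * Z.of_nat n + s) mod Z.of_nat q < Z.of_nat q)%Z)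
    by (intros; apply Z.mod_pos_bound; lia).
  transitivity (fold_right Cplus (RtoC 0) (map (fun n => F (Z.of_nat n)) (map phi (seq 0 q)))).
  - rewrite map_map. unfold Csum_nat. f_equal. apply map_ext. intros n.
    unfold phi. rewrite Z2Nat.id by apply Hb.
    generalize (u * Z.of_nat n + s)%Z. intros x.
    replace x with (x mod Z.of_nat q + x / Z.of_nat q * Z.of_nat q)%Z at 1
      by (pose proof (Z.div_mod x (Z.of_nat q) ltac:(lia)); lia).
    now apply periodic_Zmult.
  (* As u is invertible mod q, the map is injective on residues; with equal lengths this gives a
     permutation. *)
  - apply Csum_nat_perm, NoDup_Permutation_bis.
    + apply NoDup_map_NoDup_ForallPairs; [|apply seq_NoDup].
      intros x y Hx%in_seq Hy%in_seq E. unfold phi in E.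
      apply Z2Nat.inj in E; [|apply Hb|apply Hb].
      apply Z.cong_iff_0 in E.
      replace (u * Z.of_nat x + s - (u * Z.of_nat y + s))%Z
        with (u * (Z.of_nat x - Z.of_nat y))%Z in E by lia.
      apply Z.mod_divide in E; [|lia].
      apply Z.gauss in E; [|rewrite Z.gcd_comm; exact Hu].
      destruct E as [w Hw]. assert (w = 0)%Z by nia. lia.
    + rewrite length_map. lia.
    + intros x Hx. apply in_map_iff in Hx. destruct Hx as [y [<- Hy]].
      apply in_seq. specialize (Hb y). unfold phi. lia.
Qed.

(** A shift by s leaves the sum over a period unchanged, yet multiplies it by zeta, which is not
    1. *)
Lemma Csum_twist_0 (c : nat) (F : Z -> C) (s : Z) (zeta : C) (n : Z) :
  (forall z, F (z + Z.of_nat c)%Z = F z) -> (forall z, F (z + s)%Z = (zeta * F z)%C) ->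
  zeta <> RtoC 1 -> Csum_nat c (fun i => F (n + Z.of_nat i)%Z) = RtoC 0.
Proof.
  intros HF Hs Hz.
  assert (H1 : forall s, Csum_nat c (fun i => F (Z.of_nat i + s)%Z) = Csum_nat c (fun i => F (Z.of_nat i))).
  { intros s'. rewrite <- (Csum_affine c F 1 s' HF) by apply Z.gcd_1_l.
    apply Csum_nat_ext. intros i _. f_equal. lia. }
  rewrite (Csum_nat_ext c _ (fun i => F (Z.of_nat i + n)%Z)) by (intros; f_equal; lia).
  rewrite H1. specialize (H1 s).
  rewrite (Csum_nat_ext c _ (fun i => zeta * F (Z.of_nat i))%C) in H1 by (intros; apply Hs).
  rewrite Csum_nat_scal in H1. set (X := Csum_nat c _) in *.
  assert (E : ((zeta - 1) * X = 0)%C).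
  { replace ((zeta - 1) * X)%C with (zeta * X - X)%C by ring. rewrite H1. ring. }
  assert (Hz1 : (zeta - 1)%C <> RtoC 0).
  { intros H. apply Hz. replace zeta with ((zeta - 1) + 1)%C by ring. rewrite H. ring. }
  destruct (Ceq_dec X 0) as [|Hne]; [assumption|].
  exfalso. revert E. now apply Cmult_neq_0.
Qed.

Lemma e_RtoC x : e (RtoC x) = (cos (2 * PI * x), sin (2 * PI * x)).
Proof.
  unfold e, RtoC. simpl. rewrite Rmult_0_r, Ropp_0, exp_0, !Rmult_1_l. reflexivity.
Qed.

Lemma e_plus x y : e (RtoC (x + y)) = (e (RtoC x) * e (RtoC y))%C.
Proof.
  rewrite !e_RtoC, Rmult_plus_distr_l, cos_plus, sin_plus. unfold Cmult. simpl. f_equal. ring.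
Qed.

Lemma e_0 : e (RtoC 0) = RtoC 1.
Proof. rewrite e_RtoC, Rmult_0_r, cos_0, sin_0. reflexivity. Qed.

Lemma e_IZR n : e (RtoC (IZR n)) = RtoC 1.
Proof.
  assert (H : forall p, e (RtoC (INR p)) = RtoC 1).
  { induction p as [|p IH]; [apply e_0|].
    rewrite S_INR, e_plus, IH, e_RtoC, Rmult_1_r, cos_2PI, sin_2PI.
    unfold Cmult, RtoC. simpl. f_equal; ring. }
  destruct (Z_le_gt_dec 0 n).
  - rewrite <- (H (Z.to_nat n)), INR_IZR_INZ. do 3 f_equal. lia.
  - rewrite <- e_0. replace 0 with (IZR n + INR (Z.to_nat (- n))).
    + rewrite e_plus, H. ring.
    + rewrite INR_IZR_INZ, <- plus_IZR. f_equal. lia.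
Qed.

Lemma e_eq_1 x : e (RtoC x) = RtoC 1 -> exists n, x = IZR n.
Proof.
  rewrite e_RtoC. intros H. injection H as H _.
  replace (2 * PI * x) with (2 * (PI * x)) in H by ring.
  rewrite cos_2a_sin in H.
  assert (Hs : sin (PI * x) = 0) by nra.
  apply sin_eq_0_0 in Hs. destruct Hs as [n Hn]. exists n.
  apply (Rmult_eq_reg_l PI); [|apply PI_neq0]. rewrite Hn. ring.
Qed.

Lemma e_conj x : e (RtoC (- x)) = Cconj (e (RtoC x)).
Proof.
  rewrite !e_RtoC. replace (2 * PI * - x) with (- (2 * PI * x)) by ring.
  rewrite cos_neg, sin_neg. reflexivity.
Qed.

Lemma Cmod_e x : Cmod (e (RtoC x)) = 1.
Proof.
  rewrite e_RtoC. unfold Cmod. simpl.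
  rewrite !Rmult_1_r, Rplus_comm, <- sqrt_1. f_equal.
  apply (sin2_cos2 (2 * PI * x)).
Qed.

Lemma char_periodic q chi z n : is_dirichlet_char q chi -> chi (n + z * q)%Z = chi n.
Proof. intros (_ & _ & H & _). now apply periodic_Zmult. Qed.

Lemma char_1 q chi : is_dirichlet_char q chi -> chi 1%Z = RtoC 1.
Proof.
  intros (_ & Hm & _ & H0).
  assert (H1 : chi 1%Z <> RtoC 0).
  { intros H. apply H0 in H. apply H, Z.gcd_1_l. }
  pose proof (Hm 1%Z 1%Z) as H. simpl in H.
  replace (chi 1%Z) with (/ chi 1%Z * (chi 1%Z * chi 1%Z))%C at 1.
  - rewrite <- H. now apply Cinv_l.
  - rewrite Cmult_assoc, Cinv_l by exact H1. ring.
Qed.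

Lemma char_bounded q chi : is_dirichlet_char q chi ->
  exists K, forall n, Cmod (chi n) <= K.
Proof.
  intros H. pose proof H as (Hq & _).
  assert (Hb : forall p, exists K, forall n, (n < p)%nat -> Cmod (chi (Z.of_nat n)) <= K).
  { induction p as [|p [K HK]]; [exists 0; intros; lia|].
    exists (Rmax K (Cmod (chi (Z.of_nat p)))). intros n Hn.
    destruct (Nat.eq_dec n p) as [->|]; [apply Rmax_r|].
    eapply Rle_trans; [apply HK; lia | apply Rmax_l]. }
  destruct (Hb (Z.to_nat q)) as [K HK]. exists K. intros n.
  pose proof (Z.mod_pos_bound n q Hq).
  replace n with (n mod q + n / q * q)%Z by (pose proof (Z.div_mod n q ltac:(lia)); lia).
  rewrite (char_periodic q) by assumption.
  specialize (HK (Z.to_nat (n mod q)) ltac:(lia)). rewrite Z2Nat.id in HK by lia. exact HK.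
Qed.

(** Powers of chi(n) are again values of chi, which form a bounded set. *)
Lemma char_Cmod_le_1 q chi n : is_dirichlet_char q chi -> Cmod (chi n) <= 1.
Proof.
  intros H. destruct (char_bounded q chi H) as [K HK].
  destruct (Rle_lt_dec (Cmod (chi n)) 1) as [|Hgt]; [assumption|exfalso].
  assert (Hpow : forall p, exists x, Cmod (chi x) = Cmod (chi n) ^ p).
  { induction p as [|p [x Hx]].
    - exists 1%Z. rewrite (char_1 q chi H), Cmod_1. reflexivity.
    - exists (n * x)%Z. destruct H as (_ & Hm & _). rewrite Hm, Cmod_mult, Hx. reflexivity. }
  destruct (Pow_x_infinity (Cmod (chi n))) with (b := K + 1) as [N HN].
  { rewrite Rabs_pos_eq; [exact Hgt | apply Cmod_ge_0]. }
  specialize (HN N (le_n N)). destruct (Hpow N) as [x Hx].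
  rewrite <- Hx, Rabs_pos_eq in HN by apply Cmod_ge_0. specialize (HK x). lra.
Qed.

Lemma char_coprime q chi n : is_dirichlet_char q chi -> chi n <> RtoC 0 -> Z.gcd n q = 1%Z.
Proof.
  intros (_ & _ & _ & H0) Hn. destruct (Z.eq_dec (Z.gcd n q) 1) as [|Hne]; [assumption|].
  exfalso. apply Hn, H0, Hne.
Qed.

(** With u inverse to n mod q, |chi(u)| |chi(n)| = 1 and neither factor exceeds 1. *)
Lemma char_mul_conj q chi n : is_dirichlet_char q chi -> chi n <> RtoC 0 ->
  (chi n * Cconj (chi n))%C = RtoC 1.
Proof.
  intros H Hn. pose proof (char_coprime q chi n H Hn) as Hg.
  destruct (Z.gcd_bezout n q 1 Hg) as [u [v Huv]].
  assert (Hu : (chi u * chi n)%C = RtoC 1).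
  { pose proof H as (_ & Hm & _). rewrite <- Hm, <- (char_1 q chi H).
    replace (u * n)%Z with (1 + (- v) * q)%Z by lia. now apply (char_periodic q). }
  pose proof (char_Cmod_le_1 q chi n H) as H1. pose proof (char_Cmod_le_1 q chi u H) as H2.
  assert (H3 : Cmod (chi u) * Cmod (chi n) = 1) by (rewrite <- Cmod_mult, Hu; apply Cmod_1).
  pose proof (Cmod_ge_0 (chi n)). pose proof (Cmod_ge_0 (chi u)).
  assert (Hmod : Cmod (chi n) = 1) by nra.
  rewrite <- Cmod2_conj, Hmod. unfold RtoC. f_equal. ring.
Qed.

Lemma nontrivial_modulus q chi : is_dirichlet_char q chi -> nontrivial_char chi -> (1 < q)%Z.
Proof.
  intros H [n [_ Hn]]. pose proof H as (Hq & _).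
  destruct (Z.eq_dec q 1) as [->|]; [|lia].
  exfalso. apply Hn. rewrite <- (char_1 1 chi H).
  replace n with (1 + (n - 1) * 1)%Z by lia. now apply (char_periodic 1).
Qed.

Lemma char_conj_mult q chi m n : is_dirichlet_char q chi ->
  Cconj (chi (m * n)%Z) = (Cconj (chi m) * Cconj (chi n))%C.
Proof. intros (_ & Hm & _). rewrite Hm. apply Cmult_conj. Qed.

(** For A coprime to q this is the substitution n -> A n. For other A the right side must vanish,
    and this is where primitivity enters. *)
Lemma gauss_sum_twist q chi (A : Z) : primitive_char q chi ->
  (chi A * gauss_sum q (fun n => Cconj (chi n)))%C =
  Csum_nat (Z.to_nat q) (fun n =>
    (Cconj (chi (Z.of_nat n)) * e (RtoC (IZR (Z.of_nat n * A) / IZR q)))%C).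
Proof.
  intros [H Hprim]. pose proof H as (Hq & Hm & Hp & H0).
  assert (HqR : IZR q <> 0) by (apply not_0_IZR; lia).
  assert (Hqn : Z.of_nat (Z.to_nat q) = q) by lia.
  set (F := fun B n => (Cconj (chi n) * e (RtoC (IZR (n * B) / IZR q)))%C).
  assert (HF : forall B n, F B (n + Z.of_nat (Z.to_nat q))%Z = F B n).
  { intros B n. unfold F. rewrite Hqn, Hp. f_equal.
    replace (IZR ((n + q) * B) / IZR q) with (IZR (n * B) / IZR q + IZR B).
    - rewrite e_plus, e_IZR. ring.
    - rewrite Z.mul_add_distr_r, plus_IZR, (mult_IZR q). field. exact HqR. }
  change (chi A * gauss_sum q (fun n => Cconj (chi n)) =
    Csum_nat (Z.to_nat q) (fun n => F A (Z.of_nat n)))%C.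
  replace (gauss_sum q (fun n => Cconj (chi n)))
    with (Csum_nat (Z.to_nat q) (fun n => F 1%Z (Z.of_nat n))).
  2:{ apply Csum_nat_ext. intros n _. unfold F. now rewrite Z.mul_1_r, <- INR_IZR_INZ. }
  destruct (Ceq_dec (chi A) 0) as [HA|HA].
  - (* [n0 = 1 mod q / gcd A q] with [chi n0 <> 1]: replacing n by n0 n shows the sum vanishes *)
    rewrite HA, Cmult_0_l. apply H0 in HA.
    set (g := Z.gcd A q) in *.
    assert (Hg0 : (0 < g)%Z).
    { pose proof (Z.gcd_nonneg A q). unfold g.
      destruct (Z.eq_dec (Z.gcd A q) 0) as [E|]; [apply Z.gcd_eq_0_r in E; lia | lia]. }
    destruct (Z.gcd_divide_r A q) as [d Hd]. destruct (Z.gcd_divide_l A q) as [A' HA'].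
    fold g in Hd, HA'.
    destruct (Hprim d) as [n0 [Hn0 [[w Hw] Hchi]]]; [nia | exists g; lia | nia |].
    symmetry.
    assert (E : Csum_nat (Z.to_nat q) (fun n => F A (n0 * Z.of_nat n + 0)%Z) =
      (Cconj (chi n0) * Csum_nat (Z.to_nat q) (fun n => F A (Z.of_nat n)))%C).
    { rewrite <- Csum_nat_scal. apply Csum_nat_ext. intros n _. unfold F.
      rewrite Z.add_0_r, (char_conj_mult q) by exact H.
      replace (IZR (n0 * Z.of_nat n * A) / IZR q)
        with (IZR (Z.of_nat n * A) / IZR q + IZR (w * A' * Z.of_nat n)).
      - rewrite e_plus, e_IZR. ring.
      - replace (n0 * Z.of_nat n * A)%Z with (Z.of_nat n * A + (w * A' * Z.of_nat n) * q)%Z.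
        + rewrite plus_IZR, (mult_IZR _ q). field. exact HqR.
        + replace n0 with (1 + w * d)%Z by lia. rewrite HA', Hd. ring. }
    rewrite (Csum_affine (Z.to_nat q) (F A) n0 0) in E by (auto; now rewrite Hqn).
    set (X := Csum_nat _ _) in *.
    destruct (Ceq_dec X 0) as [|HX]; [assumption|]. exfalso. apply Hchi.
    rewrite <- (Cconj_conj (chi n0)).
    replace (Cconj (chi n0)) with (Cconj (chi n0) * X * / X)%C.
    + rewrite <- E, Cinv_r by exact HX. unfold Cconj, RtoC. simpl. now rewrite Ropp_0.
    + rewrite <- Cmult_assoc, Cinv_r by exact HX. ring.
  - rewrite <- (Csum_affine (Z.to_nat q) (F 1%Z) A 0); auto.
    2:{ rewrite Hqn. now apply (char_coprime q chi). }
    rewrite <- Csum_nat_scal. apply Csum_nat_ext. intros n _. unfold F.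
    rewrite Z.add_0_r, (char_conj_mult q), Z.mul_1_r, (Z.mul_comm A) by exact H.
    rewrite !Cmult_assoc, (char_mul_conj q) by assumption. ring.
Qed.

(** * The twisted kernel and the Eisenstein series *)


(** The coefficient of the double series on the line Re z = a/c, apart from the factor 2 and the
    power of B. *)
Definition twist (chi1 chi2 : Z -> C) (a c A B : Z) : C :=
  (chi1 A * Cconj (chi2 B) * e (RtoC (IZR (A * B * a) / IZR c)))%C.

Lemma e_div_period x y c : (0 < c)%Z ->
  e (RtoC (IZR (x + y * c) / IZR c)) = e (RtoC (IZR x / IZR c)).
Proof.
  intros Hc. replace (IZR (x + y * c) / IZR c) with (IZR x / IZR c + IZR y).
  - rewrite e_plus, e_IZR. ring.
  - rewrite plus_IZR, mult_IZR. field. apply not_0_IZR. lia.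
Qed.

Lemma e_div_ne_1 x c : (0 < c)%Z -> ~ (c | x)%Z -> e (RtoC (IZR x / IZR c)) <> RtoC 1.
Proof.
  intros Hc Hx H. apply Hx. apply e_eq_1 in H. destruct H as [n Hn]. exists n.
  apply eq_IZR. rewrite mult_IZR, <- Hn. field. apply not_0_IZR. lia.
Qed.

Lemma char_dvd_0 q chi n : is_dirichlet_char q chi -> (1 < q)%Z -> (q | n)%Z -> chi n = RtoC 0.
Proof.
  intros (_ & _ & _ & H0) Hq Hn. apply H0.
  rewrite Z.gcd_comm, (proj1 (Z.divide_gcd_iff q n ltac:(lia)) Hn). lia.
Qed.

(** The shift A -> A + q1 multiplies by e(q1 B a / c). As q1 q2 | c and a is coprime to c, this is 1
    only if q2 | B, and then chi2(B) = 0. *)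
Lemma twist_sum_l chi1 chi2 q1 q2 a b c d n B :
  is_dirichlet_char q1 chi1 -> is_dirichlet_char q2 chi2 -> (1 < q2)%Z ->
  in_Gamma0 (q1 * q2) a b c d -> (0 < c)%Z ->
  Csum_nat (Z.to_nat c) (fun i => twist chi1 chi2 a c (n + Z.of_nat i) B) = RtoC 0.
Proof.
  intros H1 H2 Hq2 [Hdet [w Hw]] Hc. pose proof H1 as (Hq1 & _).
  destruct (Ceq_dec (chi2 B) 0) as [HB|HB].
  { apply Csum_nat_0. intros i _. unfold twist. rewrite HB.
    replace (Cconj 0) with (RtoC 0) by (unfold Cconj, RtoC; simpl; now rewrite Ropp_0). ring. }
  apply (Csum_twist_0 (Z.to_nat c) (fun A => twist chi1 chi2 a c A B) q1
    (e (RtoC (IZR (q1 * B * a) / IZR c))) n).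
  - intros z. rewrite Z2Nat.id by lia. unfold twist. f_equal; [f_equal|].
    + rewrite <- (char_periodic q1 chi1 (w * q2) z H1). f_equal. lia.
    + rewrite <- (e_div_period (z * B * a) (B * a) c Hc). do 4 f_equal. ring.
  - intros z. unfold twist.
    replace ((z + q1) * B * a)%Z with (q1 * B * a + z * B * a)%Z by ring.
    rewrite plus_IZR, Rdiv_plus_distr, e_plus.
    replace (chi1 (z + q1)%Z) with (chi1 z); [ring|].
    symmetry. apply (proj1 (proj2 (proj2 H1))).
  - apply e_div_ne_1; [exact Hc|]. intros [v Hv]. apply HB.
    apply (char_dvd_0 q2 chi2 B H2 Hq2).
    apply (Z.gauss q2 a B).
    + exists (v * w)%Z. nia.
    + apply Znumtheory.Zgcd_1_rel_prime. apply rel_prime_sym, bezout_rel_prime.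
      (* The determinant with c = w q1 q2 reads d a - (b w q1) q2 = 1. *)
      apply (Bezout_intro _ _ _ d (- (b * w * q1))%Z). nia.
Qed.

Lemma twist_sum_r chi1 chi2 q1 q2 a b c d n A :
  is_dirichlet_char q1 chi1 -> is_dirichlet_char q2 chi2 -> (1 < q1)%Z ->
  in_Gamma0 (q1 * q2) a b c d -> (0 < c)%Z ->
  Csum_nat (Z.to_nat c) (fun i => twist chi1 chi2 a c A (n + Z.of_nat i)) = RtoC 0.
Proof.
  intros H1 H2 Hq1 [Hdet [w Hw]] Hc. pose proof H2 as (Hq2 & _).
  destruct (Ceq_dec (chi1 A) 0) as [HA|HA].
  { apply Csum_nat_0. intros i _. unfold twist. rewrite HA. ring. }
  apply (Csum_twist_0 (Z.to_nat c) (fun B => twist chi1 chi2 a c A B) q2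
    (e (RtoC (IZR (A * q2 * a) / IZR c))) n).
  - intros z. rewrite Z2Nat.id by lia. unfold twist. f_equal; [f_equal; f_equal|].
    + rewrite <- (char_periodic q2 chi2 (w * q1) z H2). f_equal. lia.
    + rewrite <- (e_div_period (A * z * a) (A * a) c Hc). do 4 f_equal. ring.
  - intros z. unfold twist.
    replace (A * (z + q2) * a)%Z with (A * q2 * a + A * z * a)%Z by ring.
    rewrite plus_IZR, Rdiv_plus_distr, e_plus.
    replace (chi2 (z + q2)%Z) with (chi2 z); [ring|].
    symmetry. apply (proj1 (proj2 (proj2 H2))).
  - apply e_div_ne_1; [exact Hc|]. intros [v Hv]. apply HA.
    apply (char_dvd_0 q1 chi1 A H1 Hq1).
    apply (Z.gauss q1 a A).
    + exists (v * w)%Z. nia.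
    + apply Znumtheory.Zgcd_1_rel_prime. apply rel_prime_sym, bezout_rel_prime.
      apply (Bezout_intro _ _ _ d (- (b * w * q2))%Z). nia.
Qed.

Lemma Rabs_Re_le_Cmod z : Rabs (Re z) <= Cmod z.
Proof. eapply Rle_trans; [|apply Rmax_Cmod]. apply Rmax_l. Qed.

Lemma Rabs_Im_le_Cmod z : Rabs (Im z) <= Cmod z.
Proof. eapply Rle_trans; [|apply Rmax_Cmod]. apply Rmax_r. Qed.

(** [part] stands for Re or Im, so that the real analysis above is applied twice. *)
Lemma twist_kernel chi1 chi2 q1 q2 a b c d (part : C -> R) :
  is_dirichlet_char q1 chi1 -> is_dirichlet_char q2 chi2 -> (1 < q1)%Z -> (1 < q2)%Z ->
  in_Gamma0 (q1 * q2) a b c d -> (0 < c)%Z ->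
  (forall z, Rabs (part z) <= Cmod z) ->
  (forall n f, part (Csum_nat n f) = Rsum_nat n (fun i => part (f i))) ->
  cancelling_kernel (Z.to_nat c)
    (fun A B => part (twist chi1 chi2 a c (Z.of_nat A) (Z.of_nat B))).
Proof.
  intros H1 H2 Hq1 Hq2 HG Hc Hpart Hsum.
  assert (Hp0 : part (RtoC 0) = 0).
  { specialize (Hpart (RtoC 0)). rewrite Cmod_0 in Hpart.
    revert Hpart. unfold Rabs. destruct Rcase_abs; lra. }
  split; [lia|]. repeat split.
  - intros A B. destruct HG as [_ [w Hw]]. f_equal. rewrite Nat2Z.inj_add, Z2Nat.id by lia.
    unfold twist. f_equal; [f_equal|].
    + rewrite <- (char_periodic q1 chi1 (w * q2) (Z.of_nat A) H1). f_equal. lia.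
    + rewrite <- (e_div_period (Z.of_nat A * Z.of_nat B * a) (Z.of_nat B * a) c Hc).
      do 4 f_equal. ring.
  - exists 1. intros A B. eapply Rle_trans; [apply Hpart|]. unfold twist.
    rewrite !Cmod_mult, Cmod_e, Cmod_conj, Rmult_1_r.
    pose proof (char_Cmod_le_1 q1 chi1 (Z.of_nat A) H1).
    pose proof (char_Cmod_le_1 q2 chi2 (Z.of_nat B) H2).
    pose proof (Cmod_ge_0 (chi1 (Z.of_nat A))). pose proof (Cmod_ge_0 (chi2 (Z.of_nat B))).
    nra.
  - intros A. rewrite <- Hp0. f_equal. unfold twist.
    rewrite (char_dvd_0 q2 chi2 (Z.of_nat 0) H2 Hq2) by apply Z.divide_0_r.
    replace (Cconj 0) with (RtoC 0) by (unfold Cconj, RtoC; simpl; now rewrite Ropp_0). ring.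
  - intros A n. unfold window. rewrite <- Hp0, <- Hsum.
    rewrite <- (twist_sum_r chi1 chi2 q1 q2 a b c d (Z.of_nat n) (Z.of_nat A)) by assumption.
    f_equal. apply Csum_nat_ext. intros i _. now rewrite Nat2Z.inj_add.
  - intros n B. rewrite <- Hp0, <- Hsum.
    rewrite <- (twist_sum_l chi1 chi2 q1 q2 a b c d (Z.of_nat n) (Z.of_nat B)) by assumption.
    f_equal. apply Csum_nat_ext. intros i _. now rewrite Nat2Z.inj_add.
Qed.

Lemma Re_Csum n f : Re (Csum_nat n f) = Rsum_nat n (fun i => Re (f i)).
Proof. now rewrite Csum_nat_pair. Qed.

Lemma Im_Csum n f : Im (Csum_nat n f) = Rsum_nat n (fun i => Im (f i)).
Proof. now rewrite Csum_nat_pair. Qed.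

Lemma e_eis_arg a c t N : (0 < c)%Z ->
  e (RtoC (INR N) * ((IZR a / IZR c)%R, t))%C =
  (RtoC (exp (- (2 * PI * t)) ^ N) * e (RtoC (IZR (Z.of_nat N * a) / IZR c)))%C.
Proof.
  intros Hc. rewrite e_RtoC. unfold e, Cmult, RtoC. simpl.
  rewrite exp_pow_n, !Rmult_0_l, Rminus_0_r, Rplus_0_r, mult_IZR, <- INR_IZR_INZ.
  replace (2 * PI * (INR N * (IZR a / IZR c))) with (2 * PI * (INR N * IZR a / IZR c))
    by (field; apply not_0_IZR; lia).
  replace (- (2 * PI * (INR N * t))) with (INR N * - (2 * PI * t)) by ring.
  f_equal; ring.
Qed.

Lemma eis_term_part chi1 chi2 m a c t n (part : C -> R) : (0 < c)%Z ->
  (forall n f, part (Csum_nat n f) = Rsum_nat n (fun i => part (f i))) ->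
  (forall x z, part (RtoC x * z)%C = x * part z) ->
  part (eis_term chi1 chi2 (S (S m)) ((IZR a / IZR c)%R, t) n) =
  dirichlet_coeff (fun A B => part (twist chi1 chi2 a c (Z.of_nat A) (Z.of_nat B))) (S m) (S n)
    * INR (S n) ^ S m * exp (- (2 * PI * t)) ^ S n.
Proof.
  intros Hc Hsum Hscal. unfold eis_term. rewrite e_eis_arg by exact Hc.
  unfold eis_coeff. set (x := exp (- (2 * PI * t)) ^ S n).
  set (E := e (RtoC (IZR (Z.of_nat (S n) * a) / IZR c))).
  match goal with |- part (?co * _)%C = _ =>
    replace (co * (RtoC x * E))%C with (RtoC x * (E * co))%C by ring end.
  rewrite Hscal, (Rmult_comm _ x). f_equal.
  rewrite <- Csum_nat_scal, Hsum. unfold dirichlet_coeff, divisor_sum.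
  rewrite Rmult_comm, <- Rsum_nat_scal. apply Rsum_nat_ext. intros A _.
  destruct (Nat.leb_spec 1 A) as [HA|HA]; cbn [andb].
  2:{ replace (E * 0)%C with (RtoC 0 * 0)%C by ring. rewrite Hscal. ring. }
  destruct (Nat.eqb_spec (S n mod A) 0) as [Hz|Hz]; cbn [andb].
  2:{ replace (E * 0)%C with (RtoC 0 * 0)%C by ring. rewrite Hscal. ring. }
  assert (EN : S n = (A * (S n / A))%nat).
  { rewrite (Nat.div_mod (S n) A) at 1 by lia. lia. }
  set (B := (S n / A)%nat) in *.
  replace (S (S m) - 1)%nat with (S m) by lia.
  replace (E * (chi1 (Z.of_nat A) * Cconj (chi2 (Z.of_nat B)) * RtoC (INR B ^ S m)))%C
    with (RtoC (INR B ^ S m) * twist chi1 chi2 a c (Z.of_nat A) (Z.of_nat B))%C.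
  2:{ unfold twist, E. rewrite EN, Nat2Z.inj_mul. ring. }
  rewrite Hscal, EN, mult_INR, Rpow_mult_distr. field.
  apply pow_nonzero, not_0_INR. lia.
Qed.

Lemma Series_eis_part chi1 chi2 m a c t (part : C -> R) :
  let g := fun A B : nat => part (twist chi1 chi2 a c (Z.of_nat A) (Z.of_nat B)) in
  (0 < c)%Z -> 0 < t -> cancelling_kernel (Z.to_nat c) g ->
  (forall n f, part (Csum_nat n f) = Rsum_nat n (fun i => part (f i))) ->
  (forall x z, part (RtoC x * z)%C = x * part z) ->
  Series (fun n => part (eis_term chi1 chi2 (S (S m)) ((IZR a / IZR c)%R, t) n)) =
  moment (dirichlet_coeff g (S m)) (S m) t.
Proof.
  intros g Hc Ht Hg Hsum Hscal. unfold moment, PSeries.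
  rewrite (Series_incr_1 (fun n => _ * _ ^ n)).
  (* E starts at N = 1 and [moment] at N = 0; the extra term carries 0^(m+1) = 0. *)
  - simpl (INR 0). rewrite (pow_i (S m)) by lia. rewrite Rmult_0_r, Rmult_0_l, Rplus_0_l.
    apply Series_ext. intros n. now apply eis_term_part.
  - apply (ex_series_ext (fun n => scal (pow_n (exp (- (2 * PI * t))) n)
      (dirichlet_coeff g (S m) n * INR n ^ S m))).
    { intros n. rewrite pow_n_pow. apply Rmult_comm. }
    apply (ex_pseries_rad1 (fun n => dirichlet_coeff g (S m) n * INR n ^ S m));
      [|now apply exp_neg_Rabs].
    apply rad1_mult_pow. now apply (dirichlet_coeff_rad1 (Z.to_nat c)).
Qed.

(** F vanishes at infinity, so the integral is minus its limit at 0; hence the signs on l. *)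
Lemma is_RInt_gen_primitive (f F : R -> C) (l : C) :
  (forall t, 0 < t -> is_derive (fun t => Re (F t)) t (Re (f t))) ->
  (forall t, 0 < t -> is_derive (fun t => Im (F t)) t (Im (f t))) ->
  (forall t, 0 < t -> continuous (fun t => Re (f t)) t) ->
  (forall t, 0 < t -> continuous (fun t => Im (f t)) t) ->
  filterlim (fun t => Re (F t)) (at_right 0) (locally (- Re l)) ->
  filterlim (fun t => Im (F t)) (at_right 0) (locally (- Im l)) ->
  filterlim (fun t => Re (F t)) (Rbar_locally p_infty) (locally 0) ->
  filterlim (fun t => Im (F t)) (Rbar_locally p_infty) (locally 0) ->
  is_RInt_gen (V := C_R_NormedModule) f (at_right 0) (Rbar_locally p_infty) l.
Proof.
  intros D1 D2 C1 C2 L1 L2 I1 I2 P HP.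
  set (G := fun ab : R * R =>
     ((Re (F (snd ab)) - Re (F (fst ab))), (Im (F (snd ab)) - Im (F (fst ab)))) : C).
  assert (HG : filter_prod (at_right 0) (Rbar_locally p_infty)
     (fun ab => P (G ab))).
  { assert (K : forall (u : R -> R) x, filterlim u (at_right 0) (locally (- x)) ->
       filterlim u (Rbar_locally p_infty) (locally 0) ->
       filterlim (fun ab => u (snd ab) - u (fst ab))
         (filter_prod (at_right 0) (Rbar_locally p_infty)) (locally x)).
    { intros u x Hu Hu'. replace x with (0 + -1 * - x) by ring.
      apply (filterlim_ext (fun ab => u (snd ab) + -1 * u (fst ab))).
      { intros ab. ring. }
      apply filterlim_Rplus; [typeclasses eauto | |].
      - eapply filterlim_comp; [apply filterlim_snd | exact Hu'].
      - apply filterlim_const_mult; [typeclasses eauto|].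
        eapply filterlim_comp; [apply filterlim_fst | exact Hu]. }
    destruct HP as [eps Heps].
    pose proof (proj1 (filterlim_locally _ _) (K _ _ L1 I1) eps) as B1.
    pose proof (proj1 (filterlim_locally _ _) (K _ _ L2 I2) eps) as B2.
    generalize (filter_and _ _ B1 B2). apply filter_imp. intros ab [H1 H2].
    apply Heps. split; assumption. }
  assert (Hpos : filter_prod (at_right 0) (Rbar_locally p_infty)
     (fun ab => 0 < fst ab < snd ab)).
  (* Separating the two ends at 1 gives x < y, hence an interval inside t > 0. *)
  { exists (fun x => 0 < x < 1) (fun y => 1 < y).
    - exists (mkposreal 1 Rlt_0_1). intros y Hy Hy0. split; [exact Hy0|].
      unfold ball in Hy. simpl in Hy. unfold AbsRing_ball, abs, minus, plus, opp in Hy.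
      simpl in Hy. rewrite Ropp_0, Rplus_0_r in Hy. apply Rabs_def2 in Hy. lra.
    - exists 1. auto.
    - intros x y Hx Hy. simpl. lra. }
  unfold filtermapi.
  generalize (filter_and _ _ HG Hpos). apply filter_imp. intros [x y] [H1 H2].
  simpl in H2. exists (G (x, y)). split; [|exact H1]. unfold G. simpl.
  apply (is_RInt_fct_extend_pair (U := R_NormedModule) (V := R_NormedModule)).
  - apply (is_RInt_derive (V := R_CompleteNormedModule) (fun t => Re (F t)) (fun t => Re (f t)));
      intros t; rewrite Rmin_left, Rmax_right by lra; intros Ht; [apply D1 | apply C1]; lra.
  - apply (is_RInt_derive (V := R_CompleteNormedModule) (fun t => Im (F t)) (fun t => Im (f t)));
      intros t; rewrite Rmin_left, Rmax_right by lra; intros Ht; [apply D2 | apply C2]; lra.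
Qed.

(** * The period integral and the Dedekind sum *)


Ltac Rring := match goal with |- ?x = ?y => change (@eq R x y); simpl; ring end.

Definition is_clim (u : nat -> C) (l : C) : Prop :=
  is_lim_seq (fun n => Re (u n)) (Re l) /\ is_lim_seq (fun n => Im (u n)) (Im l).

Lemma is_clim_ext u v l : (forall n, u n = v n) -> is_clim u l -> is_clim v l.
Proof.
  intros H [H1 H2]. split; [revert H1 | revert H2]; apply is_lim_seq_ext; intros n; now rewrite H.
Qed.

Lemma is_clim_scal z u l : is_clim u l -> is_clim (fun n => z * u n)%C (z * l)%C.
Proof.
  intros [H1 H2]. unfold Cmult. split; simpl.
  - apply is_lim_seq_minus'; [apply (is_lim_seq_scal_l _ (fst z) (Finite _) H1)
      | apply (is_lim_seq_scal_l _ (snd z) (Finite _) H2)].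
  - apply is_lim_seq_plus'; [apply (is_lim_seq_scal_l _ (fst z) (Finite _) H2)
      | apply (is_lim_seq_scal_l _ (snd z) (Finite _) H1)].
Qed.

Lemma is_clim_RtoC u (l : R) : is_lim_seq u l -> is_clim (fun n => RtoC (u n)) (RtoC l).
Proof. intros H. split; simpl; [exact H | apply is_lim_seq_const]. Qed.

Lemma is_clim_Csum p (f : nat -> nat -> C) l :
  (forall i, (i < p)%nat -> is_clim (f i) (l i)) ->
  is_clim (fun n => Csum_nat p (fun i => f i n)) (Csum_nat p l).
Proof.
  intros H. split.
  - rewrite Re_Csum. apply (is_lim_seq_ext (fun n => Rsum_nat p (fun i => Re (f i n)))).
    { intros n. now rewrite Re_Csum. }
    apply (is_lim_seq_Rsum_nat p (fun i n => Re (f i n))). intros i Hi. now apply H.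
  - rewrite Im_Csum. apply (is_lim_seq_ext (fun n => Rsum_nat p (fun i => Im (f i n)))).
    { intros n. now rewrite Im_Csum. }
    apply (is_lim_seq_Rsum_nat p (fun i n => Im (f i n))). intros i Hi. now apply H.
Qed.

Lemma is_clim_unique u l l' : is_clim u l -> is_clim u l' -> l = l'.
Proof.
  intros [H1 H2] [H3 H4].
  apply is_lim_seq_unique in H1, H2, H3, H4. rewrite H1 in H3. rewrite H2 in H4.
  injection H3 as H3. injection H4 as H4.
  destruct l, l'. simpl in *. now subst.
Qed.

Lemma Re_scal x z : Re (RtoC x * z)%C = x * Re z.
Proof. unfold Re, Cmult, RtoC. simpl. ring. Qed.

Lemma Im_scal x z : Im (RtoC x * z)%C = x * Im z.
Proof. unfold Im, Cmult, RtoC. simpl. ring. Qed.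

Lemma frac_part_unique x n f : x = IZR n + f -> 0 <= f < 1 -> frac_part x = f.
Proof.
  intros -> Hf. unfold frac_part.
  rewrite <- (Int_part_spec (IZR n + f) n) by lra. ring.
Qed.

Lemma frac_part_eq_0 x : frac_part x = 0 -> x = IZR (Int_part x).
Proof. unfold frac_part. lra. Qed.

Lemma Bper_plus_IZR m x n : Bper m (x + IZR n) = Bper m x.
Proof.
  unfold Bper. destruct (base_fp x) as [H0 H1].
  rewrite (frac_part_unique (x + IZR n) (Int_part x + n) (frac_part x)); [reflexivity| |lra].
  unfold frac_part. rewrite plus_IZR. ring.
Qed.

(** Oddness at the integers rests on the convention that the value there is 0. *)
Lemma Bper_1_opp x : Bper 1 (- x) = - Bper 1 x.
Proof.
  unfold Bper. destruct (base_fp x) as [H0 H1].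
  destruct (Req_EM_T (frac_part x) 0) as [Hz|Hz].
  - rewrite (frac_part_unique (- x) (- Int_part x) 0).
    + destruct (Req_EM_T 0 0); [ring|contradiction].
    + rewrite (frac_part_eq_0 x Hz) at 1. rewrite opp_IZR. ring.
    + lra.
  - rewrite (frac_part_unique (- x) (- Int_part x - 1) (1 - frac_part x)).
    + destruct (Req_EM_T (1 - frac_part x) 0); [lra|].
      rewrite !bernoulli_poly_1. field.
    + unfold frac_part. rewrite minus_IZR, opp_IZR. ring.
    + lra.
Qed.

Lemma Bper_1_unit_interval x : 0 < x < 1 -> Bper 1 x = x - 1 / 2.
Proof.
  intros Hx. unfold Bper. rewrite (frac_part_unique x 0 x); [|ring|lra].
  destruct (Req_EM_T x 0); [lra|]. apply bernoulli_poly_1.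
Qed.

Definition twist_row (chi1 chi2 : Z -> C) (a c A : Z) : C :=
  Csum_nat (Z.to_nat c) (fun j =>
    (RtoC (Bper 1 (IZR (Z.of_nat j) / IZR c)) * twist chi1 chi2 a c A (Z.of_nat j))%C).

(** As the row sums to zero over a period, j/c may be replaced by j/c - 1/2, which is B_1(j/c) for 0
    < j < c. The term j = 0 vanishes on both sides because the kernel does. *)
Lemma abel_value_twist chi1 chi2 a c (A : nat) (part : C -> R) :
  let g := fun A B : nat => part (twist chi1 chi2 a c (Z.of_nat A) (Z.of_nat B)) in
  (0 < c)%Z -> cancelling_kernel (Z.to_nat c) g ->
  (forall n f, part (Csum_nat n f) = Rsum_nat n (fun i => part (f i))) ->
  (forall x z, part (RtoC x * z)%C = x * part z) ->
  abel_value (Z.to_nat c) (g A) = - part (twist_row chi1 chi2 a c (Z.of_nat A)).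
Proof.
  intros g Hc (_ & _ & _ & H0 & Hw & _) Hsum Hscal.
  assert (Hs : Rsum_nat (Z.to_nat c) (g A) = 0).
  { rewrite <- (Hw A 0%nat). apply Rsum_nat_ext. reflexivity. }
  assert (Hc0 : 0 < IZR c) by (apply IZR_lt; lia).
  rewrite abel_value_spec by exact Hs. unfold twist_row. rewrite Hsum.
  replace (INR (Z.to_nat c)) with (IZR c) by (rewrite INR_IZR_INZ; f_equal; lia).
  match goal with |- - ?x / _ = _ =>
    replace (- x / IZR c) with (- (/ IZR c * x + - (1 / 2) * Rsum_nat (Z.to_nat c) (g A)))
      by (rewrite Hs; field; lra) end.
  f_equal. rewrite <- !Rsum_nat_scal, <- Rsum_nat_plus.
  apply Rsum_nat_ext. intros j Hj. rewrite Hscal.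
  change (part (twist chi1 chi2 a c (Z.of_nat A) (Z.of_nat j))) with (g A j).
  destruct (Nat.eq_dec j 0) as [->|Hj0]; [rewrite H0; ring|].
  rewrite INR_IZR_INZ, Bper_1_unit_interval; [field; lra|].
  assert (0 < IZR (Z.of_nat j)) by (apply IZR_lt; lia).
  split; [apply Rdiv_lt_0_compat; lra|].
  apply Rlt_div_l; [exact Hc0|]. rewrite Rmult_1_l. apply IZR_lt. lia.
Qed.

Lemma Cpow_imag t n : Cpow (0, t) n = (Cpow Ci n * RtoC (t ^ n))%C.
Proof.
  induction n as [|n IH]; simpl.
  - ring.
  - rewrite IH, RtoC_mult. replace (0, t) with (Ci * RtoC t)%C.
    + ring.
    + unfold Cmult, Ci, RtoC. simpl. f_equal; ring.
Qed.

(** On z = a/c + it the polynomial is (it)^m and dz = i dt, which gives i^(m+1); the minus sign is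
    the downward direction and the 2 that of E. *)
Lemma period_phi_value chi1 chi2 q1 q2 m a b c d :
  is_dirichlet_char q1 chi1 -> is_dirichlet_char q2 chi2 -> (1 < q1)%Z -> (1 < q2)%Z ->
  in_Gamma0 (q1 * q2) a b c d -> (0 < c)%Z ->
  exists V : C,
    is_clim (fun P => Csum_nat (Z.to_nat c * P) (fun i =>
      RtoC (- (INR (fact m) / (2 * PI) ^ S m / INR (S i) ^ S m)) *
      twist_row chi1 chi2 a c (Z.of_nat (S i))))%C V /\
    period_phi chi1 chi2 (S (S m)) a c (RtoC 1) (RtoC (- (IZR a / IZR c))) =
      (- Cpow Ci (S m) * (RtoC 2 * V))%C.
Proof.
  intros H1 H2 Hq1 Hq2 HG Hc.
  pose proof (twist_kernel chi1 chi2 q1 q2 a b c d Re H1 H2 Hq1 Hq2 HG Hc Rabs_Re_le_Cmod Re_Csum) as Kr.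
  pose proof (twist_kernel chi1 chi2 q1 q2 a b c d Im H1 H2 Hq1 Hq2 HG Hc Rabs_Im_le_Cmod Im_Csum) as Ki.
  destruct (period_primitive_lim_0 _ _ m Kr) as [Vr [HVr Lr]].
  destruct (period_primitive_lim_0 _ _ m Ki) as [Vi [HVi Li]].
  pose proof (period_primitive_lim_infty _ _ m Kr) as Ir.
  pose proof (period_primitive_lim_infty _ _ m Ki) as Ii.
  set (br := dirichlet_coeff (fun A B => Re (twist chi1 chi2 a c (Z.of_nat A) (Z.of_nat B))) (S m)) in *.
  set (bi := dirichlet_coeff (fun A B => Im (twist chi1 chi2 a c (Z.of_nat A) (Z.of_nat B))) (S m)) in *.
  exists (Vr, Vi). split.
  { split; simpl.
    - revert HVr. apply is_lim_seq_ext. intros P.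
      change (Rsum_nat (Z.to_nat c * P) (fun i : nat =>
        INR (fact m) / (2 * PI) ^ S m * (abel_value (Z.to_nat c)
          (fun B => Re (twist chi1 chi2 a c (Z.of_nat (S i)) (Z.of_nat B))) / INR (S i) ^ S m)) = Re
        (Csum_nat (Z.to_nat c * P) (fun i =>
      RtoC (- (INR (fact m) / (2 * PI) ^ S m / INR (S i) ^ S m)) *
      twist_row chi1 chi2 a c (Z.of_nat (S i)))%C)).
      rewrite Re_Csum. apply Rsum_nat_ext. intros i _. rewrite Re_scal.
      rewrite (abel_value_twist chi1 chi2 a c (S i) Re Hc Kr Re_Csum Re_scal).
      unfold Rdiv. ring.
    - revert HVi. apply is_lim_seq_ext. intros P.
      change (Rsum_nat (Z.to_nat c * P) (fun i : nat =>
        INR (fact m) / (2 * PI) ^ S m * (abel_value (Z.to_nat c)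
          (fun B => Im (twist chi1 chi2 a c (Z.of_nat (S i)) (Z.of_nat B))) / INR (S i) ^ S m)) = Im
        (Csum_nat (Z.to_nat c * P) (fun i =>
      RtoC (- (INR (fact m) / (2 * PI) ^ S m / INR (S i) ^ S m)) *
      twist_row chi1 chi2 a c (Z.of_nat (S i)))%C)).
      rewrite Im_Csum. apply Rsum_nat_ext. intros i _. rewrite Im_scal.
      rewrite (abel_value_twist chi1 chi2 a c (S i) Im Hc Ki Im_Csum Im_scal).
      unfold Rdiv. ring. }
  set (kap := (- Cpow Ci (S m) * RtoC 2)%C).
  rewrite Cmult_assoc. fold kap.
  set (Gr := iter_prim (moment br) (S m)) in *. set (Gi := iter_prim (moment bi) (S m)) in *.
  assert (Hrr : rad1 br) by exact (dirichlet_coeff_rad1 _ _ _ Kr).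
  assert (Hri : rad1 bi) by exact (dirichlet_coeff_rad1 _ _ _ Ki).
  assert (Dr : forall t, 0 < t -> is_derive Gr t (- (t ^ m * moment br (S m) t))).
  { intros t Ht. apply (is_derive_iter_prim (moment br) (S m)). intros l. now apply is_derive_moment. }
  assert (Di : forall t, 0 < t -> is_derive Gi t (- (t ^ m * moment bi (S m) t))).
  { intros t Ht. apply (is_derive_iter_prim (moment bi) (S m)). intros l. now apply is_derive_moment. }
  assert (Hcont : forall b, rad1 b -> forall t, 0 < t -> continuous (fun t => t ^ m * moment b (S m) t) t).
  { intros b' Hb t Ht. apply (continuous_mult (K := R_AbsRing) (fun t => t ^ m)).
    - apply continuous_pow_R.
    - apply (ex_derive_continuous (V := R_NormedModule)). eexists. now apply is_derive_moment. }
  unfold period_phi.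
  assert (Hfun : forall t, 0 < t ->
    (- (Ci * (Eisenstein chi1 chi2 (S (S m)) ((IZR a / IZR c)%R, t) *
        Cpow (RtoC 1 * (((IZR a / IZR c)%R, t) : C) + RtoC (- (IZR a / IZR c))) (S (S m) - 2))))%C
    = (kap * (t ^ m * moment br (S m) t, t ^ m * moment bi (S m) t)%R)%C).
  { intros t Ht. unfold Eisenstein.
    rewrite (Series_eis_part chi1 chi2 m a c t Re Hc Ht Kr Re_Csum Re_scal).
    rewrite (Series_eis_part chi1 chi2 m a c t Im Hc Ht Ki Im_Csum Im_scal).
    fold br bi.
    replace (RtoC 1 * (((IZR a / IZR c)%R, t) : C) + RtoC (- (IZR a / IZR c)))%C with ((0, t) : C).
    2:{ unfold Cmult, Cplus, RtoC. simpl. f_equal; ring. }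
    replace (S (S m) - 2)%nat with m by lia. rewrite Cpow_imag.
    replace ((t ^ m * moment br (S m) t)%R, (t ^ m * moment bi (S m) t)%R)
      with (RtoC (t ^ m) * ((moment br (S m) t, moment bi (S m) t) : C))%C.
    2:{ unfold Cmult, RtoC. simpl. f_equal; ring. }
    unfold kap. simpl Cpow. ring. }
  apply (is_RInt_gen_unique (V := C_R_CompleteNormedModule)).
  apply (is_RInt_gen_ext (V := C_R_NormedModule)
    (fun t => (kap * (t ^ m * moment br (S m) t, t ^ m * moment bi (S m) t)%R)%C)).
  { exists (fun x => 0 < x) (fun y => 0 < y).
    - exists (mkposreal 1 Rlt_0_1). auto.
    - exists 0. auto.
    - intros x y Hx Hy t Ht. symmetry. apply Hfun. simpl in Ht.
      eapply Rlt_trans; [|apply Ht]. now apply Rmin_glb_lt. }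
  destruct kap as [k1 k2].
  (* The minus sign is there because [iter_prim] is a tail integral: its derivative is minus the
     integrand. *)
  apply (is_RInt_gen_primitive _ (fun t => (- (((k1, k2) : C) * ((Gr t, Gi t) : C)))%C)).
  - intros t Ht. simpl.
    apply (is_derive_ext (fun t => - k1 * Gr t + k2 * Gi t)); [intros; Rring|].
    replace (k1 * _ - _) with (- k1 * (- (t ^ m * moment br (S m) t)) + k2 * (- (t ^ m * moment bi (S m) t))) by ring.
    apply (is_derive_plus (V := R_NormedModule)); apply is_derive_scal; auto.
  - intros t Ht. simpl.
    apply (is_derive_ext (fun t => - k1 * Gi t + - k2 * Gr t)); [intros; Rring|].
    replace (k1 * _ + _) with (- k1 * (- (t ^ m * moment bi (S m) t)) + - k2 * (- (t ^ m * moment br (S m) t))) by ring.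
    apply (is_derive_plus (V := R_NormedModule)); apply is_derive_scal; auto.
  - intros t Ht. simpl. apply (continuous_minus (V := R_NormedModule));
      apply (continuous_scal_r (V := R_NormedModule)); auto.
  - intros t Ht. simpl. apply (continuous_plus (V := R_NormedModule));
      apply (continuous_scal_r (V := R_NormedModule)); auto.
  - apply (filterlim_ext (fun t => - k1 * Gr t + k2 * Gi t)); [intros; simpl; ring|].
    simpl. replace (- (k1 * Vr - k2 * Vi)) with (- k1 * Vr + k2 * Vi) by ring.
    apply filterlim_Rplus; [typeclasses eauto | |]; (apply filterlim_const_mult; [typeclasses eauto|]; assumption).
  - apply (filterlim_ext (fun t => - k1 * Gi t + - k2 * Gr t)); [intros; simpl; ring|].
    simpl. replace (- (k1 * Vi + k2 * Vr)) with (- k1 * Vi + - k2 * Vr) by ring.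
    apply filterlim_Rplus; [typeclasses eauto | |]; (apply filterlim_const_mult; [typeclasses eauto|]; assumption).
  - apply (filterlim_ext (fun t => - k1 * Gr t + k2 * Gi t)); [intros; simpl; ring|].
    replace 0 with (- k1 * 0 + k2 * 0) by ring.
    apply filterlim_Rplus; [typeclasses eauto | |]; (apply filterlim_const_mult; [typeclasses eauto|]; assumption).
  - apply (filterlim_ext (fun t => - k1 * Gi t + - k2 * Gr t)); [intros; simpl; ring|].
    replace 0 with (- k1 * 0 + - k2 * 0) by ring.
    apply filterlim_Rplus; [typeclasses eauto | |]; (apply filterlim_const_mult; [typeclasses eauto|]; assumption).
Qed.

Definition dedekind_weight (chi1 chi2 : Z -> C) (c j n : Z) : C :=
  (Cconj (chi1 n) * Cconj (chi2 j) * RtoC (Bper 1 (IZR j / IZR c)))%C.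

Definition dedekind_arg (a c q1 j n : Z) : R := IZR a * IZR j / IZR c + IZR n / IZR q1.

(** The Gauss sum trades chi1(A) for additive characters, so that A occurs only in e(A x): the sum
    over A becomes a Fourier series at x = [dedekind_arg]. *)
Lemma gauss_sum_twist_row chi1 chi2 q1 a c (A : Z) :
  primitive_char q1 chi1 -> (0 < c)%Z ->
  (gauss_sum q1 (fun n => Cconj (chi1 n)) * twist_row chi1 chi2 a c A)%C =
  Csum_nat (Z.to_nat c) (fun j => Csum_nat (Z.to_nat q1) (fun n =>
    (dedekind_weight chi1 chi2 c (Z.of_nat j) (Z.of_nat n) *
     e (RtoC (IZR A * dedekind_arg a c q1 (Z.of_nat j) (Z.of_nat n))))%C)).
Proof.
  intros H1 Hc. pose proof H1 as [[Hq1 _] _].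
  unfold twist_row. rewrite <- Csum_nat_scal. apply Csum_nat_ext. intros j _.
  unfold twist.
  set (z := (RtoC (Bper 1 (IZR (Z.of_nat j) / IZR c)) * Cconj (chi2 (Z.of_nat j)) *
     e (RtoC (IZR (A * Z.of_nat j * a) / IZR c)))%C).
  transitivity (z * (chi1 A * gauss_sum q1 (fun n => Cconj (chi1 n))))%C.
  { unfold z. ring. }
  rewrite gauss_sum_twist by exact H1. rewrite <- Csum_nat_scal. apply Csum_nat_ext.
  intros n _. unfold dedekind_weight, z, dedekind_arg.
  replace (IZR A * (IZR a * IZR (Z.of_nat j) / IZR c + IZR (Z.of_nat n) / IZR q1))
    with (IZR (A * Z.of_nat j * a) / IZR c + IZR (Z.of_nat n * A) / IZR q1).
  - rewrite e_plus. ring.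
  - rewrite !mult_IZR. field. split; apply not_0_IZR; lia.
Qed.

Lemma Cpow_Ci n : Cpow Ci n = (cos (INR n * (PI / 2)), sin (INR n * (PI / 2))).
Proof.
  induction n as [|n IH].
  - simpl. rewrite Rmult_0_l, cos_0, sin_0. reflexivity.
  - rewrite S_INR, Rmult_plus_distr_r, Rmult_1_l, cos_plus, sin_plus, cos_PI2, sin_PI2.
    simpl Cpow. rewrite IH. unfold Cmult, Ci. simpl. f_equal; ring.
Qed.

Lemma cos_sin_INR_PI n : cos (INR n * PI) = (-1) ^ n /\ sin (INR n * PI) = 0.
Proof.
  induction n as [|n [IH1 IH2]].
  - simpl. rewrite Rmult_0_l, cos_0, sin_0. auto.
  - rewrite S_INR, Rmult_plus_distr_r, Rmult_1_l, cos_plus, sin_plus, cos_PI, sin_PI, IH1, IH2.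
    simpl. split; ring.
Qed.

(** Since i^m = e(m/4), the two terms are i^m e(y - m/4) and i^m e(-(y - m/4)). *)
Lemma e_symmetrize m y :
  (e (RtoC y) + RtoC ((-1) ^ m) * e (RtoC (- y)))%C =
  (RtoC 2 * (Cpow Ci m * RtoC (cos (2 * PI * y - INR m * (PI / 2)))))%C.
Proof.
  rewrite e_conj, e_RtoC, Cpow_Ci. destruct (cos_sin_INR_PI m) as [E1 E2].
  set (th := 2 * PI * y). set (al := INR m * (PI / 2)) in *.
  replace (INR m * PI) with (al + al) in * by (unfold al; field).
  rewrite cos_plus in E1. rewrite sin_plus in E2. rewrite <- E1, cos_minus.
  pose proof (sin2_cos2 al) as E3. unfold Rsqr in E3.
  unfold Cplus, Cmult, Cconj, RtoC. simpl.
  generalize dependent (cos al). generalize (sin al). intros s co E1 E2 E3.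
  f_equal.
  - transitivity ((s * s + co * co) * cos th + (co * co - s * s) * cos th
      + (s * co + co * s) * sin th); [rewrite E2, E3; ring | ring].
  - transitivity ((s * s + co * co) * sin th - (co * co - s * s) * sin th
      + (s * co + co * s) * cos th); [rewrite E2, E3; ring | ring].
Qed.

Lemma Csum_reflect2 (p q : nat) (F : Z -> Z -> C) :
  (forall j n, F (j + Z.of_nat p)%Z n = F j n) -> (forall j n, F j (n + Z.of_nat q)%Z = F j n) ->
  Csum_nat p (fun j => Csum_nat q (fun n => F (- Z.of_nat j) (- Z.of_nat n))%Z) =
  Csum_nat p (fun j => Csum_nat q (fun n => F (Z.of_nat j) (Z.of_nat n))).
Proof.
  intros Hp Hq.
  assert (Hg : forall r, Z.gcd (-1) (Z.of_nat r) = 1%Z).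
  { intros r. change (-1)%Z with (- (1))%Z. rewrite Z.gcd_opp_l. apply Z.gcd_1_l. }
  rewrite <- (Csum_affine p (fun j => Csum_nat q (fun n => F j (Z.of_nat n))) (-1) 0); auto.
  - apply Csum_nat_ext. intros j _.
    rewrite <- (Csum_affine q (fun n => F (-1 * Z.of_nat j + 0)%Z n) (-1) 0); auto.
    apply Csum_nat_ext. intros n _. f_equal; lia.
  - intros j. apply Csum_nat_ext. auto.
Qed.

(** Under (j, n) -> (-j, -n) the characters give (-1)^(m+1) and the odd B_1 one more sign. Averaging
    the sum with its reflection therefore turns e into the phase-shifted cosine of [trig_sum]. Here
    m is k - 1. *)
Lemma dedekind_sum_parity chi1 chi2 q1 q2 m a b c d A :
  is_dirichlet_char q1 chi1 -> is_dirichlet_char q2 chi2 ->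
  (chi1 (-1)%Z * chi2 (-1)%Z)%C = RtoC ((-1) ^ S m) ->
  in_Gamma0 (q1 * q2) a b c d -> (0 < c)%Z ->
  Csum_nat (Z.to_nat c) (fun j => Csum_nat (Z.to_nat q1) (fun n =>
    (dedekind_weight chi1 chi2 c (Z.of_nat j) (Z.of_nat n) *
     e (RtoC (IZR A * dedekind_arg a c q1 (Z.of_nat j) (Z.of_nat n))))%C)) =
  Csum_nat (Z.to_nat c) (fun j => Csum_nat (Z.to_nat q1) (fun n =>
    (dedekind_weight chi1 chi2 c (Z.of_nat j) (Z.of_nat n) *
     (Cpow Ci m * RtoC (cos (2 * PI * (IZR A * dedekind_arg a c q1 (Z.of_nat j) (Z.of_nat n))
        - INR m * (PI / 2)))))%C)).
Proof.
  intros H1 H2 Hpar [_ [w Hw]] Hc. pose proof H1 as (Hq1 & _).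
  assert (HcR : IZR c <> 0) by (apply not_0_IZR; lia).
  assert (Hq1R : IZR q1 <> 0) by (apply not_0_IZR; lia).
  set (F := fun j n => (dedekind_weight chi1 chi2 c j n *
    e (RtoC (IZR A * dedekind_arg a c q1 j n)))%C).
  assert (Hneg : forall j n, F (- j)%Z (- n)%Z =
    (dedekind_weight chi1 chi2 c j n * (RtoC ((-1) ^ m) *
      e (RtoC (- (IZR A * dedekind_arg a c q1 j n)))))%C).
  { intros j n. unfold F, dedekind_weight.
    replace (- n)%Z with (-1 * n)%Z by ring. replace (- j)%Z with (-1 * j)%Z by ring.
    rewrite (char_conj_mult q1) by exact H1. rewrite (char_conj_mult q2) by exact H2.
    replace (IZR A * dedekind_arg a c q1 (-1 * j) (-1 * n)) with
      (- (IZR A * dedekind_arg a c q1 j n)).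
    2:{ unfold dedekind_arg. rewrite !mult_IZR. field. auto. }
    replace (IZR (-1 * j) / IZR c) with (- (IZR j / IZR c)).
    2:{ rewrite mult_IZR. field. exact HcR. }
    rewrite Bper_1_opp, RtoC_opp.
    assert (E : (Cconj (chi1 (-1)%Z) * Cconj (chi2 (-1)%Z))%C = (- RtoC ((-1) ^ m))%C).
    { rewrite <- Cmult_conj, Hpar. simpl. unfold Cconj, RtoC, Copp. simpl. f_equal; ring. }
    transitivity ((Cconj (chi1 (-1)%Z) * Cconj (chi2 (-1)%Z)) *
      (- (Cconj (chi1 n) * Cconj (chi2 j) * RtoC (Bper 1 (IZR j / IZR c)) *
       e (RtoC (- (IZR A * dedekind_arg a c q1 j n))))))%C; [ring|].
    rewrite E. ring. }
  assert (HFj : forall j n, F (j + Z.of_nat (Z.to_nat c))%Z n = F j n).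
  { intros j n. rewrite Z2Nat.id by lia. unfold F, dedekind_weight.
    f_equal; [f_equal; [f_equal; f_equal|f_equal]|].
    - rewrite <- (char_periodic q2 chi2 (w * q1) j H2). f_equal. lia.
    - rewrite <- (Bper_plus_IZR 1 (IZR j / IZR c) 1). f_equal. rewrite plus_IZR. now field.
    - replace (IZR A * dedekind_arg a c q1 (j + c) n)
        with (IZR A * dedekind_arg a c q1 j n + IZR (A * a)).
      + rewrite e_plus, e_IZR. ring.
      + unfold dedekind_arg. rewrite plus_IZR, mult_IZR. now field. }
  assert (HFn : forall j n, F j (n + Z.of_nat (Z.to_nat q1))%Z = F j n).
  { intros j n. rewrite Z2Nat.id by lia. unfold F, dedekind_weight.
    f_equal; [f_equal; f_equal; f_equal|].
    - apply (proj1 (proj2 (proj2 H1))).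
    - replace (IZR A * dedekind_arg a c q1 j (n + q1))
        with (IZR A * dedekind_arg a c q1 j n + IZR A).
      + rewrite e_plus, e_IZR. ring.
      + unfold dedekind_arg. rewrite plus_IZR. now field. }
  set (X := Csum_nat _ _ : C) at 1. set (Y := Csum_nat _ _).
  assert (E : (X + X = RtoC 2 * Y)%C).
  { unfold X at 2. change (Csum_nat (Z.to_nat c) _) with
      (Csum_nat (Z.to_nat c) (fun j => Csum_nat (Z.to_nat q1) (fun n => F (Z.of_nat j) (Z.of_nat n)))).
    rewrite <- Csum_reflect2 by assumption.
    unfold X, Y. rewrite <- Csum_nat_plus, <- Csum_nat_scal. apply Csum_nat_ext. intros j _.
    rewrite <- Csum_nat_plus, <- Csum_nat_scal. apply Csum_nat_ext. intros n _.
    rewrite Hneg.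
    set (W := dedekind_weight _ _ _ _ _). set (y := IZR A * _).
    transitivity (W * (e (RtoC y) + RtoC ((-1) ^ m) * e (RtoC (- y))))%C; [ring|].
    rewrite e_symmetrize. ring. }
  replace X with (/ RtoC 2 * (X + X))%C.
  - rewrite E, Cmult_assoc, Cinv_l; [ring|]. intros H. injection H. lra.
  - replace (X + X)%C with (RtoC 2 * X)%C by (unfold RtoC, Cmult, Cplus; simpl; f_equal; ring).
    rewrite Cmult_assoc, Cinv_l; [ring|]. intros H. injection H. lra.
Qed.

(** Stated for finite P, so that only finite sums are exchanged and the limit is taken
    afterwards. *)
Lemma gauss_sum_row_partial chi1 chi2 q1 q2 m a b c d (kap : R) P :
  primitive_char q1 chi1 -> is_dirichlet_char q2 chi2 ->
  (chi1 (-1)%Z * chi2 (-1)%Z)%C = RtoC ((-1) ^ S m) ->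
  in_Gamma0 (q1 * q2) a b c d -> (0 < c)%Z ->
  (gauss_sum q1 (fun n => Cconj (chi1 n)) * Csum_nat P (fun i =>
      RtoC (- (kap / INR (S i) ^ m)) * twist_row chi1 chi2 a c (Z.of_nat (S i))))%C =
  Csum_nat (Z.to_nat c) (fun j => Csum_nat (Z.to_nat q1) (fun n =>
    (RtoC (- kap) * Cpow Ci m * dedekind_weight chi1 chi2 c (Z.of_nat j) (Z.of_nat n) *
     RtoC (trig_sum m P (dedekind_arg a c q1 (Z.of_nat j) (Z.of_nat n))))%C)).
Proof.
  intros H1 H2 Hpar HG Hc.
  rewrite <- Csum_nat_scal.
  rewrite (Csum_nat_ext P _ (fun i => Csum_nat (Z.to_nat c) (fun j => Csum_nat (Z.to_nat q1) (fun n =>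
    (RtoC (- kap) * Cpow Ci m * dedekind_weight chi1 chi2 c (Z.of_nat j) (Z.of_nat n) *
     RtoC (cos (2 * PI * INR (S i) * dedekind_arg a c q1 (Z.of_nat j) (Z.of_nat n)
        - INR m * (PI / 2)) / INR (S i) ^ m))%C)))).
  - rewrite Csum_nat_swap. apply Csum_nat_ext. intros j _.
    rewrite Csum_nat_swap. apply Csum_nat_ext. intros n _.
    rewrite Csum_nat_scal. f_equal. rewrite Csum_nat_pair. unfold RtoC at 3. unfold trig_sum.
    f_equal. now apply Rsum_nat_0.
  - intros i _.
    assert (Hi : INR (S i) ^ m <> 0) by (apply pow_nonzero, not_0_INR; lia).
    transitivity (RtoC (- (kap / INR (S i) ^ m)) *
      (gauss_sum q1 (fun n => Cconj (chi1 n)) * twist_row chi1 chi2 a c (Z.of_nat (S i))))%C; [ring|].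
    rewrite gauss_sum_twist_row by assumption.
    rewrite (dedekind_sum_parity chi1 chi2 q1 q2 m a b c d) by (assumption || apply H1).
    rewrite <- Csum_nat_scal. apply Csum_nat_ext. intros j _.
    rewrite <- Csum_nat_scal. apply Csum_nat_ext. intros n _.
    rewrite <- INR_IZR_INZ, <- Rmult_assoc.
    set (y := cos _).
    replace (- (kap / INR (S i) ^ m)) with (- kap * / INR (S i) ^ m) by (field; exact Hi).
    unfold Rdiv. rewrite !RtoC_mult. ring.
Qed.

(** If the argument were an integer N, then a j + n c/q1 = N c. Since q2 divides both c/q1 and c,
    and is coprime to a, it would divide j. *)
Lemma dedekind_arg_not_integer chi2 q1 q2 a b c d (j n : Z) :
  is_dirichlet_char q2 chi2 -> (0 < q1)%Z -> (1 < q2)%Z ->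
  in_Gamma0 (q1 * q2) a b c d -> (0 < c)%Z ->
  chi2 j <> RtoC 0 -> frac_part (dedekind_arg a c q1 j n) <> 0.
Proof.
  intros H2 Hq1 Hq2 [Hdet [w Hw]] Hc Hj H. apply Hj.
  apply frac_part_eq_0 in H. set (N := Int_part _) in H.
  apply (char_dvd_0 q2 chi2 j H2 Hq2).
  assert (HN : (a * j + n * (q2 * w) = N * c)%Z).
  { apply eq_IZR. rewrite plus_IZR, !mult_IZR, <- H. unfold dedekind_arg.
    assert (E : IZR c = IZR q1 * (IZR q2 * IZR w)) by (rewrite Hw, !mult_IZR; ring).
    assert (IZR c <> 0) by (apply not_0_IZR; lia).
    assert (IZR q1 <> 0) by (apply not_0_IZR; lia).
    replace (IZR q2 * IZR w) with (IZR c / IZR q1) by (rewrite E; field; auto).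
    field. auto. }
  apply (Z.gauss q2 a j).
  - exists (N * (q1 * w) - n * w)%Z. nia.
  - apply Znumtheory.Zgcd_1_rel_prime. apply rel_prime_sym, bezout_rel_prime.
    apply (Bezout_intro _ _ _ d (- (b * w * q1))%Z). nia.
Qed.

Theorem theorem1p7 (k : nat) (chi1 chi2 : Z -> C) (q1 q2 : Z) (a b c d : Z) :
  (2 <= k)%nat ->
  primitive_char q1 chi1 -> nontrivial_char chi1 ->
  primitive_char q2 chi2 -> nontrivial_char chi2 ->
  (chi1 (-1)%Z * chi2 (-1)%Z)%C = RtoC ((-1) ^ k) ->
  in_Gamma0 (q1 * q2) a b c d ->
  (0 < c)%Z ->
  S_sum chi1 chi2 q1 k a c =
  Csum_nat (Z.to_nat c) (fun j =>
    Csum_nat (Z.to_nat q1) (fun n =>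
      (Cconj (chi1 (Z.of_nat n)) * Cconj (chi2 (Z.of_nat j))
       * RtoC (Bper 1 (INR j / IZR c))
       * RtoC (Bper (k - 1) (IZR a * INR j / IZR c + INR n / IZR q1)))%C)).
Proof.
  intros Hk P1 N1 P2 N2 Hpar HG Hc.
  destruct k as [|[|m]]; [lia|lia|].
  pose proof P1 as [H1 _]. pose proof P2 as [H2 _].
  pose proof (nontrivial_modulus q1 chi1 H1 N1) as Hq1.
  pose proof (nontrivial_modulus q2 chi2 H2 N2) as Hq2.
  destruct (period_phi_value chi1 chi2 q1 q2 m a b c d H1 H2 Hq1 Hq2 HG Hc) as [V [HV HphiV]].
  set (kap := INR (fact m) / (2 * PI) ^ S m) in HV.
  set (tau := gauss_sum q1 (fun n => Cconj (chi1 n))).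
  set (T := Csum_nat (Z.to_nat c) (fun j => Csum_nat (Z.to_nat q1) (fun n =>
    (dedekind_weight chi1 chi2 c (Z.of_nat j) (Z.of_nat n) *
     RtoC (Bper (S m) (dedekind_arg a c q1 (Z.of_nat j) (Z.of_nat n))))%C))).
  (* The partial sums that define V, multiplied by tau, are computed a second time through Fourier
     series; the limits must agree. *)
  assert (Hlim : (tau * V)%C = (Cpow Ci (S m) * RtoC (/ (2 * INR (S m))) * T)%C).
  { eapply is_clim_unique; [apply is_clim_scal, HV|].
    eapply is_clim_ext.
    { intros P. symmetry. unfold tau.
      apply (gauss_sum_row_partial chi1 chi2 q1 q2 (S m) a b c d kap); assumption. }
    unfold T. rewrite <- Csum_nat_scal.
    apply (is_clim_Csum (Z.to_nat c) (fun j P => Csum_nat (Z.to_nat q1) (fun n =>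
      (RtoC (- kap) * Cpow Ci (S m) * dedekind_weight chi1 chi2 c (Z.of_nat j) (Z.of_nat n) *
       RtoC (trig_sum (S m) (Z.to_nat c * P) (dedekind_arg a c q1 (Z.of_nat j) (Z.of_nat n))))%C))).
    intros j _. rewrite <- Csum_nat_scal.
    apply (is_clim_Csum (Z.to_nat q1) (fun n P =>
      (RtoC (- kap) * Cpow Ci (S m) * dedekind_weight chi1 chi2 c (Z.of_nat j) (Z.of_nat n) *
       RtoC (trig_sum (S m) (Z.to_nat c * P) (dedekind_arg a c q1 (Z.of_nat j) (Z.of_nat n))))%C)).
    intros n _. set (W := dedekind_weight _ _ _ _ _).
    set (x := dedekind_arg _ _ _ _ _).
    destruct (Ceq_dec (chi2 (Z.of_nat j)) 0) as [Hz|Hz].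
    (* Here x may be an integer, where the Fourier limit need not be the conventional value 0 of
       [Bper]; the weight removes the term. *)
    - assert (HW : W = RtoC 0).
      { unfold W, dedekind_weight. rewrite Hz.
        replace (Cconj 0) with (RtoC 0) by (unfold Cconj, RtoC; simpl; now rewrite Ropp_0). ring. }
      rewrite HW.
      apply (is_clim_ext (fun P => RtoC 0 * RtoC 0)%C); [intros; ring|].
      replace (_ * (0 * _))%C with (RtoC 0 * RtoC 0)%C by ring.
      apply is_clim_scal, is_clim_RtoC, is_lim_seq_const.
    - replace (Cpow Ci (S m) * RtoC (/ (2 * INR (S m))) * (W * RtoC (Bper (S m) x)))%C
        with (RtoC (- kap) * Cpow Ci (S m) * W *
          RtoC (- ((2 * PI) ^ S m / (2 * INR (fact (S m)))) * Bper (S m) x))%C.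
      + apply is_clim_scal, is_clim_RtoC.
        apply (is_lim_seq_subseq_mul (fun N => trig_sum (S m) N x)); [lia|].
        apply trig_sum_lim; [lia|].
        apply (dedekind_arg_not_integer chi2 q1 q2 a b c d); auto. lia.
      + rewrite RtoC_mult.
        (* The factorial and the powers of 2 PI of the two expansions cancel, leaving 1 / (2 (k -
           1)). *)
        replace (RtoC (/ (2 * INR (S m)))) with
          (RtoC (- kap) * RtoC (- ((2 * PI) ^ S m / (2 * INR (fact (S m))))))%C; [ring|].
        rewrite <- RtoC_mult. f_equal. unfold kap. rewrite fact_simpl, mult_INR. field.
        repeat split; try apply INR_fact_neq_0; try apply not_0_INR; try lia.
        apply pow_nonzero. pose proof PI_RGT_0. lra. }
  transitivity T.
  - unfold S_sum. fold tau. rewrite HphiV.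
    assert (Hm : INR (S m) <> 0) by (apply not_0_INR; lia).
    replace (INR (S (S m)) - 1) with (INR (S m)) by (rewrite (S_INR (S m)); ring).
    transitivity (RtoC ((-1) ^ S (S m)) * RtoC (INR (S m)) * (- Cpow Ci (S m)) * RtoC 2 * (tau * V))%C;
      [ring|].
    rewrite Hlim.
    (* One factor i^(m+1) comes from the path, the other from the parity step. *)
    assert (Hi : (Cpow Ci (S m) * Cpow Ci (S m))%C = RtoC ((-1) ^ S m)).
    { generalize (S m). intros p. induction p as [|p IH]; simpl; [ring|].
      transitivity ((Ci * Ci) * (Cpow Ci p * Cpow Ci p))%C; [ring|].
      rewrite IH, RtoC_mult. f_equal. unfold Cmult, Ci, RtoC. simpl. f_equal; ring. }
    transitivity (- (RtoC ((-1) ^ S (S m)) * (Cpow Ci (S m) * Cpow Ci (S m))) *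
      (RtoC (INR (S m)) * RtoC 2 * RtoC (/ (2 * INR (S m)))) * T)%C; [ring|].
    rewrite Hi, <- !RtoC_mult.
    replace (INR (S m) * 2 * / (2 * INR (S m))) with 1 by (field; exact Hm).
    (* The total exponent 2m + 3 is odd; the resulting sign cancels that of the downward path. *)
    replace ((-1) ^ S (S m) * (-1) ^ S m) with (-1).
    + unfold RtoC, Cmult, Copp. destruct T as [t1 t2]. simpl. f_equal; ring.
    + rewrite <- pow_add. replace (S (S m) + S m)%nat with (S (2 * S m)) by lia.
      symmetry. apply pow_1_odd.
  - unfold T. apply Csum_nat_ext. intros j _. apply Csum_nat_ext. intros n _.
    unfold dedekind_weight, dedekind_arg. rewrite !INR_IZR_INZ.
    replace (S (S m) - 1)%nat with (S m) by lia. reflexivity.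
Qed.
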